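(* Let $0<p\le\infty$, $0<q<\infty$ and $0<\alpha<\infty$. (a) For every semigroup of analytic functions $(\varphi_t)_{t\ge0}$ in $\mathbb{D}$, the composition operators $C_tf=f\circ\varphi_t$ form a strongly continuous semigroup of operators on $H(p,q,\alpha)$, i.e. $\lim_{t\to0^+}\|f\circ\varphi_t-f\|_{p,q,\alpha}=0$ for every $f\in H(p,q,\alpha)$. (b) No non-trivial semigroup of analytic functions induces a uniformly continuous semigroup of composition operators on $H(p,q,\alpha)$; that is, if $\lim_{t\to0^+}\|C_t-I\|=0$ on $H(p,q,\alpha)$, then $\varphi_t$ is the identity for all $t\ge0$.
   Context: $\mathbb{D}$ is the unit disk. A semigroup of analytic functions is a family $\{\varphi_t:t\ge0\}$ of analytic self-maps of $\mathbb{D}$ with $\varphi_0=\mathrm{id}$, $\varphi_{t+s}=\varphi_t\circ\varphi_s$, and $\varphi_t\to\varphi_0$ uniformly on compact subsets as $t\to0^+$; it is trivial if every $\varphi_t$ is the identity. For $f$ analytic on $\mathbb{D}$, $M_p(r,f)=\left(\int_0^{2\pi}|f(re^{i\theta})|^p\frac{d\theta}{2\pi}\right)^{1/p}$ ($p<\infty$), $M_\infty(r,f)=\max_\theta|f(re^{i\theta})|$, and $H(p,q,\alpha)$ is the space of analytic $f$ on $\mathbb{D}$ with $\|f\|_{p,q,\alpha}^q=\alpha q\int_0^1(1-r)^{\alpha q-1}M_p^q(r,f)\,dr<\infty$. $I$ is the identity operator. *)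

(* Defs.v *)
(* Complex plane = R[i] (mathcomp-real-closed
   `complex`) over an arbitrary realType R; analyticity = complex
   differentiability (derivable over the scalar field R[i]). *)
From mathcomp Require Import all_boot all_order all_algebra.
From mathcomp Require Import all_classical all_reals all_analysis.
From mathcomp Require Export complex.
Import Order.TTheory GRing.Theory Num.Theory numFieldNormedType.Exports.

Set Implicit Arguments.
Unset Strict Implicit.
Unset Printing Implicit Defensive.

Local Open Scope classical_set_scope.
Local Open Scope ring_scope.
Local Open Scope complex_scope.

Section Defs.
Variable R : realType.

Definition disk : set R[i] := [set z | Normc.normc z < 1].

Definition analytic_on (U : set R[i]) (f : R[i] -> R[i]) : Prop :=
  forall z, U z -> derivable (f : R[i]^o -> R[i]^o) z 1.

Definition polar (r theta : R) : R[i] := (r * cos theta) +i* (r * sin theta).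

(* integral means M_p(r,f), p in (0, +oo]; value for p <= 0 is irrelevant *)
Definition Mp (p : \bar R) (f : R[i] -> R[i]) (r : R) : \bar R :=
  match p with
  | +oo%E => ereal_sup [set (Normc.normc (f (polar r theta)))%:E | theta in [set: R]]
  | (p'%:E)%E =>
      (((2 * pi)^-1)%R%:E *
        \int[lebesgue_measure]_(theta in `[0%R, (2 * pi)%R])
            ((Normc.normc (f (polar r theta))) `^ p')%:E) `^ (p'^-1)%R
  | -oo%E => 0%E
  end%E.

Definition Hnorm (p : \bar R) (q alpha : R) (f : R[i] -> R[i]) : \bar R :=
  (((alpha * q)%R%:E *
     \int[lebesgue_measure]_(r in `[0%R, 1%R[)
        (((1 - r) `^ (alpha * q - 1))%R%:E * (Mp p f r) `^ q)) `^ (q^-1)%R)%E.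

Definition Hspace (p : \bar R) (q alpha : R) : set (R[i] -> R[i]) :=
  [set f | analytic_on disk f /\ (Hnorm p q alpha f < +oo)%E].

Definition analytic_semigroup (phi : R -> R[i] -> R[i]) : Prop :=
  [/\ (forall t, 0 <= t -> analytic_on disk (phi t)),
      (forall t, 0 <= t -> forall z, disk z -> disk (phi t z)),
      (forall z, disk z -> phi 0 z = z),
      (forall t s, 0 <= t -> 0 <= s -> forall z, disk z ->
          phi (t + s) z = phi t (phi s z)) &
      (forall K : set R[i]^o, compact K -> K `<=` disk ->
         forall e : R, 0 < e -> exists2 d : R, 0 < d &
           forall t, 0 < t < d -> forall z, K z -> Normc.normc (phi t z - z) < e)].

Definition CtmI (phi : R -> R[i] -> R[i]) (t : R) (f : R[i] -> R[i]) :
  R[i] -> R[i] := fun z => f (phi t z) - f z.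

Definition opnorm_CtmI (p : \bar R) (q alpha : R) (phi : R -> R[i] -> R[i])
  (t : R) : \bar R :=
  ereal_sup [set Hnorm p q alpha (CtmI phi t f) |
               f in [set f | Hspace p q alpha f /\ (Hnorm p q alpha f <= 1)%E]].

End Defs.

(* Main.v *)
(** Composition is controlled by subordination without harmonic majorants.
    For F holomorphic near the closed disc, ln |F| is below its Poisson
    integral: this is clear for constants and linear factors, it is preserved
    by products and uniform limits, hence passes from polynomials to F.
    Jensen's inequality turns it into |F(w)|^p <= C P[|F|^p](w).  Integrating
    over w = phi (r e^(i t)) and using that the Poisson kernel composed with
    phi is harmonic yields M_p(r, f o phi) <= C M_p(1 - c (1 - r), f), with
    constants depending only on a bound for |phi 0|.  The right-hand side is a
    dominating function, uniform in small t, so (a) is dominated convergence.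

    For (b), test the operator norm on the multiples of z^n of norm at most 1.
    If ||C_t - I|| is small, there is r in [1 - 1/n, 1) with
    M_p(r, phi^n - z^n) small, phi = phi_t, and so the mean b_n of (phi / z)^n
    over circles (which does not depend on the circle) has real part at least
    1/2 for every n >= 2.  If phi 0 <> 0, log-subharmonicity of z - x phi gives
    ln |x phi 0| <= O(1) - Re (sum_n x^n b_n / n), which is impossible as
    x -> 1 because the harmonic series diverges.  If phi 0 = 0, then
    b_n = phi'(0)^n; real parts at least 1/2 force phi'(0) = 1, and the equality
    case of Schwarz's lemma gives phi = id.  So phi_t = id for small t, hence
    for all t. *)
Require Import Defs.
From mathcomp Require Import all_boot all_order all_algebra.
From mathcomp Require Import all_classical all_reals all_analysis.
From mathcomp Require Import measurable_realfun complex ring lra.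
Import Order.TTheory GRing.Theory Num.Theory numFieldNormedType.Exports.
Import Normc.
Set Implicit Arguments.
Unset Strict Implicit.
Unset Printing Implicit Defensive.
Local Open Scope classical_set_scope.
Local Open Scope ring_scope.
Local Open Scope complex_scope.

(** * Moduli, polar coordinates and complex differentiability *)

Section ComplexBasics.
Variable R : realType.
Implicit Types (z w : R[i]) (f g : R[i] -> R[i]).

(** For [p < 1] there is no triangle inequality and the power [p] is not convex, so estimates pass
    through the logarithm and sums are split with the crude factor [2^p]. Zeros of [F] on the circle
    would make [ln |F|] infinite there; hence the Poisson bound is stated for [ln (|F| + d)] with
    [d > 0], and [d] disappears only after exponentiation. A function of the space need not extend
    to the closed disc. Since [phi] maps the disc of radius [(1 + r) / 2] into one of radius [rho]
    with [1 - rho] proportional to [1 - r], the dilation of [f] by [rho] is used instead; this costs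
    only a constant because the weight is a power of [1 - r]. Only real integrals occur: Cauchy's
    theory is built for means of real parts, and complex identities are recovered by inserting an
    arbitrary complex factor. In (b), radii at distance about [1/n] from 1 serve two needs: the
    interval of such radii carries weight of order [n^(- alpha q)], the order of the weighted
    integral of [|z^n|], and [r^n] stays away from 0 there, so that smallness of [phi^n - z^n] is
    smallness of [(phi / z)^n - 1]. *)

Lemma normcE_num z : `|z| = (normc z)%:C.
Proof. by case: z. Qed.

Lemma normc_ge0 z : 0 <= normc z.
Proof. by case: z => a b; exact: sqrtr_ge0. Qed.

Lemma normc_gt0 z : (0 < normc z) = (z != 0).
Proof. by rewrite -ltcR -normcE_num normr_gt0. Qed.

Lemma normc_eq0 z : (normc z == 0) = (z == 0).
Proof. by rewrite -(inj_eq (@complexI R)) -normcE_num normr_eq0. Qed.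

Lemma normcX z n : normc (z ^+ n) = normc z ^+ n.
Proof. by elim: n => [|n IH]; rewrite ?expr0 ?normc1// !exprS normcM IH. Qed.

Lemma normc_distC z w : normc (z - w) = normc (w - z).
Proof. by rewrite -normcN opprB. Qed.

Lemma le_normcB z w : normc (z - w) <= normc z + normc w.
Proof. by rewrite (le_trans (le_normcD _ _))// normcN. Qed.

Lemma normc_leB z w : normc z - normc w <= normc (z - w).
Proof. by rewrite lerBlDr (le_trans _ (le_normcD _ _))// subrK. Qed.

Lemma normc_real (x : R) : normc x%:C = `|x|.
Proof. by rewrite /= expr0n/= addr0 sqrtr_sqr. Qed.

Lemma sqr_normcE z : normc z ^+ 2 = complex.Re z ^+ 2 + complex.Im z ^+ 2.
Proof. by case: z => a b /=; rewrite sqr_sqrtr// addr_ge0// sqr_ge0. Qed.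

Lemma normc_conj z : normc z^*%C = normc z.
Proof. by case: z => a b /=; rewrite sqrrN. Qed.

Lemma mul_conjc z : z * z^*%C = (normc z ^+ 2)%:C.
Proof. by rewrite sqr_normcE; case: z => a b; simpc; rewrite /real_complex_def/=; congr (_ +i* _); ring. Qed.

Lemma normRe_le z : `|complex.Re z| <= normc z.
Proof.
rewrite -(ler_pXn2r (ltn0Sn 1)) ?nnegrE ?normc_ge0// sqr_normcE real_normK ?num_real//.
by rewrite lerDl sqr_ge0.
Qed.

Lemma normIm_le z : `|complex.Im z| <= normc z.
Proof.
rewrite -(ler_pXn2r (ltn0Sn 1)) ?nnegrE ?normc_ge0// sqr_normcE real_normK ?num_real//.
by rewrite lerDr sqr_ge0.
Qed.

Lemma Re_le_normc z : complex.Re z <= normc z.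
Proof. exact: le_trans (ler_norm _) (normRe_le z). Qed.

Lemma normc_le_ReIm z : normc z <= `|complex.Re z| + `|complex.Im z|.
Proof.
rewrite -(ler_pXn2r (ltn0Sn 1)) ?nnegrE ?addr_ge0 ?normc_ge0// sqr_normcE.
rewrite -[X in X + _]real_normK ?num_real// -[X in _ + X]real_normK ?num_real//.
have := normr_ge0 (complex.Re z); have := normr_ge0 (complex.Im z); nra.
Qed.

Lemma cReM z w : complex.Re (z * w) =
  complex.Re z * complex.Re w - complex.Im z * complex.Im w.
Proof. by case: z w => a b [c d]. Qed.

Lemma cImM z w : complex.Im (z * w) =
  complex.Re z * complex.Im w + complex.Im z * complex.Re w.
Proof. by case: z w => a b [c d]. Qed.

Lemma cReD z w : complex.Re (z + w) = complex.Re z + complex.Re w.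
Proof. by case: z w => a b [c d]. Qed.

Lemma cImD z w : complex.Im (z + w) = complex.Im z + complex.Im w.
Proof. by case: z w => a b [c d]. Qed.

Lemma cReN z : complex.Re (- z) = - complex.Re z.
Proof. by case: z. Qed.

Lemma cImN z : complex.Im (- z) = - complex.Im z.
Proof. by case: z. Qed.

Lemma cReB z w : complex.Re (z - w) = complex.Re z - complex.Re w.
Proof. by rewrite cReD cReN. Qed.

Lemma cImB z w : complex.Im (z - w) = complex.Im z - complex.Im w.
Proof. by rewrite cImD cImN. Qed.

Lemma complex_eqP z w : complex.Re z = complex.Re w -> complex.Im z = complex.Im w -> z = w.
Proof. by case: z w => a b [c d] /= -> ->. Qed.

Lemma polarM (r s a b : R) : polar (r * s) (a + b) = polar r a * polar s b.
Proof. by rewrite /polar cosD sinD; simpc; congr (_ +i* _); ring. Qed.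

Lemma normc_polar (r a : R) : normc (polar r a) = `|r|.
Proof.
apply/eqP; rewrite -(eqrXn2 (ltn0Sn 1)) ?normc_ge0// sqr_normcE/= real_normK ?num_real//.
by rewrite !exprMn -mulrDr cos2Dsin2 mulr1.
Qed.

Lemma polarE (r a : R) : polar r a = r%:C * polar 1 a.
Proof. by rewrite /polar; simpc. Qed.

Lemma polar0 (a : R) : polar 0 a = 0.
Proof. by rewrite polarE mul0r. Qed.

Lemma polar_period (r a : R) : polar r (a + 2 * pi) = polar r a.
Proof. by rewrite /polar mulr_natl cosD2pi sinD2pi. Qed.

Definition holo f z := derivable (f : R[i]^o -> R[i]^o) z 1.

(** The norm of [R[i]] takes its values in [R[i]]; here all tolerances and moduli are real, so that
    estimates become real arithmetic. [holo_cdiff] and [cdiff_holo] give the equivalence with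
    derivability. *)
Definition cdiff f z (d : R[i]) := forall e : R, 0 < e ->
  exists2 k : R, 0 < k & forall h, normc h < k ->
    normc (f (z + h) - f z - d * h) <= e * normc h.

Definition ccont f z := forall e : R, 0 < e ->
  exists2 k : R, 0 < k & forall h, normc h < k -> normc (f (z + h) - f z) < e.

Lemma cdiff_ccont f z d : cdiff f z d -> ccont f z.
Proof.
move=> fd e e0; have [k k0 H] := fd 1 ltr01.
exists (Num.min k (e / (2 + normc d))).
  by rewrite lt_min k0 divr_gt0// ltr_wpDr ?normc_ge0.
move=> h; rewrite lt_min => /andP[hk]; rewrite ltr_pdivlMr ?ltr_wpDr ?normc_ge0// => he.
rewrite -[f _ - _](subrK (d * h)) (le_lt_trans (le_normcD _ _))//.
rewrite normcM; have := H _ hk; have := normc_ge0 h; have := normc_ge0 d; nra.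
Qed.

Lemma holo_cdiff f z : holo f z -> exists d, cdiff f z d.
Proof.
move=> /cvg_ex[/= d fd]; exists d => e e0.
move/cvgrPdist_le : fd => /(_ e%:C); rewrite ltcR => /(_ e0).
rewrite near_withinE => /nbhs_ballP[k /= k0 H].
have [k1 kE] : exists k1 : R, k = k1%:C by apply/complex_realP; rewrite gtr0_real.
exists k1; first by rewrite -ltcR -kE.
move=> h hk; have [->|h0] := eqVneq h 0.
  by rewrite addr0 subrr sub0r mulr0 oppr0 normc0 mulr0.
have := H h; rewrite /ball/= sub0r normrN normcE_num kE ltcR => /(_ hk h0).
rewrite [_ *: 1]mulr1 normcE_num lecR => H1.
have -> : f (z + h) - f z - d * h = - (h * (d - h^-1 * (f (h + z) - f z))).
  by rewrite mulrBr mulrA divff// mul1r opprB (addrC h) (mulrC h).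
by rewrite normcN normcM mulrC ler_wpM2r// normc_ge0.
Qed.

Lemma cdiff_holo f z d : cdiff f z d -> holo f z.
Proof.
move=> fd; apply/cvg_ex; exists d; apply/cvgrPdist_le => e e0.
have [e1 eE] : exists e1 : R, e = e1%:C by apply/complex_realP; rewrite gtr0_real.
move: e0; rewrite eE ltcR => /fd[k k0 H].
rewrite near_withinE; apply/nbhs_ballP; exists k%:C; first by rewrite /= ltcR.
move=> h; rewrite /ball/= sub0r normrN normcE_num ltcR => /H hk h0.
rewrite normcE_num lecR [_ *: 1]mulr1 -(ler_pM2r (_ : 0 < normc h)) ?normc_gt0//.
apply: le_trans hk; rewrite -normcM -normcN le_eqVlt; apply/orP; left; apply/eqP.
by congr normc; rewrite mulrBl opprB [_ *: _]mulrC -mulrA mulVf// mulr1 (addrC h).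
Qed.

Lemma holo_ccont f z : holo f z -> ccont f z.
Proof. by move=> /holo_cdiff[d /cdiff_ccont]. Qed.

Lemma holo_cst (c : R[i]) z : holo (fun=> c) z.
Proof. exact: derivable_cst. Qed.

Lemma holo_id z : holo id z.
Proof. exact: derivable_id. Qed.

Lemma holoD f g z : holo f z -> holo g z -> holo (fun x => f x + g x) z.
Proof. exact: derivableD. Qed.

Lemma holoB f g z : holo f z -> holo g z -> holo (fun x => f x - g x) z.
Proof. exact: derivableB. Qed.

Lemma holoM f g z : holo f z -> holo g z -> holo (fun x => f x * g x) z.
Proof. exact: derivableM. Qed.

Lemma holoV f z : f z != 0 -> holo f z -> holo (fun x => (f x)^-1) z.
Proof. exact: derivableV. Qed.

Lemma holoX f n z : holo f z -> holo (fun x => f x ^+ n) z.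
Proof.
by move=> fz; elim: n => [|n IH]; [exact: holo_cst | under eq_fun do rewrite exprS; exact: holoM].
Qed.

Lemma holo_comp f g z : holo g z -> holo f (g z) -> holo (fun x => f (g x)) z.
Proof. by move=> /derivable1_diffP gz /derivable1_diffP fz; apply/derivable1_diffP; exact: (differentiable_comp gz fz). Qed.

Lemma near_eq_holo (k : R) f g z : 0 < k -> (forall x, normc (x - z) < k -> f x = g x) ->
  holo f z -> holo g z.
Proof.
move=> k0 fg /holo_cdiff[d fd]; apply: (@cdiff_holo _ _ d) => e e0.
have [k1 k10 H] := fd e e0; exists (Num.min k k1); first by rewrite lt_min k0 k10.
move=> h; rewrite lt_min => /andP[hk hk1]; rewrite -!fg ?subrr ?normc0//; last by rewrite addrAC subrr add0r.
exact: H.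
Qed.

End ComplexBasics.

(** * Integrals of continuous functions over a segment *)

Section SegmentIntegral.
Variable R : realType.
Local Notation mu := (@lebesgue_measure R).
Implicit Types (f g : R -> R) (a b c k : R).

Definition rint a b f := (\int[mu]_(x in `[a, b]) f x)%R.
(** Continuity is two-sided even at the end points: in the uses below the integrand is defined
    around the segment. *)
Definition conton a b f := forall x, a <= x <= b -> {for x, continuous f}.

Lemma contonT a b f : continuous f -> conton a b f.
Proof. by move=> cf x _; exact: cf. Qed.

Lemma conton_sub a b a' b' f : a <= a' -> b' <= b -> conton a b f -> conton a' b' f.
Proof. by move=> aa bb cf x /andP[ax xb]; apply: cf; rewrite (le_trans aa)// (le_trans xb). Qed.

Lemma conton_integrable a b f : conton a b f -> mu.-integrable `[a, b] (EFin \o f).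
Proof.
move=> cf; apply: continuous_compact_integrable; first exact: segment_compact.
by apply: continuous_in_subspaceT => x; rewrite inE/= in_itv/=; exact: cf.
Qed.

Lemma contonB a b f g : conton a b f -> conton a b g -> conton a b (fun x => f x - g x).
Proof. by move=> cf cg x xab; apply: cvgB; [exact: cf | exact: cg]. Qed.

Lemma conton_cst a b k : conton a b (fun=> k).
Proof. by move=> x xab; exact: cvg_cst. Qed.

Lemma eq_rint a b f g : (forall x, a <= x <= b -> f x = g x) -> rint a b f = rint a b g.
Proof. by move=> fg; apply: eq_Rintegral => x; rewrite inE/= in_itv/= => /fg. Qed.

Lemma rintD a b f g : conton a b f -> conton a b g ->
  rint a b (fun x => f x + g x) = rint a b f + rint a b g.
Proof. by move=> cf cg; rewrite /rint RintegralD//; exact: conton_integrable. Qed.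

Lemma rintB a b f g : conton a b f -> conton a b g ->
  rint a b (fun x => f x - g x) = rint a b f - rint a b g.
Proof. by move=> cf cg; rewrite /rint RintegralB//; exact: conton_integrable. Qed.

Lemma rintZ a b k f : conton a b f -> rint a b (fun x => k * f x) = k * rint a b f.
Proof. by move=> cf; rewrite /rint RintegralZl//; exact: conton_integrable. Qed.

Lemma rint_cst a b k : a <= b -> rint a b (fun=> k) = k * (b - a).
Proof.
move=> ab; rewrite /rint Rintegral_cst//= lebesgue_measure_itv/= lte_fin.
case: ltP => [_ //|ba]; suff -> : b = a by rewrite subrr mulr0.
by apply/eqP; rewrite eq_le ab ba.
Qed.

Lemma le_rint a b f g : conton a b f -> conton a b g ->
  (forall x, a <= x <= b -> f x <= g x) -> rint a b f <= rint a b g.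
Proof.
move=> cf cg fg; apply: le_Rintegral => //; try exact: conton_integrable.
Qed.

Lemma rint_chasles a c b f : a <= c <= b -> conton a b f ->
  rint a b f = rint a c f + rint c b f.
Proof.
move=> /andP[ac cb] cf.
have := @Rintegral_itvB R f (BLeft a) (BRight b) c (conton_integrable cf).
rewrite !bnd_simp /rint => /(_ ac cb) /eqP; rewrite subr_eq addrC => /eqP ->.
congr (_ + _); rewrite Rintegral_itv_obnd_cbnd//.
apply: (integrableS _ _ _ (conton_integrable (conton_sub ac (lexx b) cf))) => //.
by apply: subset_itvr; rewrite bnd_simp.
Qed.

Lemma rint_bound a b k M f : a <= b -> conton a b f ->
  (forall x, a <= x <= b -> `|f x - k| <= M) -> `|rint a b f - k * (b - a)| <= M * (b - a).
Proof.
move=> ab cf fM; rewrite ler_norml lerBrDr lerBlDr -mulNr -!mulrDl -!(rint_cst _ ab).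
apply/andP; split; apply: le_rint => //; try exact: conton_cst.
- by move=> x /fM; rewrite ler_norml => /andP[? _]; lra.
- by move=> x /fM; rewrite ler_norml => /andP[_ ?]; lra.
Qed.

End SegmentIntegral.

(** * Goursat's theorem for closed differential forms on a rectangle *)

Section Goursat.
Variable R : realType.
Implicit Types (P Q : R -> R -> R).

Definition fdiff P (s t a b : R) := forall e : R, 0 < e ->
  exists2 k : R, 0 < k & forall x y, `|x| < k -> `|y| < k ->
    `|P (s + x) (t + y) - P s t - a * x - b * y| <= e * (`|x| + `|y|).

Lemma fdiff_cont1 P s t a b : fdiff P s t a b -> {for s, continuous (P ^~ t)}.
Proof.
move=> dP; apply/cvgrPdist_lt => e e0; have [k k0 H] := dP 1 ltr01.
near=> x; have := H (x - s) 0; rewrite normr0 !addr0 mulr0 subr0 mul1r.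
rewrite (addrC s) subrK => H1.
have xsk : `|x - s| < k by rewrite distrC; near: x; apply: cvgr_dist_lt.
have {}H1 := H1 xsk k0.
have xse : `|x - s| < e / (2 + `|a|).
  by rewrite distrC; near: x; apply: cvgr_dist_lt => //; rewrite divr_gt0// ltr_wpDr.
rewrite ltr_pdivlMr ?ltr_wpDr// in xse.
rewrite distrC -[P x t - _](subrK (a * (x - s))) (le_lt_trans (ler_normD _ _))//.
rewrite normrM; have := normr_ge0 (x - s); have := normr_ge0 a; nra.
Unshelve. all: by end_near. Qed.

Lemma fdiffC P s t a b : fdiff P s t a b -> fdiff (fun x y => P y x) t s b a.
Proof.
move=> dP e /dP[k k0 H]; exists k => // x y xk yk.
by rewrite addrAC (addrC `|x|) H.
Qed.

Lemma fdiff_cont2 P s t a b : fdiff P s t a b -> {for t, continuous (P s)}.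
Proof. by move=> /fdiffC /fdiff_cont1. Qed.

Variables (P Q : R -> R -> R) (S1 S2 T1 T2 : R).
(** The shared [b] says that the form [P ds + Q dt] is closed. The partial derivatives exist but
    need not be continuous, which rules out Green's formula and calls for bisection. *)
Hypothesis PQ : forall s t, S1 <= s <= S2 -> T1 <= t <= T2 ->
  exists a b c, fdiff P s t a b /\ fdiff Q s t b c.

(** The integral of [P ds + Q dt] around the rectangle, counterclockwise. *)
Let E s1 s2 t1 t2 := rint s1 s2 (fun s => P s t1 - P s t2) +
                     rint t1 t2 (fun t => Q s2 t - Q s1 t).

Let cP s1 s2 t : S1 <= s1 -> s2 <= S2 -> T1 <= t <= T2 -> conton s1 s2 (P ^~ t).
Proof.
move=> h1 h2 ht s /andP[s1s ss2].
have [] := @PQ s t _ ht; first by rewrite (le_trans h1)// (le_trans ss2).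
by move=> a [b [c [/fdiff_cont1]]].
Qed.

Let cQ t1 t2 s : T1 <= t1 -> t2 <= T2 -> S1 <= s <= S2 -> conton t1 t2 (Q s).
Proof.
move=> h1 h2 hs t /andP[t1t tt2].
have [] := @PQ s t hs; first by rewrite (le_trans h1)// (le_trans tt2).
by move=> a [b [c [_ /fdiff_cont2]]].
Qed.

Let E_splits s1 m s2 t1 t2 : S1 <= s1 -> s1 <= m -> m <= s2 -> s2 <= S2 ->
  T1 <= t1 -> t1 <= t2 -> t2 <= T2 ->
  E s1 s2 t1 t2 = E s1 m t1 t2 + E m s2 t1 t2.
Proof.
move=> h1 h2 h3 h4 k1 k2 k3; rewrite /E (@rint_chasles _ s1 m s2) ?h2//; last first.
  by apply: contonB; apply: cP => //; apply/andP; split => //; lra.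
rewrite [X in _ + X](_ : _ = rint t1 t2 (fun t => Q m t - Q s1 t) + rint t1 t2 (fun t => Q s2 t - Q m t)).
  by lra.
rewrite -rintD; first by apply: eq_rint => t _; ring.
all: apply: contonB; apply: cQ => //; apply/andP; split => //; lra.
Qed.

Let E_splitt s1 s2 t1 m t2 : S1 <= s1 -> s1 <= s2 -> s2 <= S2 ->
  T1 <= t1 -> t1 <= m -> m <= t2 -> t2 <= T2 ->
  E s1 s2 t1 t2 = E s1 s2 t1 m + E s1 s2 m t2.
Proof.
move=> h1 h2 h3 h4 k1 k2 k3; rewrite /E [in LHS](@rint_chasles _ t1 m t2) ?k1//; last first.
  by apply: contonB; apply: cQ => //; apply/andP; split => //; lra.
rewrite [X in X + _](_ : _ = rint s1 s2 (fun s => P s t1 - P s m) + rint s1 s2 (fun s => P s m - P s t2)).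
  by lra.
rewrite -rintD; first by apply: eq_rint => t _; ring.
all: apply: contonB; apply: cP => //; apply/andP; split => //; lra.
Qed.

(** The linear part of the form contributes [- b * y * x] on the horizontal sides and [b * x * y] on
    the vertical ones, and these cancel. What remains is the differentiability error, of order
    [e * (x + y)], integrated over sides of total length of order [x + y]. *)
Let E_local s t e : S1 <= s <= S2 -> T1 <= t <= T2 -> 0 < e ->
  exists2 k, 0 < k & forall s1 s2 t1 t2, S1 <= s1 <= s -> s <= s2 <= S2 ->
    T1 <= t1 <= t -> t <= t2 <= T2 -> s2 - s1 < k -> t2 - t1 < k ->
    `|E s1 s2 t1 t2| <= e * ((s2 - s1) + (t2 - t1)) ^+ 2.
Proof.
move=> sS tT e0; have [a [b [c [dP dQ]]]] := PQ sS tT.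
have e20 : 0 < e / 2 by lra.
have [k k0 HP] := dP _ e20; have [l l0 HQ] := dQ _ e20.
exists (Num.min k l); first by rewrite lt_min k0.
move=> s1 s2 t1 t2 /andP[a1 a2] /andP[a3 a4] /andP[b1 b2] /andP[b3 b4].
rewrite !lt_min => /andP[sk sl] /andP[tk tl].
set x := s2 - s1; set y := t2 - t1.
have s12 : s1 <= s2 by lra. have t12 : t1 <= t2 by lra.
have HP' u v : s1 <= u <= s2 -> t1 <= v <= t2 ->
    `|P u v - P s t - a * (u - s) - b * (v - t)| <= e / 2 * (x + y).
  move=> /andP[? ?] /andP[? ?]; have := HP (u - s) (v - t); rewrite !subrKC => H.
  apply: le_trans (H _ _) _; rewrite ?ltr_norml; [lra..|].
  by apply: ler_wpM2l; [lra | apply: lerD; rewrite ler_norml /x /y; lra].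
have HQ' u v : s1 <= u <= s2 -> t1 <= v <= t2 ->
    `|Q u v - Q s t - b * (u - s) - c * (v - t)| <= e / 2 * (x + y).
  move=> /andP[? ?] /andP[? ?]; have := HQ (u - s) (v - t); rewrite !subrKC => H.
  apply: le_trans (H _ _) _; rewrite ?ltr_norml; [lra..|].
  by apply: ler_wpM2l; [lra | apply: lerD; rewrite ler_norml /x /y; lra].
have A : `|rint s1 s2 (fun s => P s t1 - P s t2) - (- b * y) * (s2 - s1)| <= e * (x + y) * (s2 - s1).
  apply: rint_bound => // [|u us].
    by apply: contonB; apply: cP => //; apply/andP; split => //; lra.
  have := HP' u t1 us; have := HP' u t2 us; rewrite !lexx !t12 => /(_ isT) + /(_ isT).
  by rewrite !ler_norml /x /y => /andP[? ?] /andP[? ?]; apply/andP; split; lra.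
have B : `|rint t1 t2 (fun t => Q s2 t - Q s1 t) - (b * x) * (t2 - t1)| <= e * (x + y) * (t2 - t1).
  apply: rint_bound => // [|u us].
    by apply: contonB; apply: cQ => //; apply/andP; split => //; lra.
  have := HQ' s1 u; have := HQ' s2 u; rewrite !lexx !s12 => /(_ isT us) + /(_ isT us).
  by rewrite !ler_norml /x /y => /andP[? ?] /andP[? ?]; apply/andP; split; lra.
rewrite /E; move: A B; rewrite -/x -/y !ler_norml => /andP[? ?] /andP[? ?].
by apply/andP; split; lra.
Qed.

Hypotheses (S12 : S1 <= S2) (T12 : T1 <= T2).
Let A := S2 - S1.
Let B := T2 - T1.
Let d n : R := 2^-1 ^+ n.

Let d_ge0 n : 0 <= d n.
Proof. by rewrite exprn_ge0// invr_ge0. Qed.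

Let dS n : d n = d n.+1 + d n.+1.
Proof. by rewrite /d exprS; lra. Qed.

(** A rectangle of generation [n], with sides divided by [2^n], whose boundary integral is still
    larger than [e / 4^n]. *)
Let bad (e : R) n (q : R * R) := [/\ S1 <= q.1, q.1 + A * d n <= S2, T1 <= q.2,
  q.2 + B * d n <= T2 & e * d n ^+ 2 < `|E q.1 (q.1 + A * d n) q.2 (q.2 + B * d n)|].

Let nest n (q q' : R * R) := [/\ q.1 <= q'.1, q'.1 + A * d n.+1 <= q.1 + A * d n,
  q.2 <= q'.2 & q'.2 + B * d n.+1 <= q.2 + B * d n].

(** The integral is the sum over the four quarters, and [d n ^+ 2] is four times [d n.+1 ^+ 2], so
    some quarter carries at least its share. *)
Let bad_step e n q : bad e n q -> exists q', bad e n.+1 q' /\ nest n q q'.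
Proof.
case: q => s t [/= h1 h2 h3 h4 h5].
have A0 : 0 <= A by rewrite /A subr_ge0.
have B0 : 0 <= B by rewrite /B subr_ge0.
set x := A * d n.+1; set y := B * d n.+1.
have x0 : 0 <= x by rewrite mulr_ge0.
have y0 : 0 <= y by rewrite mulr_ge0.
have xE : A * d n = x + x by rewrite dS mulrDr.
have yE : B * d n = y + y by rewrite dS mulrDr.
have dE : d n ^+ 2 = 4 * d n.+1 ^+ 2 by rewrite (dS n); ring.
rewrite xE yE dE in h2 h4 h5 *.
move: h5; rewrite (@E_splits s (s + x)); [|lra..].
rewrite (@E_splitt s (s + x) t (t + y)); [|lra..].
rewrite (@E_splitt (s + x) (s + (x + x)) t (t + y)); [|lra..].
set E1 := E _ _ _ _; set E2 := E _ _ _ _; set E3 := E _ _ _ _; set E4 := E _ _ _ _ => h5.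
have split : [\/ e * d n.+1 ^+ 2 < `|E1|, e * d n.+1 ^+ 2 < `|E2|,
              e * d n.+1 ^+ 2 < `|E3| | e * d n.+1 ^+ 2 < `|E4|].
  have [k1|k1] := ltP (e * d n.+1 ^+ 2) `|E1|; first by constructor 1.
  have [k2|k2] := ltP (e * d n.+1 ^+ 2) `|E2|; first by constructor 2.
  have [k3|k3] := ltP (e * d n.+1 ^+ 2) `|E3|; first by constructor 3.
  have [k4|k4] := ltP (e * d n.+1 ^+ 2) `|E4|; first by constructor 4.
  exfalso; move: h5; apply/negP; rewrite -leNgt.
  apply: le_trans (ler_normD _ _) _; have := ler_normD E1 E2; have := ler_normD E3 E4; lra.
case: split => H.
- by exists (s, t); split; split => //=; rewrite -/x -/y ?xE ?yE; lra.
- by exists (s, t + y); split; split => //=; rewrite -/x -/y ?xE ?yE -?addrA; lra.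
- by exists (s + x, t); split; split => //=; rewrite -/x -/y ?xE ?yE -?addrA; lra.
- by exists (s + x, t + y); split; split => //=; rewrite -/x -/y ?xE ?yE -?addrA; lra.
Qed.

Let nested_point (a : nat -> R) L : 0 <= L -> (forall n, a n <= a n.+1) ->
  (forall n, a n.+1 + L * d n.+1 <= a n + L * d n) ->
  exists x, forall n, a n <= x <= a n + L * d n.
Proof.
move=> L0 a1 a2; have am m n : (m <= n)%N -> a m <= a n /\ a n + L * d n <= a m + L * d m.
  move=> mn; rewrite -(subnK mn); elim: (n - m)%N => // k [IH1 IH2]; rewrite addSn; split.
    exact: le_trans IH1 (a1 _).
  exact: le_trans (a2 _) IH2.
have ub m n : a m <= a n + L * d n.
  have Ld k : 0 <= L * d k by rewrite mulr_ge0.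
  have := Ld n; have := Ld m.
  by case: (leqP m n) => [/am|/ltnW /am] [? ?]; lra.
have hs : has_sup [set a n | n in setT].
  by split; [exists (a 0%N); exists 0%N | exists (a 0%N + L * d 0%N) => _ [n _ <-]].
exists (sup [set a n | n in setT]) => n; apply/andP; split.
  by apply: ub_le_sup; [exact: hs.2 | exists n].
by apply: ge_sup; [exact: hs.1 | move=> _ [m _ <-]].
Qed.

Theorem Goursat : rint S1 S2 (fun s => P s T1 - P s T2) +
                  rint T1 T2 (fun t => Q S2 t - Q S1 t) = 0.
Proof.
apply/eqP/negP => /negP E0; rewrite -normr_gt0 in E0.
set e := `|_| in E0.
have A0 : 0 <= A by rewrite /A subr_ge0.
have B0 : 0 <= B by rewrite /B subr_ge0.
have bad0 : bad (e / 2) 0 (S1, T1).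
  by rewrite /bad/= /d expr0 expr1n !mulr1 /A /B !subrKC; split => //; rewrite -/e; lra.
have step (x : nat * (R * R)) : exists y, bad (e / 2) x.1 x.2 ->
    bad (e / 2) x.1.+1 y /\ nest x.1 x.2 y.
  case: x => n q /=; have [/bad_step[q' H]|nb] := pselect (bad (e / 2) n q).
    by exists q'.
  by exists q.
have [F HF] := boolp.choice step.
pose u := fix u n := if n is n'.+1 then F (n', u n') else (S1, T1).
have ub n : bad (e / 2) n (u n).
  by elim: n => //= n IH; have [] := HF (n, u n) IH.
have un n : nest n (u n) (u n.+1) by have [] := HF (n, u n) (ub n).
have [s Hs] : exists x, forall n, (u n).1 <= x <= (u n).1 + A * d n.
  by apply: nested_point => // n; have [] := un n.
have [t Ht] : exists x, forall n, (u n).2 <= x <= (u n).2 + B * d n.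
  by apply: nested_point => // n; have [] := un n.
have sS : S1 <= s <= S2 by have := Hs 0%N; rewrite /= /d expr0 mulr1 /A subrKC.
have tT : T1 <= t <= T2 by have := Ht 0%N; rewrite /= /d expr0 mulr1 /B subrKC.
(* Makes the local bound [e1 * ((A + B) * d n) ^+ 2] at most [e / 2 * d n ^+ 2]; the summand 1 keeps
   the denominator positive when the rectangle is a point. *)
pose e1 := e / 2 / (1 + (A + B) ^+ 2).
have AB0 : 0 < 1 + (A + B) ^+ 2 by have := sqr_ge0 (A + B); lra.
have e10 : 0 < e1 by rewrite !divr_gt0.
have [k k0 H] := E_local sS tT e10.
have [n Hn] : exists n, (A + B) * d n < k.
  have : (fun n => (A + B) * d n) @ \oo --> (A + B) * 0.
    by apply: cvgM; [exact: cvg_cst | apply: cvg_expr; rewrite ger0_norm; lra].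
  rewrite mulr0 => /cvgrPdist_lt /(_ _ k0)[n _ /(_ n (leqnn n))].
  by rewrite /= sub0r normrN => /(le_lt_trans (ler_norm _)) ?; exists n.
have [h1 h2 h3 h4 h5] := ub n.
have Ad : 0 <= A * d n by rewrite mulr_ge0.
have Bd : 0 <= B * d n by rewrite mulr_ge0.
have /andP[k1 k2] := Hs n; have /andP[k3 k4] := Ht n.
move: h5; apply/negP; rewrite -leNgt.
apply: le_trans (H _ _ _ _ _ _ _ _ _ _) _; rewrite ?h1 ?h2 ?h3 ?h4 ?k1 ?k2 ?k3 ?k4//.
- lra.
- lra.
have -> x y : x + A * d n - x + (y + B * d n - y) = (A + B) * d n by ring.
rewrite exprMn mulrA ler_wpM2r ?sqr_ge0// /e1 mulrAC ler_pdivrMr//.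
by apply: ler_wpM2l; lra.
Qed.

End Goursat.

(** * The complex exponential and means over concentric circles *)

Section CircleAverage.
Variable R : realType.
Implicit Types (f g : R[i] -> R[i]) (u : R -> R).
Local Notation Re := (@complex.Re R).
Local Notation Im := (@complex.Im R).

Lemma is_derive_cdiff (f : R -> R) (x d : R) : is_derive x 1 f d -> forall e : R, 0 < e ->
  exists2 k : R, 0 < k & forall h : R, `|h| < k -> `|f (x + h) - f x - d * h| <= e * `|h|.
Proof.
move=> fd e e0.
have /cvgrPdist_le/(_ _ e0) : (fun h => h^-1 *: (f (h *: 1 + x) - f x)) @ 0^' --> d.
  have [D] := fd; rewrite /derive => <-; exact: D.
rewrite near_withinE => /nbhs_ballP[k /= k0 H]; exists k => // h hk.
have [->|h0] := eqVneq h 0; first by rewrite addr0 subrr sub0r mulr0 oppr0 normr0 mulr0.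
have := H h; rewrite /ball/= sub0r normrN => /(_ hk h0).
rewrite [_ *: 1]mulr1 => H1.
have -> : f (x + h) - f x - d * h = - (h * (d - h^-1 * (f (h + x) - f x))).
  by rewrite mulrBr mulrA divff// mul1r opprB (addrC h) (mulrC h).
by rewrite normrN normrM mulrC ler_wpM2r.
Qed.

(** The complex exponential; it turns rectangles into annuli. *)
Definition cexp (z : R[i]) := polar (expR (Re z)) (Im z).

Lemma cexpD z w : cexp (z + w) = cexp z * cexp w.
Proof. by rewrite /cexp cReD cImD expRD polarM. Qed.

Lemma cexp_diff0 : cdiff cexp 0 1.
Proof.
(* The two coordinates of the error add up to at most seven terms [e1 * normc h], whence [e / 8];
   the bound [e1 <= 1] controls [1 + a] and [sin b]. *)
move=> e e0; have [e1 [e10 e11 e1e]] : exists e1 : R, [/\ 0 < e1, e1 <= 1 & e1 <= e / 8].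
  exists (Num.min (e / 8) 1).
  by rewrite lt_min ltr01 andbT divr_gt0// !ge_min !lexx orbT.
have [k1 k10 H1] := is_derive_cdiff (is_derive_expR 0) e10.
have [k2 k20 H2] := is_derive_cdiff (is_derive_sin 0) e10.
have [k3 k30 H3] := is_derive_cdiff (is_derive_cos 0) e10.
exists (Num.min (Num.min k1 k2) (Num.min k3 e1)); first by rewrite !lt_min k10 k20 k30 e10.
move=> [a b]; rewrite !lt_min => /andP[/andP[h1 h2] /andP[h3 h4]].
have bh : `|b| <= normc (a +i* b) := normIm_le (a +i* b).
have ah : `|a| <= normc (a +i* b) := normRe_le (a +i* b).
have {H1} := H1 _ (le_lt_trans ah h1); rewrite !add0r expR0 mul1r => H1.
have {H2} := H2 _ (le_lt_trans bh h2); rewrite !add0r cos0 sin0 mul1r subr0 => H2.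
have {H3} := H3 _ (le_lt_trans bh h3); rewrite !add0r sin0 cos0 oppr0 mul0r subr0 => H3.
rewrite ?add0r ?mul1r; apply: le_trans (normc_le_ReIm _) _.
rewrite {1 2}/cexp /= expR0 cos0 sin0 !mulr0 !mul1r subr0.
move: bh ah h1 h2 h3 h4 => /=; set N := Num.sqrt _ => bh ah h1 h2 h3 h4.
have -> : expR a * cos b - 1 - a = (expR a - 1 - a) * cos b + (1 + a) * (cos b - 1) by ring.
have -> : expR a * sin b - b = (expR a - 1 - a) * sin b + a * sin b + (sin b - b) by ring.
have cb : `|cos b| <= 1 by rewrite ler_norml cos_geN1 cos_le1.
have sb : `|sin b| <= 1 by rewrite ler_norml sin_geN1 sin_le1.
have a1 : `|1 + a| <= 2.
  by rewrite (le_trans (ler_normD _ _))// normr1; move: h4 e11 ah; lra.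
have sb2 : `|sin b| <= 2 * `|b|.
  rewrite -[sin b](subrK b) (le_trans (ler_normD _ _))//.
  have := ler_wpM2r (normr_ge0 b) e11; move: H2; lra.
have t1 : `|(expR a - 1 - a) * cos b| <= e1 * `|a|.
  rewrite normrM -[leRHS]mulr1; apply: ler_pM => //.
have t2 : `|(1 + a) * (cos b - 1)| <= 2 * (e1 * `|b|) by rewrite normrM; apply: ler_pM.
have t3 : `|(expR a - 1 - a) * sin b| <= e1 * `|a|.
  rewrite normrM -[leRHS]mulr1; apply: ler_pM => //.
have t4 : `|a * sin b| <= `|a| * (2 * e1).
  rewrite normrM; apply: ler_wpM2l => //; move: sb2 bh h4; lra.
have := ler_normD ((expR a - 1 - a) * cos b) ((1 + a) * (cos b - 1)).
have := ler_normD ((expR a - 1 - a) * sin b + a * sin b) (sin b - b).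
have := ler_normD ((expR a - 1 - a) * sin b) (a * sin b).
have ea : e1 * `|a| <= e / 8 * N by apply: ler_pM => //; exact: ltW.
have eb : e1 * `|b| <= e / 8 * N by apply: ler_pM => //; exact: ltW.
have eN : 0 <= e * N by rewrite mulr_ge0 ?sqrtr_ge0 ?ltW.
move: eN t1 t2 t3 t4 H2 ea eb; lra.
Qed.

Lemma cexp_diff z : cdiff cexp z (cexp z).
Proof.
have c0 : cexp 0 = 1 by rewrite /cexp/= expR0 /polar cos0 sin0 mulr0 mulr1.
move=> e e0; have N0 : 0 < 1 + normc (cexp z) by rewrite ltr_wpDr ?normc_ge0.
have [k k0 H] := cexp_diff0 (divr_gt0 e0 N0).
exists k => // h /H; rewrite add0r c0 mul1r => {}H.
have -> : cexp (z + h) - cexp z - cexp z * h = cexp z * (cexp h - 1 - h) by rewrite cexpD; ring.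
rewrite normcM; have h1 := normc_ge0 h; have h2 := normc_ge0 (cexp z).
apply: le_trans (ler_wpM2l h2 H) _.
rewrite mulrA ler_wpM2r// mulrCA; apply: ler_piMr; first exact: ltW.
by rewrite ler_pdivrMr//; lra.
Qed.

Lemma cdiff_comp f g z d1 d2 : cdiff g z d1 -> cdiff f (g z) d2 ->
  cdiff (fun x => f (g x)) z (d2 * d1).
Proof.
move=> dg df; have [k k0 gc] : exists2 k : R, 0 < k & forall h, normc h < k ->
    normc (g (z + h) - g z) <= (1 + normc d1) * normc h.
  have [k k0 H] := dg 1 ltr01; exists k => // h /H; rewrite mul1r => {}H.
  rewrite -[g _ - _](subrK (d1 * h)) (le_trans (le_normcD _ _))// normcM mulrDl mul1r.
  by rewrite lerD2r.
move=> e e0; have n1 := normc_ge0 d1; have n2 := normc_ge0 d2.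
have nz1 : 1 + normc d1 != 0 by rewrite gt_eqF//; lra.
have nz2 : 1 + normc d2 != 0 by rewrite gt_eqF//; lra.
pose e1 := e / (2 * (1 + normc d1)); pose e2 := e / (2 * (1 + normc d2)).
have e10 : 0 < e1 by rewrite divr_gt0// mulr_gt0//; lra.
have e20 : 0 < e2 by rewrite divr_gt0// mulr_gt0//; lra.
have [k1 k10 H1] := df _ e10; have [k2 k20 H2] := dg _ e20.
have [k3 k30 H3] := cdiff_ccont dg k10.
exists (Num.min (Num.min k k2) k3); first by rewrite !lt_min k0 k20 k30.
move=> h; rewrite !lt_min => /andP[/andP[hk hk2] hk3].
have := H1 _ (H3 _ hk3); rewrite subrKC => {}H1.
set gh := g (z + h) - g z in H1 *.
have -> : f (g (z + h)) - f (g z) - d2 * d1 * h =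
   (f (g (z + h)) - f (g z) - d2 * gh) + d2 * (gh - d1 * h) by ring.
apply: le_trans (le_normcD _ _) _; rewrite normcM.
have A : e1 * normc gh <= e / 2 * normc h.
  apply: le_trans (ler_wpM2l (ltW e10) (gc _ hk)) _; rewrite mulrA ler_wpM2r ?normc_ge0//.
  by rewrite le_eqVlt /e1; apply/orP; left; apply/eqP; field.
have B : normc d2 * normc (gh - d1 * h) <= e / 2 * normc h.
  apply: le_trans (ler_wpM2l n2 (H2 _ hk2)) _; rewrite mulrA ler_wpM2r ?normc_ge0//.
  have -> : normc d2 * e2 = e / 2 * (normc d2 / (1 + normc d2)) by rewrite /e2; field.
  by apply: ler_piMr; [lra | rewrite ler_pdivrMr; lra].
lra.
Qed.

Definition avg u : R := (2 * pi)^-1 * rint 0 (2 * pi) u.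

Let pi2_gt0 : 0 < 2 * pi :> R.
Proof. by rewrite mulr_gt0// pi_gt0. Qed.

(** Goursat on the rectangle with sides [[ln r1, ln r2]] and [[0, 2 pi]], for the imaginary and real
    parts of [g] composed with the exponential. The form is closed by the Cauchy-Riemann equations,
    and the horizontal sides cancel by periodicity, leaving the two circle means. *)
Lemma circle_avg_const (a b r1 r2 : R) g : 0 <= a -> a < r1 -> r1 <= r2 -> r2 < b ->
  (forall z, a < normc z < b -> holo g z) ->
  avg (fun t => Re (g (polar r1 t))) = avg (fun t => Re (g (polar r2 t))).
Proof.
move=> a0 ar1 r12 r2b hg; congr (_ * _).
have r10 : 0 < r1 by exact: le_lt_trans ar1.
have r20 : 0 < r2 by exact: lt_le_trans r12.
pose P s t := Im (g (cexp (s +i* t))); pose Q s t := Re (g (cexp (s +i* t))).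
have PQ s t : ln r1 <= s <= ln r2 -> (0 : R) <= t <= 2 * pi ->
    exists a b c, fdiff P s t a b /\ fdiff Q s t b c.
  move=> /andP[s1 s2] _.
  have [|d gd] := @holo_cdiff _ g (cexp (s +i* t)).
    apply: hg; rewrite normc_polar/= ger0_norm ?expR_ge0//; apply/andP; split.
      by rewrite (lt_le_trans ar1)// -[leLHS]lnK ?posrE// ler_expR.
    by rewrite (le_lt_trans _ r2b)// -[leRHS]lnK ?posrE// ler_expR.
  have := cdiff_comp (cexp_diff (s +i* t)) gd; set D := d * _ => hD.
  exists (Im D), (Re D), (- Im D); split => e e0.

    have [k k0 H] := hD _ e0; exists (k / 2); first lra.
    move=> x y xk yk; have xy : normc (x +i* y) <= `|x| + `|y| := normc_le_ReIm (x +i* y).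
    have xyk : `|x| + `|y| < k by lra.
    have {}H : normc (g (cexp ((s + x) +i* (t + y))) - g (cexp (s +i* t)) - D * (x +i* y)) <=
      e * normc (x +i* y) := H (x +i* y) (le_lt_trans xy xyk).
    have -> : P (s + x) (t + y) - P s t - Im D * x - Re D * y =
       Im (g (cexp ((s + x) +i* (t + y))) - g (cexp (s +i* t)) - D * (x +i* y)).
      have ME : Im (D * (x +i* y)) = Re D * y + Im D * x := cImM D (x +i* y).
      by rewrite !cImD !cImN ME /P; ring.
    apply: le_trans (normIm_le _) _; apply: le_trans H _.
    by apply: ler_wpM2l xy; lra.
  have [k k0 H] := hD _ e0; exists (k / 2); first lra.
  move=> x y xk yk; have xy : normc (x +i* y) <= `|x| + `|y| := normc_le_ReIm (x +i* y).
  have xyk : `|x| + `|y| < k by lra.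
    have {}H : normc (g (cexp ((s + x) +i* (t + y))) - g (cexp (s +i* t)) - D * (x +i* y)) <=
      e * normc (x +i* y) := H (x +i* y) (le_lt_trans xy xyk).
  have -> : Q (s + x) (t + y) - Q s t - Re D * x - - Im D * y =
     Re (g (cexp ((s + x) +i* (t + y))) - g (cexp (s +i* t)) - D * (x +i* y)).
    have ME : Re (D * (x +i* y)) = Re D * x - Im D * y := cReM D (x +i* y).
    by rewrite !cReD !cReN ME /Q; ring.
  apply: le_trans (normRe_le _) _; apply: le_trans H _.
  by apply: ler_wpM2l xy; lra.
have l12 : ln r1 <= ln r2 by rewrite ler_ln ?posrE.
have := Goursat PQ l12 (ltW pi2_gt0).
have -> : rint (ln r1) (ln r2) (fun s => P s 0 - P s (2 * pi)) = 0.
  rewrite (@eq_rint _ _ _ _ (fun=> 0)) ?rint_cst ?mul0r// => s _.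
  by rewrite /P /cexp/= -[2 * pi]add0r polar_period subrr.
have QE r t : 0 < r -> Q (ln r) t = Re (g (polar r t)) by move=> r0; rewrite /Q /cexp /= lnK.
rewrite add0r rintB.
- move/eqP; rewrite subr_eq0 => /eqP /esym; rewrite /Q /cexp/= !lnK ?posrE//.
- move=> t tp; have [|? [? [? [_ /fdiff_cont2//]]]] := PQ (ln r2) t _ tp.
  by rewrite lexx l12.
- move=> t tp; have [|? [? [? [_ /fdiff_cont2//]]]] := PQ (ln r1) t _ tp.
  by rewrite lexx l12.
Qed.

End CircleAverage.

(** * Continuous curves, and uniform bounds on discs *)

Section CurvesAndDiscs.
Variable R : realType.
Implicit Types (f g : R[i] -> R[i]) (u v : R -> R[i]) (h : R -> R).
Local Notation Re := (@complex.Re R).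
Local Notation Im := (@complex.Im R).

Definition tcont u := forall t e : R, 0 < e ->
  exists2 k : R, 0 < k & forall s, `|s - t| < k -> normc (u s - u t) < e.

Lemma tcont_lip u (g : R[i] -> R) : tcont u ->
  (forall z w, `|g z - g w| <= normc (z - w)) -> continuous (fun t => g (u t)).
Proof.
move=> cu gl t; apply/cvgrPdist_lt => e e0; have [k k0 H] := cu t e e0.
near=> s; rewrite distrC; apply: le_lt_trans (gl _ _) _; apply: H.
by rewrite distrC; near: s; exact: cvgr_dist_lt.
Unshelve. all: by end_near. Qed.

Lemma tcont_Re u : tcont u -> continuous (fun t => Re (u t)).
Proof. by move=> /tcont_lip; apply => z w; rewrite -cReB normRe_le. Qed.

Lemma tcont_Im u : tcont u -> continuous (fun t => Im (u t)).
Proof. by move=> /tcont_lip; apply => z w; rewrite -cImB normIm_le. Qed.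

Lemma tcont_normc u : tcont u -> continuous (fun t => normc (u t)).
Proof.
move=> /tcont_lip; apply => z w; rewrite ler_norml normc_leB andbT.
by rewrite lerNl opprB normc_distC normc_leB.
Qed.

Lemma tcont_ReIm u : continuous (fun t => Re (u t)) -> continuous (fun t => Im (u t)) -> tcont u.
Proof.
move=> cR cI t e e0; have e2 : 0 < e / 2 by lra.
have /cvgrPdist_lt/(_ _ e2)/nbhs_ballP[k1 /= k10 H1] := cR t.
have /cvgrPdist_lt/(_ _ e2)/nbhs_ballP[k2 /= k20 H2] := cI t.
exists (Num.min k1 k2); first by rewrite lt_min k10.
move=> s; rewrite lt_min => /andP[s1 s2].
apply: le_lt_trans (normc_le_ReIm _) _; rewrite cReB cImB.
have b1 : ball t k1 s by rewrite /ball/= distrC.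
have b2 : ball t k2 s by rewrite /ball/= distrC.
by rewrite distrC; have := H1 s b1; rewrite [X in _ -> _ + X < _]distrC; have := H2 s b2; lra.
Qed.

Lemma tcont_cst (c : R[i]) : tcont (fun=> c).
Proof. by move=> t e e0; exists 1 => // s _; rewrite subrr normc0. Qed.

Lemma tcontD u v : tcont u -> tcont v -> tcont (fun t => u t + v t).
Proof.
move=> cu cv t e e0; have e2 : 0 < e / 2 by lra.
have [k1 k10 H1] := cu t _ e2; have [k2 k20 H2] := cv t _ e2.
exists (Num.min k1 k2); first by rewrite lt_min k10.
move=> s; rewrite lt_min => /andP[/H1 s1 /H2 s2].
rewrite opprD addrACA (le_lt_trans (le_normcD _ _))//; lra.
Qed.

Lemma tcontM u v : tcont u -> tcont v -> tcont (fun t => u t * v t).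
Proof.
move=> cu cv; apply: tcont_ReIm => t; under eq_fun do rewrite ?cReM ?cImM.
- by apply: cvgB; apply: cvgM; (exact: tcont_Re || exact: tcont_Im).
- by apply: cvgD; apply: cvgM; (exact: tcont_Re || exact: tcont_Im).
Qed.

Lemma tcontN u : tcont u -> tcont (fun t => - u t).
Proof. by move=> /(tcontM (tcont_cst (-1))); under eq_fun do rewrite mulN1r. Qed.

Lemma tcontB u v : tcont u -> tcont v -> tcont (fun t => u t - v t).
Proof. by move=> cu /tcontN; exact: tcontD. Qed.

Lemma tcont_comp f u : tcont u -> (forall t, ccont f (u t)) -> tcont (fun t => f (u t)).
Proof.
move=> cu cf t e e0; have [k k0 H] := cf t e e0; have [l l0 K] := cu t k k0.
by exists l => // s /K /H; rewrite subrKC.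
Qed.

Lemma tcontX u n : tcont u -> tcont (fun t => u t ^+ n).
Proof. by move=> cu; apply: (@tcont_comp (fun z => z ^+ n)) => // t; apply: holo_ccont; apply: holoX; exact: holo_id. Qed.

Lemma tcontV u : (forall t, u t != 0) -> tcont u -> tcont (fun t => (u t)^-1).
Proof.
move=> u0 cu; apply: (@tcont_comp (fun z => z^-1)) => // t; apply: holo_ccont.
by apply: holoV; [exact: u0 | exact: holo_id].
Qed.

Lemma tcont_polar (r : R) : tcont (polar r).
Proof.
apply: tcont_ReIm => t /=; apply: cvgM; try exact: cvg_cst.
- exact: continuous_cos.
- exact: continuous_sin.
Qed.

Definition con (B : R) f := forall z, normc z < B -> ccont f z.
Definition hol (B : R) f := forall z, normc z < B -> holo f z.

Lemma hol_con B f : hol B f -> con B f.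
Proof. by move=> hf z /hf /holo_ccont. Qed.

Lemma tcont_circle B f (r : R) : 0 <= r < B -> con B f -> tcont (fun t => f (polar r t)).
Proof.
move=> /andP[r0 rB] cf; apply: tcont_comp; first exact: tcont_polar.
by move=> t; apply: cf; rewrite normc_polar ger0_norm.
Qed.

Lemma nbhs_normc (z : R[i]) (A : set R[i]^o) :
  nbhs (z : R[i]^o) A <-> exists2 k : R, 0 < k & forall w, normc (w - z) < k -> A w.
Proof.
split=> [/nbhs_ballP[k /= k0 H]|[k k0 H]].
  have [k1 kE] : exists k1 : R, k = k1%:C by apply/complex_realP; rewrite gtr0_real.
  exists k1; first by rewrite -ltcR -kE.
  by move=> w wk; apply: H; rewrite /ball/= kE normcE_num ltcR normc_distC.
apply/nbhs_ballP; exists k%:C; first by rewrite /= ltcR.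
by move=> w; rewrite /ball/= normcE_num ltcR normc_distC; exact: H.
Qed.

(** A closed subset of the image of the square [[-r, r]^2] under [(x, y) |-> x + i y]. *)
Lemma compact_cdisc (r : R) : compact ([set z | normc z <= r] : set R[i]^o).
Proof.
pose F (p : R * R) : R[i]^o := p.1 +i* p.2.
have cF : continuous F.
  move=> [x y] A /= /nbhs_normc[k k0 H].
  exists (ball x (k / 2), ball y (k / 2)).
    by split; apply: nbhsx_ballx; lra.
  move=> [a b] /= [xa yb]; apply: H; apply: le_lt_trans (normc_le_ReIm _) _ => /=.
  by move: xa yb; rewrite /ball/= distrC => ?; rewrite distrC => ?; lra.
have K1 : compact (F @` (`[-r, r] `*` `[-r, r])).
  apply: continuous_compact; first exact: continuous_subspaceT.
  by apply: compact_setX; exact: segment_compact.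
apply: (subclosed_compact _ K1) => [z|z zr].
  move=> clz; rewrite /= leNgt; apply/negP => rz.
  have [|w [/= wr wz]] := clz [set w | normc (w - z) < normc z - r].
    by apply/nbhs_normc; exists (normc z - r); rewrite ?subr_gt0.
  by have := normc_leB z w; rewrite normc_distC; lra.
exists (Re z, Im z); last by rewrite /F /=; case: (z).
have := le_trans (normRe_le z) zr; have := le_trans (normIm_le z) zr.
by rewrite /= !in_itv/= !ler_norml.
Qed.

(** Only [z] is confined to the smaller disc; [w] may leave it, which allows comparing circles of
    nearby radii. *)
Lemma con_unif B f (r e : R) : con B f -> r < B -> 0 < e ->
  exists2 k : R, 0 < k & forall z w, normc z <= r -> normc (w - z) < k -> normc (f w - f z) < e.
Proof.
move=> cf rB e0.
have /compact_near_coveringP cov := @compact_cdisc r.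
have /= H := cov R (0^'+) (fun k z => forall w, normc (w - z) < k -> normc (f w - f z) < e) _.
have {H} /H : forall x : R[i]^o, [set z | normc z <= r] x ->
    \forall x' \near x & k \near 0^'+, forall w, normc (w - x') < k -> normc (f w - f x') < e.
  move=> z /= zr; have e2 : 0 < e / 2 by lra.
  have [k k0 K] := cf z (le_lt_trans zr rB) _ e2.
  exists ([set w | normc (w - z) < k / 2], [set l | l < k / 2]).
    split => /=; first by apply/nbhs_normc; exists (k / 2) => //; lra.
    by apply: nbhs_right_lt; lra.
  move=> [z' l] /= [zz' lk] w wz'.
  have -> : f w - f z' = (f (z + (w - z)) - f z) - (f (z + (z' - z)) - f z).
    by rewrite !subrKC; ring.
  apply: le_lt_trans (le_normcB _ _) _.
  have h1 := K (z' - z); have h2 := K (w - z).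
  have : normc (w - z) < k.
    by rewrite -(subrKA z' w) (le_lt_trans (le_normcD _ _))//; lra.
  by move=> /h2; have := h1 (lt_trans zz' _); lra.
case=> k /= k0 H; exists (k / 2); first lra.
move=> z w zr wz; apply: (H (k / 2)) => //=; last lra.
by rewrite sub0r normrN gtr0_norm; lra.
Qed.

Lemma con_bounded B f (r : R) : con B f -> r < B ->
  exists M : R, forall z, normc z <= r -> normc (f z) <= M.
Proof.
move=> cf rB; have [r0|r0] := ltP r 0.
  by exists 0 => z zr; have := normc_ge0 z; lra.
have /compact_near_coveringP cov := @compact_cdisc r.
have /= H := cov R +oo (fun M z => normc (f z) <= M) _.
have {H} /H : forall x : R[i]^o, [set z | normc z <= r] x ->
    \forall x' \near x & M \near +oo, normc (f x') <= M.
  move=> z /= zr; have [k k0 K] := cf z (le_lt_trans zr rB) _ ltr01.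
  exists ([set w | normc (w - z) < k], [set l | normc (f z) + 1 < l]).
    split => /=; first by apply/nbhs_normc; exists k.
    by apply: nbhs_pinfty_gt; rewrite num_real.
  move=> [z' l] /= [/K]; rewrite subrKC => h hl.
  by rewrite -[f z'](subrK (f z)) (le_trans (le_normcD _ _))//; lra.
case=> M [_ H]; exists (M + 1) => z zr; apply: (H (M + 1)) => //.
by rewrite ltrDl.
Qed.

End CurvesAndDiscs.

(** * The mean value property and Cauchy's formula *)

Section MeanValue.
Variable R : realType.
Implicit Types (f g : R[i] -> R[i]) (u v : R -> R[i]) (h : R -> R).
Local Notation Re := (@complex.Re R).
Local Notation Im := (@complex.Im R).

Lemma twopi_gt0 : 0 < 2 * pi :> R.
Proof. by rewrite mulr_gt0// pi_gt0. Qed.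

Let cT h : continuous h -> conton 0 (2 * pi) h.
Proof. exact: contonT. Qed.

Lemma avgD h1 h2 : continuous h1 -> continuous h2 ->
  avg (fun t => h1 t + h2 t) = avg h1 + avg h2.
Proof. by move=> c1 c2; rewrite -mulrDr -rintD//; exact: cT. Qed.

Lemma avgB h1 h2 : continuous h1 -> continuous h2 ->
  avg (fun t => h1 t - h2 t) = avg h1 - avg h2.
Proof. by move=> c1 c2; rewrite -mulrBr -rintB//; exact: cT. Qed.

Lemma avgZ k h : continuous h -> avg (fun t => k * h t) = k * avg h.
Proof. by move=> c; rewrite /avg (rintZ _ (cT c)) mulrCA. Qed.

Lemma avg_cst k : avg (fun=> k) = k :> R.
Proof.
rewrite /avg rint_cst; last exact: ltW twopi_gt0.
by rewrite subr0 mulrCA mulVf ?mulr1// gt_eqF// twopi_gt0.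
Qed.

Lemma le_avg h1 h2 : continuous h1 -> continuous h2 -> (forall t, h1 t <= h2 t) ->
  avg h1 <= avg h2.
Proof.
move=> c1 c2 h12; rewrite ler_wpM2l ?invr_ge0 ?(ltW twopi_gt0)//.
by apply: le_rint => //; exact: cT.
Qed.

Lemma eq_avg h1 h2 : h1 =1 h2 -> avg h1 = avg h2.
Proof. by move=> /funext ->. Qed.

Lemma avg_ge0 h : continuous h -> (forall t, 0 <= h t) -> 0 <= avg h.
Proof. by move=> ch h0; rewrite -[leLHS]avg_cst; apply: le_avg => // x; exact: cvg_cst. Qed.

Lemma avg_dist h1 h2 (M : R) : continuous h1 -> continuous h2 ->
  (forall t, `|h1 t - h2 t| <= M) -> `|avg h1 - avg h2| <= M.
Proof.
move=> c1 c2 h12; have cM : continuous (fun _ : R => M) by move=> x; exact: cvg_cst.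
have c12 : continuous (fun t => h1 t - h2 t) by move=> x; exact: (cvgB (c1 x) (c2 x)).
rewrite -avgB// ler_norml -{1}(avg_cst M) -mulN1r -avgZ//; apply/andP; split.
  apply: le_avg => //; first by move=> x; exact: cvg_cst.
  by move=> t; have := h12 t; rewrite ler_norml => /andP[]; lra.
rewrite -[leRHS](avg_cst M); apply: le_avg => // t.
by have := h12 t; rewrite ler_norml => /andP[].
Qed.

Let circ_cont B g r : con B g -> 0 <= r < B -> continuous (fun t => Re (g (polar r t))).
Proof. by move=> cg rB; apply: tcont_Re; exact: tcont_circle cg. Qed.

Lemma circle_avg_limit B g (r c : R) : con B g -> 0 <= r < B ->
  (forall k : R, 0 < k -> exists r', [/\ 0 <= r' < B, `|r' - r| < k &
     avg (fun t => Re (g (polar r' t))) = c]) -> avg (fun t => Re (g (polar r t))) = c.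
Proof.
move=> cg /andP[r0 rB] H; apply/eqP; rewrite -subr_eq0 -normr_le0.
apply/ler_addgt0Pr => e e0; rewrite add0r.
have [k k0 K] := con_unif cg rB e0; have [r' [r'B r'k <-]] := H k k0.
rewrite distrC; apply: avg_dist; [exact: (circ_cont cg) | by apply: (circ_cont cg); rewrite r0 |].
move=> t; rewrite -cReB; apply: le_trans (normRe_le _) _; apply/ltW/K.
  by rewrite normc_polar ger0_norm.
by rewrite [polar r' t]polarE [polar r t]polarE -mulrBl normcM normc_polar normr1 mulr1 -rmorphB normc_real.
Qed.

(** The mean is constant for radii below [normc w] and for radii above it; continuity glues the two
    ranges at [normc w] and identifies the value at radius 0. It takes the place of a removable
    singularity theorem for difference quotients. *)
Lemma mean_value_except B w g (r : R) : con B g ->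
  (forall z, normc z < B -> z != w -> holo g z) -> 0 <= r < B ->
  avg (fun t => Re (g (polar r t))) = Re (g 0).
Proof.
move=> cg hg.
have m0 : avg (fun t => Re (g (polar 0 t))) = Re (g 0).
  by under eq_avg do rewrite polar0; rewrite avg_cst.
have below (s : R) : 0 <= s < B -> s < normc w -> avg (fun t => Re (g (polar s t))) = Re (g 0).
  move=> /andP[]; rewrite le_eqVlt => /predU1P[<- //|s0] sB sw; rewrite -m0; apply/esym.
  apply: (circle_avg_limit cg); first by rewrite lexx (lt_trans s0).
  move=> k k0; exists (Num.min (k / 2) s).
  have q0 : 0 < Num.min (k / 2) s by rewrite lt_min s0 divr_gt0.
  split; first by rewrite ltW//= gt_min sB orbT.
  - by rewrite subr0 gtr0_norm// gt_min; apply/orP; left; lra.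
  - apply: (@circle_avg_const _ 0 (Num.min B (normc w))) => //; first by rewrite ge_min lexx orbT.
    + by rewrite lt_min sB.
    + move=> z; rewrite lt_min => /andP[_ /andP[zB zw]]; apply: hg => //.
      by apply: contraTneq zw => ->; rewrite ltxx.
have at_w : normc w < B -> avg (fun t => Re (g (polar (normc w) t))) = Re (g 0).
  move=> wB; have := normc_ge0 w; rewrite le_eqVlt => /predU1P[<- //|w0].
  apply: (circle_avg_limit cg); first by rewrite ltW.
  move=> k k0; exists (Num.max 0 (normc w - k / 2)).
  have q1 : Num.max 0 (normc w - k / 2) < normc w by rewrite gt_max w0; lra.
  have q0 : 0 <= Num.max 0 (normc w - k / 2) by rewrite le_max lexx.
  split; first by rewrite q0 (lt_trans q1).
  - rewrite distrC gtr0_norm ?subr_gt0// ltrBlDl -ltrBlDr lt_max; apply/orP; right; lra.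
  - by apply: below => //; rewrite q0 (lt_trans q1).
move=> /andP[r0 rB]; have [rw|wr|rwE] := ltgtP r (normc w).
- by apply: below; rewrite ?r0.
- have wB := lt_trans wr rB; rewrite -(at_w wB); apply/esym.
  apply: (circle_avg_limit cg); first by rewrite normc_ge0.
  move=> k k0; exists (Num.min r (normc w + k / 2)).
  have q1 : normc w < Num.min r (normc w + k / 2) by rewrite lt_min wr; lra.
  have q0 : Num.min r (normc w + k / 2) <= r by rewrite ge_min lexx.
  split; first by rewrite (le_lt_trans q0 rB) (le_trans (normc_ge0 w) (ltW q1)).
  - rewrite gtr0_norm ?subr_gt0// ltrBlDl gt_min; apply/orP; right; lra.
  - apply: (@circle_avg_const _ (normc w) B) => //; first exact: normc_ge0.
    move=> z /andP[wz zB]; apply: hg => //.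
    by apply: contraTneq wz => ->; rewrite ltxx.
- by rewrite rwE; apply: at_w; rewrite -rwE.
Qed.

Lemma mean_value B g (r : R) : hol B g -> 0 <= r < B ->
  avg (fun t => Re (g (polar r t))) = Re (g 0).
Proof. by move=> hg; apply: (@mean_value_except B 0); [exact: hol_con | move=> z zB _; exact: hg]. Qed.

Lemma conjcM (x y : R[i]) : (x * y)^*%C = x^*%C * y^*%C.
Proof. exact: rmorphM. Qed.

Lemma conjcB (x y : R[i]) : (x - y)^*%C = x^*%C - y^*%C.
Proof. exact: rmorphB. Qed.

Lemma conjcV (x : R[i]) : (x^-1)^*%C = (x^*%C)^-1.
Proof. exact: fmorphV. Qed.

Lemma unit_circle_neq0 (t : R) : polar 1 t != 0.
Proof. by rewrite -normc_gt0 normc_polar normr1. Qed.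

Lemma unit_circle_conj (t : R) : (polar 1 t)^*%C = (polar 1 t)^-1.
Proof.
apply: (mulfI (unit_circle_neq0 t)); rewrite divff ?unit_circle_neq0// mul_conjc.
by rewrite normc_polar normr1 expr1n.
Qed.

Lemma unit_circle_sub_neq0 (t : R) w : normc w < 1 -> polar 1 t - w != 0.
Proof.
by move=> w1; apply: contraTneq w1 => /subr0_eq <-; rewrite normc_polar normr1 ltxx.
Qed.

Lemma sub1_neq0 (x : R[i]) : normc x < 1 -> 1 - x != 0.
Proof. by move=> x1; apply: contraTneq x1 => /subr0_eq <-; rewrite normc1 ltxx. Qed.

Lemma holo_sub1V (a z : R[i]) : 1 - a * z != 0 -> holo (fun z => (1 - a * z)^-1) z.
Proof.
move=> nz; apply: holoV => //; apply: holoB; first exact: holo_cst.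
by apply: holoM; [exact: holo_cst | exact: holo_id].
Qed.

(** On the unit circle [z / (z - w)] is the conjugate of [1 / (1 - conj w z)], which is holomorphic
    beyond the closed disc with value 1 at the origin. *)
Lemma cauchy_cst (c w : R[i]) : normc w < 1 ->
  avg (fun t => Re (c * (polar 1 t / (polar 1 t - w)))) = Re c.
Proof.
move=> w1.
(* This radius exceeds 1, yet [normc w] times it is below 1, so the pole stays outside. *)
have h : hol (1 + (1 - normc w) / 2) (fun z => c^*%C * (1 - w^*%C * z)^-1).
  move=> z zB; apply: holoM; first exact: holo_cst.
  apply: holo_sub1V; apply: sub1_neq0; rewrite normcM normc_conj.
  have := normc_ge0 w; have := normc_ge0 z; nra.
have := mean_value h; move=> /(_ 1); rewrite mulr0 subr0 invr1 mulr1.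
have -> : Re c^*%C = Re c by case: (c).
move=> <-; last by apply/andP; split; lra.
apply: eq_avg => t; have -> x : Re x = Re x^*%C by case: (x).
rewrite !conjcM !conjcV !conjcB !unit_circle_conj; congr (Re (_ * _)).
have z0 := unit_circle_neq0 t.
have zw : (polar 1 t)^-1 - w^*%C != 0.
  by rewrite -unit_circle_conj -conjcB conjc_eq0 unit_circle_sub_neq0.
have zw' : 1 - w^*%C * polar 1 t != 0.
  by apply: contra zw => /eqP H; rewrite -(mulIr_eq0 _ (mulIf z0)) mulrBl mulVf// H.
field; rewrite ?z0 ?zw ?zw' ?andbT//.
Qed.

Lemma ccontM f g z : ccont f z -> ccont g z -> ccont (fun z => f z * g z) z.
Proof.
move=> cf cg e e0; have nf := normc_ge0 (f z); have ng := normc_ge0 (g z).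
have p1 : 0 < e / (2 * (1 + normc (f z))) by rewrite divr_gt0// mulr_gt0//; lra.
have p2 : 0 < e / (2 * (1 + normc (g z))) by rewrite divr_gt0// mulr_gt0//; lra.
have [k1 k10 H1] := cf _ p2; have [k2 k20 H2] := cg _ p1; have [k3 k30 H3] := cg _ ltr01.
exists (Num.min k1 (Num.min k2 k3)); first by rewrite !lt_min k10 k20.
move=> h; rewrite !lt_min => /andP[/H1 h1 /andP[/H2 h2 /H3 h3]].
have -> : f (z + h) * g (z + h) - f z * g z =
  (f (z + h) - f z) * g (z + h) + f z * (g (z + h) - g z) by ring.
apply: le_lt_trans (le_normcD _ _) _; rewrite !normcM.
have gh : normc (g (z + h)) <= 1 + normc (g z).
  by rewrite -[g (z + h)](subrK (g z)) (le_trans (le_normcD _ _))// lerD2r ltW.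
move: h1 h2; rewrite !ltr_pdivlMr; [|lra..].
set a := normc (f (z + h) - f z); set b := normc (g (z + h) - g z) => h1 h2.
have a0 : 0 <= a := normc_ge0 _; have b0 : 0 <= b := normc_ge0 _.
have := ler_wpM2l a0 gh; nra.
Qed.

(** Let [D] be the difference quotient of [F] at [w]. Then [F z * z / (z - w)] is [z * D z] plus
    [F w * z / (z - w)]; the first has mean 0, its value at the origin, and the second is
    [cauchy_cst]. *)
Lemma cauchy_formula B F w : 1 < B -> hol B F -> normc w < 1 ->
  avg (fun t => Re (F (polar 1 t) * (polar 1 t / (polar 1 t - w)))) = Re (F w).
Proof.
move=> B1 hF w1; have [d Fd] := holo_cdiff (hF w (lt_trans w1 B1)).
pose D z := if z == w then d else (F z - F w) / (z - w).
have hD z : normc z < B -> z != w -> holo D z.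
  move=> zB zw; have nz : 0 < normc (z - w) by rewrite normc_gt0 subr_eq0.
  apply: (@near_eq_holo _ _ (fun z => (F z - F w) / (z - w)) _ _ nz).
    move=> x xz; rewrite /D ifF//; apply: contraTF xz => /eqP ->.
    by rewrite normc_distC ltxx.
  apply: holoM; first by apply: holoB; [exact: hF|exact: holo_cst].
  apply: holoV; first by rewrite subr_eq0.
  by apply: holoB; [exact: holo_id | exact: holo_cst].
have cD : con B D.
  move=> z zB; have [->|zw] := eqVneq z w; last by apply: holo_ccont; exact: hD.
  move=> e e0; have e2 : 0 < e / 2 by lra.
  have [k k0 H] := Fd _ e2.
  exists k => // h /H hk; rewrite /D eqxx.
  have [h0|h0] := eqVneq h 0; first by rewrite h0 addr0 eqxx subrr normc0.
  rewrite ifF; last by apply/negbTE; rewrite -subr_eq0 addrAC subrr add0r.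
  have -> : w + h - w = h by ring.
  have h1 : 0 < normc h by rewrite normc_gt0.
  rewrite -(ltr_pM2r h1) -normcM mulrBl divfK//; apply: le_lt_trans hk _.
  by rewrite ltr_pM2r//; lra.
have cG : con B (fun z => z * D z).
  by move=> z zB; apply: (@ccontM id D); [apply: holo_ccont; exact: holo_id | exact: cD].
have hG z : normc z < B -> z != w -> holo (fun z => z * D z) z.
  by move=> zB zw; apply: holoM; [exact: holo_id | exact: hD].
have r1 : 0 <= (1 : R) < B by rewrite ler01.
have := mean_value_except cG hG r1; rewrite mul0r => G0.
have c1 : continuous (fun t => Re (F (polar 1 t) * (polar 1 t / (polar 1 t - w)))).
  apply: tcont_Re; apply: tcontM.
    by apply: (@tcont_circle _ B); [rewrite ler01 | exact: hol_con].
  apply: tcontM; first exact: tcont_polar.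
  apply: tcontV; first by move=> t; exact: unit_circle_sub_neq0.
  by apply: tcontB; [exact: tcont_polar | exact: tcont_cst].
have c2 : continuous (fun t => Re (F w * (polar 1 t / (polar 1 t - w)))).
  apply: tcont_Re; apply: tcontM; first exact: tcont_cst.
  apply: tcontM; first exact: tcont_polar.
  apply: tcontV; first by move=> t; exact: unit_circle_sub_neq0.
  by apply: tcontB; [exact: tcont_polar | exact: tcont_cst].
apply/eqP; rewrite -subr_eq0 -(cauchy_cst (F w) w1) -avgB// -[X in _ == X]G0; apply/eqP.
apply: eq_avg => t; rewrite -cReB -mulrBl /D ifF; last first.
  by apply/negbTE; rewrite -subr_eq0 unit_circle_sub_neq0.
by congr (Re _); rewrite mulrCA mulrA.
Qed.

End MeanValue.

(** * Poisson's formula and polynomial approximation on the closed disc *)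

Section Poisson.
Variable R : realType.
Implicit Types (f g : R[i] -> R[i]) (u v : R -> R[i]) (h : R -> R) (w z : R[i]).
Local Notation Re := (@complex.Re R).
Local Notation Im := (@complex.Im R).

Definition pk w t : R := (1 - normc w ^+ 2) / normc (polar 1 t - w) ^+ 2.

Lemma holo_sub1V_disc (w z : R[i]) : normc w < 1 -> normc z < 1 + (1 - normc w) / 2 ->
  1 - w^*%C * z != 0.
Proof.
move=> w1 zw; apply: sub1_neq0; rewrite normcM normc_conj.
have := normc_ge0 w; have := normc_ge0 z; nra.
Qed.

Lemma cReMr (x : R[i]) (r : R) : Re (x * r%:C) = r * Re x.
Proof. by rewrite cReM mulr0 subr0 mulrC. Qed.

Lemma realcM (x y : R) : (x * y)%:C = x%:C * y%:C.
Proof. exact: rmorphM. Qed.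

Lemma realcV (x : R) : (x^-1)%:C = (x%:C)^-1.
Proof. exact: fmorphV. Qed.

(** Cauchy's formula for [f] times [(1 - |w|^2) / (1 - conj w z)], a factor equal to 1 at [w]; on
    the circle its product with the Cauchy kernel is the Poisson kernel. *)
Lemma poisson_formula B f w : 1 < B -> hol B f -> normc w < 1 ->
  avg (fun t => pk w t * Re (f (polar 1 t))) = Re (f w).
Proof.
move=> B1 hf w1.
pose c := (1 - normc w ^+ 2)%:C.
have n1 : 1 - w^*%C * w = c by rewrite mulrC mul_conjc /c rmorphB.
have c0 : c != 0.
  rewrite -n1; apply: holo_sub1V_disc => //; lra.
pose F z := f z * (c * (1 - w^*%C * z)^-1).
have hF : hol (Num.min B (1 + (1 - normc w) / 2)) F.
  move=> z; rewrite lt_min => /andP[zB zw]; apply: holoM; first exact: hf.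
  apply: holoM; first exact: holo_cst.
  by apply: holo_sub1V; exact: holo_sub1V_disc.
have B'1 : 1 < Num.min B (1 + (1 - normc w) / 2) by rewrite lt_min B1; lra.
have := cauchy_formula B'1 hF w1; rewrite /F n1 divff// mulr1 => <-.
apply: eq_avg => t; rewrite -cReMr; congr Re; rewrite -!mulrA; congr (_ * _).
have z0 := unit_circle_neq0 t; have zw := unit_circle_sub_neq0 t w1.
have zw' : 1 - w^*%C * polar 1 t != 0 by apply: holo_sub1V_disc; rewrite ?normc_polar ?normr1//; lra.
rewrite /pk realcM realcV -mul_conjc conjcB unit_circle_conj -/c; congr (_ * _).
have -> : (polar 1 t)^-1 - w^*%C = (1 - w^*%C * polar 1 t) / polar 1 t by field.
by field; rewrite zw zw' z0.
Qed.

Lemma normc_unit_sub_gt0 w (t : R) : normc w < 1 -> 0 < normc (polar 1 t - w).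
Proof. by move=> w1; rewrite normc_gt0 unit_circle_sub_neq0. Qed.

Lemma sqr_lt1 w : normc w < 1 -> normc w ^+ 2 < 1.
Proof. by move=> w1; rewrite expr_lt1// normc_ge0. Qed.

Lemma pk_gt0 w t : normc w < 1 -> 0 < pk w t.
Proof.
move=> w1; rewrite divr_gt0 ?subr_gt0 ?sqr_lt1// exprn_gt0//.
exact: normc_unit_sub_gt0.
Qed.

Lemma tcont_pk u w : (forall t, u t - w != 0) -> tcont u ->
  continuous (fun t => (1 - normc w ^+ 2) / normc (u t - w) ^+ 2).
Proof.
move=> uw cu t; apply: cvgM; first exact: cvg_cst.
apply: cvgV; first by rewrite expf_eq0/= normc_eq0.
have c : {for t, continuous (fun t => normc (u t - w))}.
  by apply: tcont_normc; apply: tcontB => //; exact: tcont_cst.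
by rewrite expr2; exact: cvgM.
Qed.

Lemma pk_continuous w : normc w < 1 -> continuous (pk w).
Proof.
by move=> w1; apply: tcont_pk; [move=> t; exact: unit_circle_sub_neq0 | exact: tcont_polar].
Qed.

Lemma avg_pk w : normc w < 1 -> avg (pk w) = 1.
Proof.
move=> w1; have := @poisson_formula 2 (fun=> 1) w _ _ w1.
have -> : Re 1 = 1 by []. move=> <- //; first by apply: eq_avg => t; rewrite mulr1.
  by rewrite ltr1n.
by move=> z _; exact: holo_cst.
Qed.

Lemma pk_le w t : normc w < 1 -> pk w t <= 2 / (1 - normc w).
Proof.
move=> w1; have w0 := normc_ge0 w.
have d : 1 - normc w <= normc (polar 1 t - w).
  by have := normc_leB (polar 1 t) w; rewrite normc_polar normr1.
rewrite /pk ler_pdivrMr ?exprn_gt0 ?normc_unit_sub_gt0//.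
apply: (@le_trans _ _ (2 / (1 - normc w) * (1 - normc w) ^+ 2)).
  rewrite expr2 mulrA divfK; last by rewrite gt_eqF//; lra.
  nra.
apply: ler_wpM2l; first by rewrite divr_ge0//; lra.
by rewrite ler_pXn2r ?nnegrE ?normc_ge0//; lra.
Qed.

Lemma pk_ge w t : normc w < 1 -> (1 - normc w) / 2 <= pk w t.
Proof.
move=> w1; have w0 := normc_ge0 w.
have d : normc (polar 1 t - w) <= 1 + normc w.
  by have := le_normcB (polar 1 t) w; rewrite normc_polar normr1.
have d0 := normc_ge0 (polar 1 t - w).
rewrite /pk ler_pdivlMr ?exprn_gt0 ?normc_unit_sub_gt0//.
have N2 : normc (polar 1 t - w) ^+ 2 <= (1 + normc w) ^+ 2.
  by rewrite ler_pXn2r ?nnegrE//; lra.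
have h1 : 0 <= (1 - normc w) / 2 by lra.
apply: le_trans (ler_wpM2l h1 N2) _.
have : 0 <= (1 - normc w) * ((1 + normc w) * (1 - normc w)) by rewrite !mulr_ge0//; lra.
nra.
Qed.

(** Reduces bounds on a complex modulus to bounds on means of real parts. *)
Lemma norm_as_Re x : exists2 v : R[i], normc v <= 1 & Re (v * x) = normc x.
Proof.
have [->|x0] := eqVneq x 0; first by exists 0; rewrite ?normc0 ?mul0r.
have n0 : normc x != 0 by rewrite normc_eq0.
exists (x^*%C * ((normc x)^-1)%:C).
  by rewrite normcM normc_conj normc_real ger0_norm ?invr_ge0 ?normc_ge0// divff.
by rewrite mulrAC cReMr mulrC [_ * x]mulrC mul_conjc/= expr2 mulfK.
Qed.

Definition cavg u : R[i] := avg (fun t => Re (u t)) +i* avg (fun t => Im (u t)).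

Lemma Re_cavg (k : R[i]) u : tcont u -> Re (k * cavg u) = avg (fun t => Re (k * u t)).
Proof.
move=> cu; under eq_avg do rewrite cReM.
have cR := tcont_Re cu; have cI := tcont_Im cu.
rewrite avgB; first by rewrite !avgZ// cReM.
- by move=> t; apply: cvgM; [exact: cvg_cst | exact: cR].
- by move=> t; apply: cvgM; [exact: cvg_cst | exact: cI].
Qed.

(** The Taylor polynomial at 0, with coefficients given by Cauchy's integrals instead of
    derivatives. *)
Let taylor_poly f n := \sum_(i < n) cavg (fun t => f (polar 1 t) / polar 1 t ^+ i) *: 'X^i.

(** Geometric expansion of the Cauchy kernel: with [q = w / z], subtracting [q^n] from
    [q^n * z / (z - w)] leaves [q^(n+1) * z / (z - w)]. *)
Lemma taylor_rem B f w (v : R[i]) n : 1 < B -> hol B f -> normc w < 1 ->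
  Re (v * (f w - (taylor_poly f n).[w])) =
  avg (fun t => Re (v * (f (polar 1 t) * ((w / polar 1 t) ^+ n * (polar 1 t / (polar 1 t - w)))))).
Proof.
move=> B1 hf w1; elim: n => [|n IH].
  rewrite /taylor_poly big_ord0 horner0 subr0.
  have hvf : hol B (fun z => v * f z) by move=> z zB; apply: holoM; [exact: holo_cst | exact: hf].
  rewrite -(cauchy_formula B1 hvf w1); apply: eq_avg => t.
  by rewrite expr0 mul1r !mulrA.
rewrite /taylor_poly big_ord_recr/= hornerD -/(taylor_poly f n) opprD addrA mulrDr cReD IH.
have cf : tcont (fun t => f (polar 1 t)).
  by apply: (@tcont_circle _ B); [rewrite ler01 | exact: hol_con].
have cz : tcont (fun t : R => (polar 1 t)^-1).
  by apply: tcontV; [exact: unit_circle_neq0 | exact: tcont_polar].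
have cn : tcont (fun t => f (polar 1 t) / polar 1 t ^+ n).
  apply: tcontM => //; under eq_fun do rewrite -exprVn; exact: tcontX.
rewrite hornerZ hornerXn mulrN cReN [_ * w ^+ n]mulrC mulrA Re_cavg// -avgB.
- apply: eq_avg => t; rewrite -cReB; congr Re.
  have z0 := unit_circle_neq0 t; have zw := unit_circle_sub_neq0 t w1.
  have zn : polar 1 t ^+ n != 0 by rewrite expf_neq0.
  by rewrite !exprSr !exprMn !exprVn; field; rewrite zn zw z0.
- apply: tcont_Re; apply: tcontM; first exact: tcont_cst.
  apply: tcontM => //; apply: tcontM.
    by apply: tcontX; apply: tcontM => //; exact: tcont_cst.
  apply: tcontM; first exact: tcont_polar.
  apply: tcontV; first by move=> t; exact: unit_circle_sub_neq0.
  by apply: tcontB; [exact: tcont_polar | exact: tcont_cst].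
- by apply: tcont_Re; apply: tcontM => //; exact: tcont_cst.
Qed.

Lemma poly_approx_inner B f (s e : R) : 1 < B -> hol B f -> 0 <= s < 1 -> 0 < e ->
  exists p : {poly R[i]}, forall z, normc z <= s -> normc (f z - p.[z]) <= e.
Proof.
move=> B1 hf /andP[s0 s1] e0; have [M HM] := con_bounded (hol_con hf) B1.
have M0 : 0 <= M by apply: le_trans (normc_ge0 _) (HM 0 _); rewrite normc0.
have : (fun n => M / (1 - s) * s ^+ n) @ \oo --> M / (1 - s) * 0.
  by apply: cvgM; [exact: cvg_cst | apply: cvg_expr; rewrite ger0_norm].
rewrite mulr0 => /cvgrPdist_le /(_ _ e0)[n _ /(_ n (leqnn n))].
rewrite /= sub0r normrN => /(le_trans (ler_norm _)) He.
exists (taylor_poly f n) => z zs; have z1 := le_lt_trans zs s1.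
have [v v1 <-] := norm_as_Re (f z - (taylor_poly f n).[z]).
rewrite (taylor_rem v n B1 hf z1); apply: le_trans He.
have cu : tcont (fun t => v * (f (polar 1 t) * ((z / polar 1 t) ^+ n * (polar 1 t / (polar 1 t - z))))).
  apply: tcontM; first exact: tcont_cst.
  apply: tcontM; first by apply: (@tcont_circle _ B); [rewrite ler01 | exact: hol_con].
  apply: tcontM.
    apply: tcontX; apply: tcontM; first exact: tcont_cst.
    by apply: tcontV; [exact: unit_circle_neq0 | exact: tcont_polar].
  apply: tcontM; first exact: tcont_polar.
  apply: tcontV; first by move=> t; exact: unit_circle_sub_neq0.
  by apply: tcontB; [exact: tcont_polar | exact: tcont_cst].
rewrite -[leRHS]avg_cst; apply: le_avg; first exact: tcont_Re.
  by move=> x; exact: cvg_cst.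
move=> t; apply: le_trans (Re_le_normc _) _.
rewrite !(normcM, normcX, normcV) normc_polar normr1 invr1 mulr1 mul1r.
have zn : normc z ^+ n <= s ^+ n by rewrite lerXn2r ?nnegrE ?normc_ge0.
have zs' : (normc (polar 1 t - z))^-1 <= (1 - s)^-1.
  rewrite lef_pV2 ?posrE ?normc_unit_sub_gt0 ?subr_gt0//.
  by have := normc_leB (polar 1 t) z; rewrite normc_polar normr1; lra.
have fM : normc (f (polar 1 t)) <= M by apply: HM; rewrite normc_polar normr1.
apply: (@le_trans _ _ (1 * (M * (s ^+ n * (1 - s)^-1)))); last first.
  by rewrite mul1r mulrA mulrAC.
have ge := normc_ge0; repeat apply: ler_pM => //; rewrite ?mulr_ge0 ?invr_ge0 ?exprn_ge0 ?ge//.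
Qed.

(** The Taylor remainder decays uniformly only inside the unit disc; rescaling by some [b] strictly
    between 1 and [B] moves the closed unit disc to radius [1 / b]. *)
Lemma poly_approx B f (e : R) : 1 < B -> hol B f -> 0 < e ->
  exists p : {poly R[i]}, forall z, normc z <= 1 -> normc (f z - p.[z]) <= e.
Proof.
move=> B1 hf e0; pose b := (1 + B) / 2.
have b1 : 1 < b by rewrite /b; lra.
have bB : b < B by rewrite /b; lra.
have b0 : 0 < b by lra.
have bC : b%:C != 0 by rewrite -normc_gt0 normc_real gtr0_norm.
have hg : hol (B / b) (fun z => f (b%:C * z)).
  move=> z zB; apply: (@holo_comp _ f (fun z => b%:C * z)).
    by apply: holoM; [exact: holo_cst | exact: holo_id].
  by apply: hf; rewrite normcM normc_real gtr0_norm// mulrC -ltr_pdivlMr.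
have Bb : 1 < B / b by rewrite ltr_pdivlMr// mul1r.
have [|p Hp] := @poly_approx_inner (B / b) _ b^-1 e Bb hg _ e0.
  by rewrite invr_ge0 (ltW b0) invf_lt1.
exists (p \Po (b%:C^-1 *: 'X)) => z z1.
rewrite horner_comp hornerZ hornerX; have := Hp (b%:C^-1 * z).
rewrite mulrA divff// mul1r; apply; rewrite normcM normcV normc_real gtr0_norm//.
by rewrite ler_piMr// invr_ge0 ltW.
Qed.

End Poisson.

(** * The logarithm of |1 - y| and its power series *)

Section LogSeries.
Variable R : realType.
Implicit Types (y z w : R[i]).
Local Notation Re := (@complex.Re R).
Local Notation Im := (@complex.Im R).

(** The truncated series of [- ln (1 - y)]. *)
Definition logsum n y : R[i] := \sum_(i < n) y ^+ i.+1 / i.+1%:R.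

Lemma natc (n : nat) : (n%:R : R)%:C = n%:R :> R[i].
Proof. exact: rmorph_nat. Qed.

Lemma realcX (x : R) n : (x ^+ n)%:C = x%:C ^+ n :> R[i].
Proof. exact: rmorphXn. Qed.

Lemma Re_logsum_term (x : R) y i :
  Re ((x%:C * y) ^+ i.+1 / i.+1%:R) = x ^+ i.+1 * (Re (y ^+ i.+1) / i.+1%:R).
Proof.
rewrite exprMn -natc -realcV -realcX cReMr [(x ^+ _)%:C * _]mulrC cReMr; ring.
Qed.

Lemma is_derive_logsum n y (x : R) :
  is_derive x 1 (fun x : R => Re (logsum n (x%:C * y))) (Re (\sum_(i < n) (x%:C * y) ^+ i * y)).
Proof.
elim: n => [|n IH].
  rewrite big_ord0; under eq_fun do rewrite /logsum big_ord0.
  exact: is_derive_cst.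
under eq_fun do rewrite /logsum big_ord_recr /= cReD.
rewrite big_ord_recr/= cReD; apply: is_deriveD.
under eq_fun do rewrite Re_logsum_term.
rewrite -/(_ ^+ n.+1).
have -> : Re ((x%:C * y) ^+ n * y) = n.+1%:R * x ^+ n * (Re (y ^+ n.+1) / n.+1%:R).
  have -> : (x%:C * y) ^+ n * y = y ^+ n.+1 * (x ^+ n)%:C by rewrite realcX exprSr exprMn; ring.
  rewrite cReMr.
  by have : (n.+1%:R : R) != 0 by []; move=> ?; field.
set c := _ / _.
have dX : is_derive x 1 (@GRing.exp R ^~ n.+1) (n.+1%:R * x ^+ n).
  by apply: DeriveDef; [exact: exprn_derivable | rewrite exp_derive [_ *: _]mulr1].
have := is_deriveM dX (is_derive_cst c x 1).
by rewrite scaler0 add0r [_ *: _]mulrC.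
Qed.

Lemma normc_sub_gt0 y (x : R) : normc y < 1 -> 0 <= x <= 1 -> 0 < normc (1 - x%:C * y).
Proof.
move=> y1 /andP[x0 x1]; rewrite normc_gt0 sub1_neq0// normcM normc_real ger0_norm//.
by have := normc_ge0 y; nra.
Qed.

Lemma is_derive_ln_normc y (x : R) : 0 < normc (1 - x%:C * y) ->
  is_derive x 1 (fun x : R => ln (normc (1 - x%:C * y))) (Re (- y / (1 - x%:C * y))).
Proof.
move=> n0; pose a := Re y; pose b := Im y.
pose q (x : R) := (1 - x * a) ^+ 2 + (x * b) ^+ 2.
have qE (x' : R) : normc (1 - x'%:C * y) ^+ 2 = q x'.
  rewrite sqr_normcE cReB cImB [x'%:C * y]mulrC cReMr /q sub0r sqrrN; congr (_ + _ ^+ 2).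
  by rewrite cImM mulr0 add0r mulrC.
have q0 : 0 < q x by rewrite -qE exprn_gt0.
rewrite [X in is_derive _ _ X _](_ : _ = (fun x => 2^-1 * ln (q x))); last first.
  apply/funext => x'; rewrite -qE; have := normc_ge0 (1 - x'%:C * y).
  (* If the modulus vanishes, both sides are 0 by the default value of [ln] at 0. *)
  rewrite le_eqVlt => /predU1P[<-|h]; first by rewrite expr0n/= ln0// mulr0.
  by rewrite lnXn// -mulr_natl; field.
have dq : is_derive x 1 q (2 * (1 - x * a) * (- a) + 2 * (x * b) * b).
  have d1 : is_derive x 1 (fun x : R => 1 - x * a) (- a).
    have := is_deriveB (is_derive_cst (1 : R) x 1) (is_deriveM (is_derive_id x (1 : R)) (is_derive_cst a x 1)).
    by rewrite scaler0 !add0r [_ *: _]mulr1.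
  have d2 : is_derive x 1 (fun x : R => x * b) b.
    have := is_deriveM (is_derive_id x (1 : R)) (is_derive_cst b x 1).
    by rewrite scaler0 !add0r [_ *: _]mulr1.
  exact: (is_deriveD (is_deriveX 2 d1) (is_deriveX 2 d2)).
have dl := is_derive1_ln q0.
have -> : Re (- y / (1 - x%:C * y)) = 2^-1 * ((2 * (1 - x * a) * (- a) + 2 * (x * b) * b) * (q x)^-1).
  have -> : (q x)^-1 = (normc (1 - x%:C * y) ^+ 2)^-1 by rewrite qE.
  have -> : - y / (1 - x%:C * y) = - y * (1 - x%:C * y)^*%C * ((normc (1 - x%:C * y) ^+ 2)^-1)%:C.
    have G (a0 v : R[i]) : a0 != 0 -> v != 0 -> - y / a0 = - y * v * (a0 * v)^-1.
      by move=> az vz; field; rewrite az vz.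
    by rewrite realcV -mul_conjc; apply: G; rewrite ?conjc_eq0 -normc_gt0.
  rewrite cReMr; move: (_ ^-1) => v; rewrite /a /b; case: (y) => c d.
  by rewrite /= ; field.
have := is_deriveM (is_derive_cst (2^-1 : R) x 1) (is_derive1_comp dl dq).
rewrite scaler0 addr0 => H; apply: (is_derive_eq H).
by rewrite /cst -[_ *: _]/(_ * _) [(q x)^-1 * _]mulrC.
Qed.

(** Along the ray [x y], the derivative telescopes to [- Re (y (x y)^n / (1 - x y))], and the real
    mean value theorem on [[0, 1]] finishes. No complex logarithm enters. *)
Lemma ln_normc_approx y n (rho : R) : normc y <= rho -> rho < 1 ->
  `|ln (normc (1 - y)) + Re (logsum n y)| <= rho ^+ n / (1 - rho).
Proof.
move=> yr r1; have y1 := le_lt_trans yr r1; have y0 := normc_ge0 y.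
pose D (x : R) := ln (normc (1 - x%:C * y)) + Re (logsum n (x%:C * y)).
pose dD (x : R) := Re (- y / (1 - x%:C * y)) + Re (\sum_(i < n) (x%:C * y) ^+ i * y).
have dDE (x : R) : 0 <= x <= 1 -> is_derive x 1 D (dD x).
  move=> x01; apply: is_deriveD; last exact: is_derive_logsum.
  by apply: is_derive_ln_normc; exact: normc_sub_gt0.
have D0 : D 0 = 0.
  rewrite /D mul0r subr0 normc1 ln1 add0r /logsum big1// => i _.
  by rewrite expr0n/= mul0r.
have D1 : D 1 = ln (normc (1 - y)) + Re (logsum n y) by rewrite /D mul1r.
have [||c] := @MVT _ D dD 0 1 ltr01.
- by move=> x; rewrite in_itv/= => /andP[x0 x1]; apply: dDE; rewrite !ltW.
- apply: derivable_within_continuous => x; rewrite in_itv/= => x01.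
  by have := dDE _ x01 => /@ex_derive.
rewrite in_itv/= => /andP[c0 c1]; rewrite D0 !subr0 mulr1 -D1 => ->.
have nz : 1 - c%:C * y != 0 by rewrite -normc_gt0 normc_sub_gt0// !ltW.
have -> : dD c = Re (- (y * ((c%:C * y) ^+ n / (1 - c%:C * y)))).
  rewrite /dD -cReD; congr Re; rewrite -mulr_suml.
  have H : \sum_(i < n) (c%:C * y) ^+ i = (1 - (c%:C * y) ^+ n) / (1 - c%:C * y).
    apply: (mulIf nz); rewrite divfK// mulrC.
    by rewrite -opprB -[in RHS]opprB subrX1 mulNr.
  by rewrite H; field.
apply: le_trans (normRe_le _) _; rewrite normcN !(normcM, normcX, normcV) normc_real gtr0_norm//.
rewrite -[leRHS]mul1r; apply: ler_pM => //.
- by rewrite mulr_ge0 ?invr_ge0 ?normc_ge0// exprn_ge0// mulr_ge0// ltW.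
- exact: ltW.
apply: ler_pM; rewrite ?invr_ge0 ?normc_ge0 ?exprn_ge0 ?mulr_ge0 ?(ltW c0)//.
  rewrite lerXn2r ?nnegrE ?mulr_ge0 ?(ltW c0)//; first exact: le_trans yr.
  by apply: le_trans yr; rewrite ler_piMl// ltW.
rewrite lef_pV2 ?posrE ?normc_gt0// ?subr_gt0//.
have := normc_leB 1 (c%:C * y); rewrite normc1 normcM normc_real gtr0_norm//.
by apply: le_trans; rewrite lerD2l lerN2; apply: le_trans yr; rewrite ler_piMl// ltW.
Qed.

End LogSeries.

(** * Poisson integrals of continuous functions *)

Section PoissonAverage.
Variable R : realType.
Implicit Types (h : R -> R) (w : R[i]).

Lemma continuous_ln_comp h : continuous h -> (forall t, 0 < h t) -> continuous (fun t => ln (h t)).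
Proof. by move=> ch h0 t; apply: continuous_comp; [exact: ch | exact: continuous_ln]. Qed.

Lemma continuousDf h1 h2 : continuous h1 -> continuous h2 -> continuous (fun t => h1 t + h2 t).
Proof. by move=> c1 c2 t; exact: (cvgD (c1 t) (c2 t)). Qed.

Lemma continuousMf h1 h2 : continuous h1 -> continuous h2 -> continuous (fun t => h1 t * h2 t).
Proof. by move=> c1 c2 t; exact: (cvgM (c1 t) (c2 t)). Qed.

Lemma continuous_cstf (k : R) : continuous (fun _ : R => k).
Proof. by move=> t; exact: cvg_cst. Qed.

Definition pavg w h := avg (fun t => pk w t * h t).

Lemma pavgD w h1 h2 : normc w < 1 -> continuous h1 -> continuous h2 ->
  pavg w (fun t => h1 t + h2 t) = pavg w h1 + pavg w h2.
Proof.
move=> w1 c1 c2; rewrite /pavg -avgD; first by apply: eq_avg => t; rewrite mulrDr.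
all: by apply: continuousMf => //; exact: pk_continuous.
Qed.

Lemma pavg_cst w k : normc w < 1 -> pavg w (fun=> k) = k.
Proof.
move=> w1; rewrite /pavg; under eq_avg do rewrite mulrC.
by rewrite avgZ ?avg_pk ?mulr1//; exact: pk_continuous.
Qed.

Lemma pavgZ w k h : normc w < 1 -> continuous h -> pavg w (fun t => k * h t) = k * pavg w h.
Proof.
move=> w1 ch; rewrite /pavg -avgZ; first by apply: eq_avg => t; rewrite mulrCA.
by apply: continuousMf => //; exact: pk_continuous.
Qed.

Lemma le_pavg w h1 h2 : normc w < 1 -> continuous h1 -> continuous h2 ->
  (forall t, h1 t <= h2 t) -> pavg w h1 <= pavg w h2.
Proof.
move=> w1 c1 c2 h12; have cp := pk_continuous w1.
by apply: le_avg => [||t]; [exact: continuousMf..|rewrite ler_wpM2l// ltW// pk_gt0].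
Qed.

Lemma pavg_dist w h1 h2 (e : R) : normc w < 1 -> continuous h1 -> continuous h2 ->
  (forall t, `|h1 t - h2 t| <= e) -> `|pavg w h1 - pavg w h2| <= e.
Proof.
move=> w1 c1 c2 H; rewrite ler_norml; apply/andP; split.
  rewrite lerBrDr -[X in X + _](pavg_cst _ w1) -pavgD//; last exact: continuous_cstf.
  apply: le_pavg => //; first by apply: continuousDf => //; exact: continuous_cstf.
  by move=> t; have := H t; rewrite ler_norml => /andP[]; lra.
rewrite lerBlDr -[X in _ <= X + _](pavg_cst _ w1) -pavgD//; last exact: continuous_cstf.
apply: le_pavg => //; first by apply: continuousDf => //; exact: continuous_cstf.
by move=> t; have := H t; rewrite ler_norml => /andP[]; lra.
Qed.

End PoissonAverage.

(** * Logarithmic subharmonicity of holomorphic functions *)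

Section LogSubharmonic.
Variable R : realType.
Implicit Types (F G H : R[i] -> R[i]) (w a b z : R[i]).
Local Notation Re := (@complex.Re R).
Local Notation Im := (@complex.Im R).

Definition ucont F := tcont (fun t : R => F (polar 1 t)).

Lemma hol_logsum b n B : hol B (fun z => - logsum n (b * z)).
Proof.
move=> z _; rewrite (_ : (fun z => _) = (fun z => -1 * logsum n (b * z))); last first.
  by apply/funext => x; rewrite mulN1r.
apply: holoM; first exact: holo_cst.
elim: n => [|n IH]; rewrite /logsum.
  by under eq_fun do rewrite big_ord0; exact: holo_cst.
under eq_fun do rewrite big_ord_recr/=.
have H1 : holo (fun z => b * z) z by apply: holoM; [exact: holo_cst | exact: holo_id].
exact: (holoD IH (holoM (@holoX _ _ n.+1 _ H1) (@holo_cst _ n.+1%:R^-1 z))).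
Qed.

Lemma ucont_1sub b : ucont (fun z => 1 - b * z).
Proof.
by apply: tcontB; [exact: tcont_cst | apply: tcontM; [exact: tcont_cst | exact: tcont_polar]].
Qed.

(** [ln |1 - b z|] is a uniform limit on the closed disc of the functions [- Re (logsum n (b z))],
    for which Poisson's formula holds. The truncation error is met twice, on the circle and at [w],
    whence the 2 below. *)
Lemma pavg_ln_1sub b w : normc b < 1 -> normc w < 1 ->
  pavg w (fun t => ln (normc (1 - b * polar 1 t))) = ln (normc (1 - b * w)).
Proof.
move=> b1 w1; have b0 := normc_ge0 b; apply/eqP; rewrite -subr_eq0 -normr_le0.
have bz z : normc z <= 1 -> normc (b * z) <= normc b.
  by move=> z1; rewrite normcM ler_piMr.
have c1 : continuous (fun t => ln (normc (1 - b * polar 1 t))).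
  apply: continuous_ln_comp; first exact: tcont_normc (ucont_1sub b).
  move=> t; rewrite normc_gt0 sub1_neq0//; apply: le_lt_trans (bz _ _) b1.
  by rewrite normc_polar normr1.
apply/ler_addgt0Pr => e e0; rewrite add0r.
have : (fun n => 2 / (1 - normc b) * normc b ^+ n) @ \oo --> 2 / (1 - normc b) * 0.
  by apply: cvgM; [exact: cvg_cst | apply: cvg_expr; rewrite ger0_norm].
rewrite mulr0 => /cvgrPdist_le /(_ _ e0)[n _ /(_ n (leqnn n))].
rewrite /= sub0r normrN => /(le_trans (ler_norm _)) He.
have h2 : hol 2 (fun z => - logsum n (b * z)) by exact: hol_logsum.
have B2 : 1 < 2 :> R by rewrite ltr1n.
have c2 : continuous (fun t => Re (- logsum n (b * polar 1 t))).
  apply: tcont_Re; apply: (@tcont_circle _ 2 (fun z => - logsum n (b * z))).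
    by rewrite ler01.
  exact: hol_con.
have P := poisson_formula B2 h2 w1.
have A : `|pavg w (fun t => ln (normc (1 - b * polar 1 t))) - Re (- logsum n (b * w))|
    <= normc b ^+ n / (1 - normc b).
  rewrite -P; apply: pavg_dist => // t; rewrite cReN opprK; apply: ln_normc_approx => //.
  by apply: bz; rewrite normc_polar normr1.
have := ln_normc_approx n (bz w (ltW w1)) b1.
move: A; rewrite cReN => A A'; apply: le_trans He.
move: A A'; rewrite !ler_norml; set x := normc b ^+ n / _ => /andP[? ?] /andP[? ?].
have -> : 2 / (1 - normc b) * normc b ^+ n = 2 * x by rewrite /x; ring.
by apply/andP; split; lra.
Qed.

(** The shift by [d] keeps the logarithm continuous at zeros of [F] on the circle, where [ln] would
    take its default value 0 in place of minus infinity. *)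
Definition logsub F := forall w, normc w < 1 -> forall d : R, 0 < d ->
  normc (F w) <= expR (pavg w (fun t => ln (normc (F (polar 1 t)) + d))).

Lemma ucont_ln F (d : R) : ucont F -> 0 < d -> continuous (fun t => ln (normc (F (polar 1 t)) + d)).
Proof.
move=> cF d0; apply: continuous_ln_comp.
  by apply: continuousDf; [exact: tcont_normc cF | exact: continuous_cstf].
by move=> t; rewrite ltr_wpDl ?normc_ge0.
Qed.

Lemma logsub_cst (c : R[i]) : logsub (fun=> c).
Proof.
move=> w w1 d d0; rewrite pavg_cst// lnK ?posrE ?ltr_wpDl ?normc_ge0//.
by rewrite lerDl ltW.
Qed.

(** The shift absorbs the uniform error [e1]: on the circle [|G| + (d - e1) <= |F| + d]. *)
Lemma logsub_lim F : ucont F -> (forall e : R, 0 < e -> exists G, [/\ ucont G, logsub G &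
  forall z, normc z <= 1 -> normc (F z - G z) <= e]) -> logsub F.
Proof.
move=> cF H w w1 d d0; apply/ler_addgt0Pr => e e0.
pose e1 := Num.min e (d / 2); have e10 : 0 < e1 by rewrite lt_min e0; lra.
have [e1e e1d] : e1 <= e /\ e1 <= d / 2 by split; rewrite /e1 ge_min lexx ?orbT.
have [G [cG sG FG]] := H _ e10.
have d1 : 0 < d - e1 by lra.
apply: (@le_trans _ _ (normc (G w) + e1)).
  rewrite -[F w](subrK (G w)) (le_trans (le_normcD _ _))// addrC lerD2l.
  exact: FG (ltW w1).
apply: lerD => //; apply: le_trans (sG w w1 _ d1) _; rewrite ler_expR.
apply: le_pavg => //; [exact: ucont_ln|exact: ucont_ln|] => t.
rewrite ler_ln; [|by rewrite posrE ltr_wpDl ?normc_ge0..].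
have := FG (polar 1 t); rewrite normc_polar normr1 lexx => /(_ isT).
have := normc_leB (G (polar 1 t)) (F (polar 1 t)); rewrite normc_distC; lra.
Qed.

(** The shift is rescaled by the bound on [H]: [(|F| + d / M) |H| <= |F H| + d] on the circle. *)
Lemma logsub_mul F H (M : R) : ucont F -> ucont H -> logsub F ->
  (forall t, 0 < normc (H (polar 1 t)) <= M) ->
  (forall w, normc w < 1 -> normc (H w) <= expR (pavg w (fun t => ln (normc (H (polar 1 t)))))) ->
  logsub (fun z => F z * H z).
Proof.
move=> cF cH sF HM sH w w1 d d0.
have M0 : 0 < M by have /andP[/lt_le_trans] := HM 0; apply.
have dM : 0 < d / M by rewrite divr_gt0.
have H0 t : 0 < normc (H (polar 1 t)) by have /andP[] := HM t.
have F0 t : 0 < normc (F (polar 1 t)) + d / M by rewrite ltr_wpDl ?normc_ge0.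
have c1 : continuous (fun t => ln (normc (H (polar 1 t)))).
  by apply: continuous_ln_comp => //; exact: tcont_normc cH.
rewrite normcM; apply: le_trans (ler_pM (normc_ge0 _) (normc_ge0 _) (sF w w1 _ dM) (sH w w1)) _.
rewrite -expRD -pavgD//; last exact: ucont_ln.
have cFH : ucont (fun z => F z * H z) by exact: tcontM.
rewrite ler_expR; apply: le_pavg => //; last 1 first.
- move=> t; rewrite -lnM ?posrE// ler_ln ?posrE ?mulr_gt0 ?ltr_wpDl ?normc_ge0//.
  rewrite normcM mulrDl lerD2l -mulrA ler_piMr ?(ltW d0)// mulrC ler_pdivrMr// mul1r.
  by have /andP[] := HM t.
- by apply: continuousDf => //; exact: ucont_ln.
- exact: (ucont_ln cFH).
Qed.

Lemma ucontXsub a : ucont (fun z => z - a).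
Proof. by apply: tcontB; [exact: tcont_polar | exact: tcont_cst]. Qed.

Lemma normc_Xsub_le a t : normc (polar 1 t - a) <= 1 + normc a.
Proof. by apply: le_trans (le_normcB _ _) _; rewrite normc_polar normr1. Qed.

(** Up to the constant [- a], the factor is [1 - z / a], whose logarithmic modulus is reproduced
    exactly by the Poisson integral. *)
Lemma logsub_factor_out F a : ucont F -> logsub F -> 1 < normc a -> logsub (fun z => F z * (z - a)).
Proof.
move=> cF sF a1; have a0 : a != 0 by rewrite -normc_gt0; lra.
have na0 : 0 < normc a by lra.
have fact z : normc (z - a) = normc a * normc (1 - a^-1 * z).
  by rewrite -normcM mulrBr mulr1 mulrA divff// mul1r normc_distC.
have ai : normc a^-1 < 1 by rewrite normcV invf_lt1.
have pos z : normc z <= 1 -> 0 < normc (1 - a^-1 * z).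
  move=> z1; rewrite normc_gt0 sub1_neq0// normcM; apply: le_lt_trans ai.
  by rewrite ler_piMr ?normc_ge0.
apply: (@logsub_mul F _ (1 + normc a)) => //; first exact: ucontXsub.
  move=> t; rewrite normc_Xsub_le andbT fact mulr_gt0// pos//.
  by rewrite normc_polar normr1.
move=> w w1.
rewrite (_ : (fun t => _) = (fun t => ln (normc a) + ln (normc (1 - a^-1 * polar 1 t)))); last first.
  by apply/funext => t; rewrite fact lnM ?posrE ?pos// normc_polar normr1.
rewrite pavgD//; [|exact: continuous_cstf|].
  by rewrite pavg_cst// pavg_ln_1sub// expRD !lnK ?posrE ?pos ?(ltW w1)// fact.
apply: continuous_ln_comp; first exact: tcont_normc (ucont_1sub _).
by move=> t; rewrite pos// normc_polar normr1.
Qed.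

(** The difference of the squares is [(1 - |a|^2) (1 - |w|^2)]. *)
Lemma blaschke_le a w : normc a < 1 -> normc w < 1 -> normc (w - a) <= normc (1 - a^*%C * w).
Proof.
move=> a1 w1; rewrite -(ler_pXn2r (ltn0Sn 1)) ?nnegrE ?normc_ge0//.
have := sqr_lt1 a1; have := sqr_lt1 w1; rewrite !sqr_normcE.
rewrite !(cReB, cImB, cReM, cImM); case: a a1 => a b _; case: w w1 => c d _ /=.
set x := a ^+ 2 + b ^+ 2; set y := c ^+ 2 + d ^+ 2 => y1 x1.
have : 0 <= (1 - x) * (1 - y) by rewrite mulr_ge0// subr_ge0 ltW.
rewrite /x /y; lra.
Qed.

(** On the circle [|z - a| = |1 - conj a z|], and the latter is reproduced exactly by the Poisson
    integral; inside the disc it dominates [|z - a|]. *)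
Lemma logsub_factor_in F a : ucont F -> logsub F -> normc a < 1 -> logsub (fun z => F z * (z - a)).
Proof.
move=> cF sF a1; have a1' : normc a^*%C < 1 by rewrite normc_conj.
apply: (@logsub_mul F _ (1 + normc a)) => //; first exact: ucontXsub.
  by move=> t; rewrite normc_Xsub_le andbT normc_unit_sub_gt0.
move=> w w1.
rewrite (_ : (fun t => _) = (fun t => ln (normc (1 - a^*%C * polar 1 t)))); last first.
  apply/funext => t; congr ln.
  rewrite -[RHS]mulr1 -[X in _ * X](_ : normc (polar 1 t)^*%C = 1); last first.
    by rewrite normc_conj normc_polar normr1.
  rewrite -normcM mulrBl mul1r -mulrA mul_conjc normc_polar normr1 expr1n mulr1.
  by rewrite -conjcB normc_conj.
rewrite pavg_ln_1sub// lnK; first exact: blaschke_le.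
by rewrite posrE normc_gt0 sub1_neq0// normcM normc_conj mulr_ilt1 ?normc_ge0.
Qed.

(** The remaining case is a zero on the circle itself: it is pushed out to [(1 + k) a], and the
    uniform limit [k -> 0] is taken. *)
Lemma logsub_factor F a (M : R) : ucont F -> logsub F -> (forall z, normc z <= 1 -> normc (F z) <= M) ->
  logsub (fun z => F z * (z - a)).
Proof.
move=> cF sF FM; have [a1|a1|a1] := ltgtP (normc a) 1.
- exact: logsub_factor_in.
- exact: logsub_factor_out.
apply: logsub_lim => [|e e0]; first by apply: tcontM => //; exact: ucontXsub.
have M0 : 0 <= M by apply: le_trans (normc_ge0 _) (FM 0 _); rewrite normc0.
pose k := e / (1 + M); have k0 : 0 < k by rewrite divr_gt0//; lra.
exists (fun z => F z * (z - (1 + k)%:C * a)); split.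
- by apply: tcontM => //; exact: ucontXsub.
- by apply: logsub_factor_out => //; rewrite normcM a1 mulr1 normc_real gtr0_norm; lra.
- move=> z z1; have -> : F z * (z - a) - F z * (z - (1 + k)%:C * a) = F z * (k%:C * a).
    by rewrite rmorphD rmorph1; ring.
  rewrite !normcM a1 mulr1 normc_real gtr0_norm// (le_trans (ler_wpM2r (ltW k0) (FM z z1)))//.
  by rewrite /k mulrCA ler_piMr ?(ltW e0)// ler_pdivrMr; lra.
Qed.

Lemma hol_horner (p : {poly R[i]}) B : hol B (horner p).
Proof.
elim/poly_ind: p => [|p c IH] z zB.
  rewrite (_ : horner 0 = fun=> 0); first exact: holo_cst.
  by apply/funext => x; rewrite horner0.
rewrite (_ : horner _ = fun x => p.[x] * x + c); last by apply/funext => x; rewrite !hornerE.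
apply: holoD; last exact: holo_cst.
by apply: holoM; [exact: IH | exact: holo_id].
Qed.

Lemma hol_ucont B F : 1 < B -> hol B F -> ucont F.
Proof. by move=> B1 hF; apply: (@tcont_circle _ B); [rewrite ler01 | exact: hol_con]. Qed.

Lemma logsub_poly (p : {poly R[i]}) : logsub (horner p).
Proof.
have B2 : 1 < 2 :> R by rewrite ltr1n.
have [r ->] := closed_field_poly_normal p; elim: r => [|a r IH].
  rewrite big_nil (_ : horner _ = fun=> lead_coef p); first exact: logsub_cst.
  by apply/funext => x; rewrite !hornerE.
rewrite big_cons (_ : horner _ = fun z =>
    (lead_coef p *: \prod_(z <- r) ('X - z%:P)).[z] * (z - a)); last first.
  by apply/funext => x; rewrite !hornerZ hornerM hornerXsubC; ring.
have [M HM] := con_bounded (hol_con (@hol_horner (lead_coef p *: \prod_(z <- r) ('X - z%:P)) 2)) B2.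
by apply: (logsub_factor a _ IH HM); apply: (hol_ucont B2); exact: hol_horner.
Qed.

Theorem logsub_hol B F : 1 < B -> hol B F -> logsub F.
Proof.
move=> B1 hF; apply: logsub_lim => [|e e0]; first exact: hol_ucont hF.
have [p Hp] := poly_approx B1 hF e0; exists (horner p); split => //; last exact: logsub_poly.
by apply: (@hol_ucont 2); [rewrite ltr1n | exact: hol_horner].
Qed.

End LogSubharmonic.

(** * Power means, Harnack's inequality and boundary distance *)

Section PowerMeans.
Variable R : realType.
Implicit Types (h : R -> R) (F f g : R[i] -> R[i]) (w z : R[i]).
Local Notation Re := (@complex.Re R).
Local Notation Im := (@complex.Im R).

Lemma powR_le (x y p : R) : 0 <= p -> 0 <= x -> x <= y -> x `^ p <= y `^ p.
Proof. by move=> p0 x0 xy; apply: ge0_ler_powR; rewrite ?nnegrE// (le_trans x0). Qed.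

Lemma powR_addle (x y p : R) : 0 <= p -> 0 <= x -> 0 <= y ->
  (x + y) `^ p <= 2 `^ p * (x `^ p + y `^ p).
Proof.
move=> p0; wlog xy : x y / x <= y => [H x0 y0|x0 y0].
  by have [xy|/ltW yx] := leP x y; [|rewrite addrC [x `^ p + _]addrC]; exact: H.
apply: (@le_trans _ _ ((2 * y) `^ p)); first by apply: powR_le => //; lra.
by rewrite powRM// ler_wpM2l ?powR_ge0// lerDr powR_ge0.
Qed.

Lemma powR_small (p e : R) : 0 < p -> 0 < e -> exists2 k : R, 0 < k & k `^ p = e.
Proof.
move=> p0 e0; exists (e `^ p^-1); first exact: powR_gt0.
by rewrite -powRrM mulVf ?gt_eqF// powRr1// ltW.
Qed.

Lemma continuous_powR_at h (p t : R) : 0 < p -> (forall t, 0 <= h t) -> {for t, continuous h} ->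
  {for t, continuous (fun t => h t `^ p)}.
Proof.
move=> p0 h0 ch; have := h0 t; rewrite le_eqVlt => /predU1P[ht|ht].
  apply/cvgrPdist_lt => e e0; rewrite -ht powR0 ?gt_eqF//.
  have [k k0 kE] := powR_small p0 e0.
  near=> s; rewrite sub0r normrN ger0_norm ?powR_ge0// -kE.
  apply: gt0_ltr_powR; rewrite ?nnegrE ?(ltW k0)//.
  have : `|h t - h s| < k by near: s; have /cvgrPdist_lt/(_ _ k0) := ch.
  by rewrite -ht sub0r normrN ger0_norm.
apply: (@continuous_comp _ _ _ h (fun x => x `^ p)); first exact: ch.
apply: differentiable_continuous; apply/derivable1_diffP.
by apply: derivable_powR; rewrite in_itv/= ht.
Unshelve. all: by end_near. Qed.

Lemma continuous_powR_comp h (p : R) : 0 < p -> (forall t, 0 <= h t) -> continuous h ->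
  continuous (fun t => h t `^ p).
Proof. by move=> p0 h0 ch t; apply: continuous_powR_at => //; exact: ch. Qed.

Lemma ucont_powR F (p : R) : 0 < p -> ucont F -> continuous (fun t => normc (F (polar 1 t)) `^ p).
Proof. by move=> p0 cF; apply: continuous_powR_comp => // [t|]; [exact: normc_ge0 | exact: tcont_normc cF]. Qed.

(** The exponential lies above its tangent line at [c], and the Poisson integral of that tangent is
    [expR c] because the kernel has mean 1. *)
Lemma jensen_exp w h : normc w < 1 -> continuous h -> expR (pavg w h) <= pavg w (fun t => expR (h t)).
Proof.
move=> w1 ch; set c := pavg w h.
have ce : continuous (fun t => expR (h t)).
  by move=> t; apply: continuous_comp; [exact: ch | exact: continuous_expR].
have c1 : continuous (fun t => h t + (1 - c)) by apply: continuousDf => //; exact: continuous_cstf.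
have -> : expR c = pavg w (fun t => expR c * (h t + (1 - c))).
  rewrite pavgZ// pavgD//; last exact: continuous_cstf.
  by rewrite pavg_cst// -/c subrKC mulr1.
apply: le_pavg => // [|t].
  by apply: continuousMf => //; exact: continuous_cstf.
rewrite -[h t in leRHS](subrKC c) expRD ler_wpM2l ?expR_ge0//.
by apply: le_trans (expR_ge1Dx _); lra.
Qed.

Lemma poisson_powR B F w (p : R) : 1 < B -> hol B F -> normc w < 1 -> 0 < p ->
  normc (F w) `^ p <= 2 `^ p * pavg w (fun t => normc (F (polar 1 t)) `^ p).
Proof.
move=> B1 hF w1 p0; have cF := hol_ucont B1 hF.
apply/ler_addgt0Pr => e e0.
have two0 : 0 < 2 `^ p :> R by rewrite powR_gt0.
(* Separating [|F|] from the shift [d] costs the factor [2^p] of the statement; [d] is chosen so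
   that its own contribution [2^p d^p] is exactly [e]. *)
have [d d0 dE] := powR_small p0 (divr_gt0 e0 two0).
have cl := ucont_ln cF d0.
have pos t : 0 < normc (F (polar 1 t)) + d by rewrite ltr_wpDl ?normc_ge0.
apply: le_trans (powR_le (ltW p0) (normc_ge0 _) (logsub_hol B1 hF w1 d0)) _.
rewrite -expRM [_ * p]mulrC -(pavgZ p w1 cl).
have cpl : continuous (fun t => p * ln (normc (F (polar 1 t)) + d)).
  by apply: continuousMf => //; exact: continuous_cstf.
apply: (le_trans (jensen_exp w1 cpl)).
have cp := ucont_powR p0 cF.
have c2 : continuous (fun t => 2 `^ p * (normc (F (polar 1 t)) `^ p + d `^ p)).
  apply: continuousMf; first exact: continuous_cstf.
  by apply: continuousDf => //; exact: continuous_cstf.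
apply: (@le_trans _ _ (pavg w (fun t => 2 `^ p * (normc (F (polar 1 t)) `^ p + d `^ p)))).
  apply: le_pavg => // [|t].
    by move=> t; apply: continuous_comp; [exact: cpl | exact: continuous_expR].
  rewrite mulrC expRM lnK ?posrE//; apply: powR_addle; rewrite ?normc_ge0 ?ltW//.
rewrite pavgZ// ?pavgD// ?pavg_cst//; [|exact: continuous_cstf|].
  by rewrite mulrDr lerD2l dE mulrC divfK// gt_eqF.
by apply: continuousDf => //; exact: continuous_cstf.
Qed.

Lemma harnack B g w : 1 < B -> hol B g -> (forall t, 0 <= Re (g (polar 1 t))) -> normc w < 1 ->
  (1 - normc w) / 2 * Re (g 0) <= Re (g w) <= 2 / (1 - normc w) * Re (g 0).
Proof.
move=> B1 hg g0 w1; have cg := tcont_Re (hol_ucont B1 hg).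
have m : Re (g 0) = avg (fun t => Re (g (polar 1 t))).
  by rewrite (mean_value hg)// ler01.
rewrite -(poisson_formula B1 hg w1) m -!avgZ//.
have cp := pk_continuous w1.
apply/andP; split; apply: le_avg => [||t]; try by apply: continuousMf => //; exact: continuous_cstf.
- by rewrite ler_wpM2r// pk_ge.
- by rewrite ler_wpM2r// pk_le.
Qed.

Lemma hol_dilate B f (r : R) : 0 < r -> hol B f -> hol (B / r) (fun z => f (r%:C * z)).
Proof.
move=> r0 hf z zB; apply: (@holo_comp _ f (fun z => r%:C * z)).
  by apply: holoM; [exact: holo_cst | exact: holo_id].
by apply: hf; rewrite normcM normc_real gtr0_norm// mulrC -ltr_pdivlMr.
Qed.

Definition selfmap f := hol 1 f /\ forall z, normc z < 1 -> normc (f z) < 1.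

(** Harnack's lower bound for the real part of [1 - k f], with [|k| <= 1] and [Re (k f z) = |f z|].
    The dilation by [r = (1 + |z|) / 2] provides holomorphy beyond the closed disc and halves the
    distance to the circle, so the 4 is Harnack's 2 times this 2. *)
Lemma selfmap_boundary_dist f z : selfmap f -> normc z < 1 ->
  (1 - normc z) * (1 - normc (f 0)) / 4 <= 1 - normc (f z).
Proof.
move=> [hf sf] z1; have z0 := normc_ge0 z.
have [k k1 kE] := norm_as_Re (f z).
pose r := (1 + normc z) / 2; have r0 : 0 < r by rewrite /r; lra.
have r1 : r < 1 by rewrite /r; lra.
have rC : r%:C != 0 by rewrite -normc_gt0 normc_real gtr0_norm.
pose g x := 1 - k * f (r%:C * x).
have hg : hol (1 / r) g.
  move=> x xr; apply: holoB; first exact: holo_cst.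
  by apply: holoM; [exact: holo_cst | exact: (hol_dilate r0 hf)].
have B1 : 1 < 1 / r by rewrite ltr_pdivlMr// mul1r.
have Rk x : normc x < 1 -> Re (k * f x) <= normc (f x).
  by move=> x1; apply: le_trans (Re_le_normc _) _; rewrite normcM ler_piMl ?normc_ge0.
have g0 t : 0 <= Re (g (polar 1 t)).
  rewrite /g cReB subr_ge0; have n : normc (r%:C * polar 1 t) < 1.
    by rewrite normcM normc_real normc_polar normr1 mulr1 gtr0_norm.
  exact: le_trans (Rk _ n) (ltW (sf _ n)).
pose w := r%:C^-1 * z.
have nw : normc w = normc z / r by rewrite normcM normcV normc_real gtr0_norm// mulrC.
have w1 : normc w < 1 by rewrite nw ltr_pdivrMr// /r; lra.
have /andP[H _] := harnack B1 hg g0 w1.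
move: H; rewrite /g /w mulr0 mulrA divff// mul1r !cReB kE; apply: le_trans.
have f01 := sf 0; rewrite normc0 in f01; have {}f01 := f01 ltr01.
have R0 := Rk 0; rewrite normc0 in R0; have {}R0 := R0 ltr01.
have W : (1 - normc z) / 2 <= 1 - normc w.
  rewrite nw; have -> : 1 - normc z / r = (1 - normc z) / (2 * r).
    by rewrite /r; field; rewrite gt_eqF//; lra.
  by apply: ler_wpM2l; [lra | rewrite lef_pV2 ?posrE; lra].
rewrite -/w; apply: (@le_trans _ _ ((1 - normc w) / 2 * (1 - normc (f 0)))).
  by rewrite [leLHS](_ : _ = (1 - normc z) / 2 / 2 * (1 - normc (f 0))); [apply: ler_wpM2r; lra | field].
by apply: ler_wpM2l; [lra | rewrite lerD2l lerN2].
Qed.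

End PowerMeans.

(** * Exchanging the mean with the Poisson integral *)

Section Swap.
Variable R : realType.
Local Notation mu := (@lebesgue_measure R).
Implicit Types (h g : R -> R) (W : R -> R[i]).
Local Notation Re := (@complex.Re R).
Local Notation Im := (@complex.Im R).

Lemma rintE (a b : R) h : continuous h ->
  (rint a b h)%:E = (\int[mu]_(x in `[a, b]) (h x)%:E)%E.
Proof.
by move=> ch; rewrite /rint /Rintegral fineK//; apply: integrable_fin_num => //; apply: conton_integrable; exact: contonT.
Qed.

Lemma rint_swap (a b c d : R) (K : R -> R -> R) :
  (forall t s, 0 <= K t s) -> (forall t, continuous (K t)) -> (forall s, continuous (K ^~ s)) ->
  measurable_fun [set: R * R] (fun z => K z.1 z.2) ->
  rint a b (fun t => rint c d (K t)) = rint c d (fun s => rint a b (K ^~ s)).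
Proof.
move=> K0 c1 c2 mK; rewrite /rint /Rintegral; congr fine.
under eq_integral do rewrite -/(rint c d (K _)) rintE//.
under [RHS]eq_integral do rewrite -/(rint a b (K ^~ _)) rintE//.
pose A := `[a, b]%classic : set R; pose B := `[c, d]%classic : set R.
pose f : R * R -> \bar R := (fun z : R * R => (K z.1 z.2)%:E) \_ (A `*` B).
have mA : measurable A by exact: measurable_itv.
have mB : measurable B by exact: measurable_itv.
have mf : measurable_fun [set: R * R] f.
  have mAB : measurable (A `*` B) by exact: measurableX.
  apply/(measurable_restrictT _ mAB).
  by apply: measurable_funTS; exact/measurable_EFinP.
have f0 z : (0 <= f z)%E by rewrite /f patchE; case: ifP => // _; rewrite lee_fin.
have := @fubini_tonelli _ _ _ _ _ mu mu f mf f0.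
rewrite [LHS](_ : _ = \int[mu]_(t in A) \int[mu]_(s in B) (K t s)%:E)%E; last first.
  rewrite [RHS]integral_mkcond; apply: eq_integral => t _.
  rewrite patchE; case: ifPn => tA.
    rewrite [RHS]integral_mkcond; apply: eq_integral => s _.
    by rewrite /f !patchE in_setX tA.
  by apply: integral0_eq => s _; rewrite /f patchE in_setX (negbTE tA).
move=> ->; rewrite [RHS]integral_mkcond; apply: eq_integral => s _.
rewrite patchE; case: ifPn => sB.
  rewrite [RHS]integral_mkcond; apply: eq_integral => t _.
  by rewrite /f !patchE in_setX /= sB andbT.
by apply: integral0_eq => t _; rewrite /f patchE in_setX /= (negbTE sB) andbF.
Qed.

Lemma avg_swap (K : R -> R -> R) :
  (forall t s, 0 <= K t s) -> (forall t, continuous (K t)) -> (forall s, continuous (K ^~ s)) ->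
  measurable_fun [set: R * R] (fun z => K z.1 z.2) ->
  avg (fun t => avg (K t)) = avg (fun s => avg (K ^~ s)).
Proof.
move=> K0 c1 c2 mK; rewrite /avg; congr (_ * _); set k := _^-1.
have k0 : 0 <= k by rewrite invr_ge0 ltW// twopi_gt0.
transitivity (rint 0 (2 * pi) (fun t => rint 0 (2 * pi) (fun s => k * K t s))).
  by apply: eq_rint => t _; rewrite rintZ//; exact: contonT.
rewrite (@rint_swap _ _ _ _ (fun t s => k * K t s)).
- by apply: eq_rint => t _; rewrite rintZ//; exact: contonT.
- by move=> t s; rewrite mulr_ge0.
- by move=> t; apply: continuousMf => //; exact: continuous_cstf.
- by move=> t; apply: continuousMf => //; exact: continuous_cstf.
- by apply: measurable_funM => //; exact: measurable_cst.
Qed.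

(** The inverse is written as a power [-1], so that joint measurability in [(t, s)] follows from
    [measurable_powR]. *)
Lemma pk_joint W (t s : R) : pk (W t) s = (1 - (Re (W t) ^+ 2 + Im (W t) ^+ 2)) *
  ((cos s - Re (W t)) ^+ 2 + (sin s - Im (W t)) ^+ 2) `^ (-1).
Proof.
by rewrite /pk !sqr_normcE cReB cImB /= !mul1r powR_inv1// addr_ge0// sqr_ge0.
Qed.

Lemma avg_pavg W g : tcont W -> (forall t, normc (W t) < 1) -> continuous g -> (forall s, 0 <= g s) ->
  avg (fun t => pavg (W t) g) = avg (fun s => avg (fun t => pk (W t) s) * g s).
Proof.
move=> cW W1 cg g0.
have cpk s : continuous (fun t => pk (W t) s).
  under eq_fun do rewrite pk_joint.
  have cR := tcont_Re cW; have cI := tcont_Im cW.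
  have sq h : continuous h -> continuous (fun t => h t ^+ 2).
    by move=> ch; under eq_fun do rewrite expr2; exact: continuousMf.
  have op h : continuous h -> continuous (fun t => - h t).
    by move=> ch t; apply: cvgN; exact: ch.
  have c1 : continuous (fun t => (cos s - Re (W t)) ^+ 2 + (sin s - Im (W t)) ^+ 2).
    by apply: continuousDf; apply: sq; apply: continuousDf; try exact: op; exact: continuous_cstf.
  apply: continuousMf.
    by apply: continuousDf; [exact: continuous_cstf | apply: op; apply: continuousDf; exact: sq].
  move=> t; under eq_fun do rewrite powR_inv1 ?addr_ge0 ?sqr_ge0//.
  apply: cvgV; last exact: c1.
  have -> : (cos s - Re (W t)) ^+ 2 + (sin s - Im (W t)) ^+ 2 = normc (polar 1 s - W t) ^+ 2.
    by rewrite sqr_normcE cReB cImB /= !mul1r.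
  by rewrite expf_eq0/= normc_eq0 unit_circle_sub_neq0.
rewrite /pavg (@avg_swap (fun t s => pk (W t) s * g s)).
- by apply: eq_avg => s; under eq_avg do rewrite mulrC; rewrite avgZ// mulrC.
- by move=> t s; rewrite mulr_ge0// ltW// pk_gt0.
- by move=> t; apply: continuousMf => //; exact: pk_continuous.
- by move=> s; apply: continuousMf => //; exact: continuous_cstf.
have m1 h : continuous h -> measurable_fun [set: R * R] (fun z => h z.1).
  move=> ch; apply: (measurableT_comp (f := h)); last exact: measurable_fst.
  exact: continuous_measurable_fun.
have m2 h : continuous h -> measurable_fun [set: R * R] (fun z => h z.2).
  move=> ch; apply: (measurableT_comp (f := h)); last exact: measurable_snd.
  exact: continuous_measurable_fun.
under eq_fun do rewrite pk_joint.
have mR := m1 _ (tcont_Re cW); have mI := m1 _ (tcont_Im cW).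
apply: measurable_funM; last exact: m2.
apply: measurable_funM.
  apply: measurable_funB; first exact: measurable_cst.
  by apply: measurable_funD; apply: measurable_funX.
apply: (measurableT_comp (f := fun x => x `^ (-1))); first exact: measurable_powR.
by apply: measurable_funD; apply: measurable_funX; apply: measurable_funB => //;
  apply: m2; [exact: continuous_cos | exact: continuous_sin].
Qed.

End Swap.

(** * Subordination with a shift of radius *)

Section Subordination.
Variable R : realType.
Implicit Types (f phi : R[i] -> R[i]) (w z : R[i]).
Local Notation Re := (@complex.Re R).
Local Notation Im := (@complex.Im R).

(** The Herglotz kernel: holomorphic in [w], so after composition with a holomorphic map the mean
    value property still applies. *)
Lemma pk_Re w (s : R) : normc w < 1 -> pk w s = Re ((polar 1 s + w) / (polar 1 s - w)).
Proof.
move=> w1; have nz := unit_circle_sub_neq0 s w1.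
have G (x y : R[i]) : y != 0 -> Re (x / y) = (normc y ^+ 2)^-1 * Re (x * y^*%C).
  move=> y0; rewrite -cReMr; congr Re; rewrite realcV -mul_conjc.
  have cy : y^*%C != 0 by rewrite conjc_eq0.
  by move: (y^*%C) cy => v v0; field; rewrite ?y0 ?v0.
rewrite G// /pk mulrC; congr (_ * _); rewrite cReM cReD cImD.
have -> : Re (polar 1 s - w)^*%C = Re (polar 1 s - w) by case: (_ - _).
have -> : Im (polar 1 s - w)^*%C = - Im (polar 1 s - w) by case: (_ - _).
rewrite cReB cImB sqr_normcE.
have := sqr_normcE (polar 1 s); rewrite normc_polar normr1 expr1n.
move: (Re (polar 1 s)) (Im (polar 1 s)) (Re w) (Im w) => x y u v; lra.
Qed.

Lemma pk_lip w w' (th s : R) : normc w <= th -> normc w' <= th -> th < 1 ->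
  `|pk w s - pk w' s| <= 2 / (1 - th) ^+ 2 * normc (w - w').
Proof.
move=> wt wt' t1; have w1 := le_lt_trans wt t1; have w1' := le_lt_trans wt' t1.
have n1 := unit_circle_sub_neq0 s w1; have n2 := unit_circle_sub_neq0 s w1'.
rewrite !pk_Re// -cReB; apply: le_trans (normRe_le _) _.
have -> : (polar 1 s + w) / (polar 1 s - w) - (polar 1 s + w') / (polar 1 s - w') =
  2 * polar 1 s * (w - w') * ((polar 1 s - w)^-1 * (polar 1 s - w')^-1).
  by field; rewrite n1 n2.
rewrite !(normcM, normcV) normc_polar normr1 mulr1.
have -> : normc (2 : R[i]) = 2 by rewrite (_ : (2 : R[i]) = (2%:R : R)%:C) ?natc// -natc normc_real ger0_norm.
have d x : normc x <= th -> (normc (polar 1 s - x))^-1 <= (1 - th)^-1.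
  move=> xt; rewrite lef_pV2 ?posrE ?subr_gt0 ?normc_unit_sub_gt0 ?(le_lt_trans xt)//.
  by have := normc_leB (polar 1 s) x; rewrite normc_polar normr1; lra.
rewrite [leRHS](_ : _ = 2 * normc (w - w') * ((1 - th)^-1 * (1 - th)^-1)); last first.
  by rewrite expr2 invfM; ring.
apply: ler_wpM2l; first by rewrite mulr_ge0// normc_ge0.
by apply: ler_pM; rewrite ?invr_ge0 ?normc_ge0// d.
Qed.

Lemma pavg_continuous (W : R -> R[i]) (g : R -> R) : tcont W -> (forall t, normc (W t) < 1) ->
  continuous g -> (forall s, 0 <= g s) -> continuous (fun t => pavg (W t) g).
Proof.
move=> cW W1 cg g0 t; apply/cvgrPdist_lt => e e0.
pose th := (1 + normc (W t)) / 2; have Wt := W1 t.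
have th1 : th < 1 by rewrite /th; lra.
pose L := 2 / (1 - th) ^+ 2; have L0 : 0 <= L by rewrite divr_ge0// sqr_ge0.
have G0 := avg_ge0 cg g0.
have k1 : 0 < th - normc (W t) by rewrite /th; lra.
have LG : 0 <= L * avg g by rewrite mulr_ge0.
have k2 : 0 < e / (1 + L * avg g) by rewrite divr_gt0//; lra.
have [l1 l10 H1] := cW t _ k1; have [l2 l20 H2] := cW t _ k2.
near=> s.
have /H1 h1 : `|s - t| < l1 by rewrite distrC; near: s; exact: cvgr_dist_lt.
have /H2 h2 : `|s - t| < l2 by rewrite distrC; near: s; exact: cvgr_dist_lt.
have ws : normc (W s) <= th.
  by rewrite -[W s](subrK (W t)) (le_trans (le_normcD _ _))//; lra.
have wt : normc (W t) <= th by rewrite /th; lra.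
rewrite normc_distC in h2.
have cpt := pk_continuous (W1 t); have cps := pk_continuous (W1 s).
have cd : continuous (fun x => pk (W t) x - pk (W s) x) by move=> x; exact: (cvgB (cpt x) (cps x)).
rewrite /pavg -avgB; [|exact: continuousMf..].
have : `|avg (fun x => pk (W t) x * g x - pk (W s) x * g x)| <= L * normc (W t - W s) * avg g.
  have cL : continuous (fun x => L * normc (W t - W s) * g x).
    by apply: continuousMf => //; exact: continuous_cstf.
  rewrite -avgZ//; under eq_avg do rewrite -mulrBl.
  rewrite ler_norml; apply/andP; split.
    rewrite -mulN1r -avgZ//; apply: le_avg; [|exact: continuousMf|].
      by apply: continuousMf => //; exact: continuous_cstf.
    move=> x; rewrite mulN1r -mulNr ler_wpM2r//.
    by have := pk_lip x wt ws th1; rewrite ler_norml => /andP[].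
  apply: le_avg => //; first exact: continuousMf.
  move=> x; rewrite ler_wpM2r//.
  by have := pk_lip x wt ws th1; rewrite ler_norml => /andP[].
move=> /le_lt_trans; apply; rewrite ltr_pdivlMr in h2; last lra.
have := normc_ge0 (W t - W s); nra.
Unshelve. all: by end_near. Qed.

Section Bounds.
Variables (phi : R[i] -> R[i]) (a r : R).
Hypotheses (sphi : selfmap phi) (phia : normc (phi 0) <= a) (a1 : a < 1) (r01 : 0 <= r < 1).
(** [selfmap_boundary_dist] gives [1 - |phi z| >= (1 - |z|) (1 - a) / 4], and
    [1 - |z| > (1 - r) / 2] on the disc of radius [(1 + r) / 2]; hence the 8. Thus [phi / rho] maps
    this disc, which has the circle of radius [r] in its interior, into the unit disc. *)
Let c : R := (1 - a) / 8.
Let rho : R := 1 - c * (1 - r).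

Let a0 : 0 <= a.
Proof. exact: le_trans (normc_ge0 _) phia. Qed.

Let cr : 0 < c * (1 - r) <= c.
Proof.
have /andP[? ?] := r01; have c0 : 0 < c by rewrite /c; move: a1; lra.
by rewrite mulr_gt0//=; [rewrite ler_piMr//; lra | lra].
Qed.

Let c8 : c <= 1 / 8.
Proof. by rewrite /c; move: a0; lra. Qed.

Let rho_gt0 : 0 < rho.
Proof. by have /andP[? ?] := cr; have := c8; rewrite /rho; lra. Qed.

Let rho_lt1 : rho < 1.
Proof. by have /andP[? ?] := cr; rewrite /rho; lra. Qed.

Let rhoC : rho%:C != 0.
Proof. by rewrite -normc_gt0 normc_real gtr0_norm. Qed.

Let phi_rho z : normc z < (1 + r) / 2 -> normc (rho%:C^-1 * phi z) < 1.
Proof.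
move=> zr; have /andP[r0 r1] := r01; have A1 := a1; have PA := phia.
have z1 : normc z < 1 by lra.
have := selfmap_boundary_dist sphi z1 => H.
rewrite normcM normcV normc_real gtr0_norm// mulrC ltr_pdivrMr// mul1r.
have : c * (1 - r) < (1 - normc z) * (1 - normc (phi 0)) / 4.
  have h1 : (1 - r) / 2 < 1 - normc z by lra.
  have h2 : 1 - a <= 1 - normc (phi 0) by lra.
  apply: (@lt_le_trans _ _ ((1 - normc z) * (1 - a) / 4)).
    by rewrite /c; nra.
  by rewrite ler_pM2r//; apply: ler_wpM2l => //; lra.
by rewrite /rho; lra.
Qed.

Let r_half : 0 <= r < (1 + r) / 2.
Proof. by have /andP[? ?] := r01; apply/andP; split; lra. Qed.

Let hphi : hol ((1 + r) / 2) (fun z => rho%:C^-1 * phi z).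
Proof.
move=> z zr; apply: holoM; first exact: holo_cst.
by apply: sphi.1; have /andP[? ?] := r01; lra.
Qed.

Let polar_r (t : R) : normc (polar r t) < (1 + r) / 2.
Proof. by have /andP[? ?] := r_half; rewrite normc_polar ger0_norm. Qed.

Lemma avg_pk_comp (s : R) :
  avg (fun t => pk (rho%:C^-1 * phi (polar r t)) s) = pk (rho%:C^-1 * phi 0) s.
Proof.
have /andP[r0 r1] := r_half.
have hg : hol ((1 + r) / 2) (fun z => (polar 1 s + rho%:C^-1 * phi z) / (polar 1 s - rho%:C^-1 * phi z)).
  move=> z zr; have hz := hphi zr.
  have h1 := holoD (@holo_cst _ (polar 1 s) z) hz.
  have h2 := holoB (@holo_cst _ (polar 1 s) z) hz.
  apply: (holoM h1); apply: (holoV _ h2).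
  by apply: unit_circle_sub_neq0; exact: phi_rho.
rewrite pk_Re; last by apply: phi_rho; rewrite normc0; lra.
rewrite -(mean_value hg r_half); apply: eq_avg => t; rewrite pk_Re//.
exact: phi_rho.
Qed.

Let comp_rho f z : f (rho%:C * (rho%:C^-1 * phi z)) = f (phi z).
Proof. by rewrite mulrA divff// mul1r. Qed.

Let B1 : 1 < 1 / rho.
Proof. by rewrite ltr_pdivlMr// mul1r. Qed.

Lemma subordination_powR f (p : R) : hol 1 f -> 0 < p ->
  avg (fun t => normc (f (phi (polar r t))) `^ p) <=
  2 `^ p * (4 / (1 - a)) * avg (fun s => normc (f (polar rho s)) `^ p).
Proof.
move=> hf p0; have hF := hol_dilate rho_gt0 hf.
have cF := hol_ucont B1 hF.
pose g s := normc (f (rho%:C * polar 1 s)) `^ p.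
have cg : continuous g := ucont_powR p0 cF.
have g0 s : 0 <= g s by exact: powR_ge0.
have -> : avg (fun s => normc (f (polar rho s)) `^ p) = avg g.
  by apply: eq_avg => s; rewrite /g -polarE.
pose W t := rho%:C^-1 * phi (polar r t).
have cW : tcont W by apply: (tcont_circle r_half (hol_con hphi)).
have W1 t : normc (W t) < 1 by exact: phi_rho.
have cphi : tcont (fun t => f (phi (polar r t))).
  have /andP[r0 r1] := r01.
  apply: (@tcont_circle _ 1 (fun z => f (phi z))) => // z z1.
  by apply: holo_ccont; apply: holo_comp; [exact: sphi.1 | apply: hf; exact: sphi.2].
have cP : continuous (fun t => pavg (W t) g).
  exact: pavg_continuous.
apply: (@le_trans _ _ (avg (fun t => 2 `^ p * pavg (W t) g))).
  apply: le_avg.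
  - by apply: continuous_powR_comp => // [t|]; [exact: normc_ge0 | exact: tcont_normc].
  - by apply: continuousMf => //; exact: continuous_cstf.
  - by move=> t; have := poisson_powR B1 hF (W1 t) p0; rewrite /W comp_rho.
rewrite avgZ// -mulrA ler_wpM2l ?powR_ge0// avg_pavg// -avgZ//.
have w0 : normc (rho%:C^-1 * phi 0) < 1.
  by apply: phi_rho; rewrite normc0; have /andP[? ?] := r01; lra.
under eq_avg do rewrite avg_pk_comp.
apply: le_avg.
- by apply: continuousMf => //; exact: pk_continuous.
- by apply: continuousMf => //; exact: continuous_cstf.
move=> s; rewrite ler_wpM2r//; apply: le_trans (pk_le s w0) _.
rewrite ler_pdivrMr ?subr_gt0// mulrAC ler_pdivlMr ?subr_gt0//.
(* Together with [pk_le] this is the constant [4 / (1 - a)]: as [rho >= 1 - c], dividing [phi 0] by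
   [rho] loses at most half of the gap [1 - a]. *)
suff : (1 - a) / 2 <= 1 - normc (rho%:C^-1 * phi 0) by lra.
rewrite normcM normcV normc_real gtr0_norm//.
have H : rho^-1 * normc (phi 0) <= a / rho by rewrite mulrC ler_wpM2r// invr_ge0 ltW.
suff : a / rho <= 1 - (1 - a) / 2 by lra.
rewrite ler_pdivrMr//; have /andP[? ?] := cr.
have A1 := a1; have A0 := a0; have rc : 1 - c <= rho by rewrite /rho; lra.
by apply: (@le_trans _ _ ((1 - (1 - a) / 2) * (1 - c))); [rewrite /c; nra | apply: ler_wpM2l; lra].
Qed.

Lemma subordination_sup f (S : R) : hol 1 f -> (forall s, normc (f (polar rho s)) <= S) ->
  forall t, normc (f (phi (polar r t))) <= 2 * S.
Proof.
move=> hf fS t; have hF := hol_dilate rho_gt0 hf.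
have := poisson_powR B1 hF (phi_rho (polar_r t)) ltr01.
rewrite comp_rho powRr1 ?normc_ge0// powRr1//; move/le_trans; apply.
rewrite ler_wpM2l//; have w1 := phi_rho (polar_r t).
rewrite -[leRHS](pavg_cst _ w1); apply: le_pavg => //.
- exact: (ucont_powR ltr01 (hol_ucont B1 hF)).
- exact: continuous_cstf.
- by move=> s; rewrite powRr1 ?normc_ge0// -polarE.
Qed.

End Bounds.
End Subordination.

(** * Integral means: finiteness, quasi-triangle inequality, regularity in r *)

Section IntegralMeans.
Variable R : realType.
Local Notation mu := (@lebesgue_measure R).
Implicit Types (f g phi : R[i] -> R[i]) (p : \bar R) (r : R).

Definition mp p f r : R := fine (Mp p f r).

Lemma avg_nonneg (h : R -> R) : (forall t, 0 <= h t) -> 0 <= avg h.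
Proof.
move=> h0; rewrite mulr_ge0 ?invr_ge0 ?(ltW (twopi_gt0 R))//.
by apply: Rintegral_ge0 => t _.
Qed.

Lemma circ_normc f r : con 1 f -> 0 <= r < 1 -> continuous (fun t => normc (f (polar r t))).
Proof. by move=> cf r01; apply: tcont_normc; exact: tcont_circle cf. Qed.

Lemma circ_powR f r (p : R) : 0 < p -> con 1 f -> 0 <= r < 1 ->
  continuous (fun t => normc (f (polar r t)) `^ p).
Proof. by move=> p0 cf r01; apply: continuous_powR_comp => // [t|]; [exact: normc_ge0 | exact: circ_normc]. Qed.

Lemma Mp_fin (p : R) f r : 0 < p -> con 1 f -> 0 <= r < 1 ->
  Mp p%:E f r = ((avg (fun t => normc (f (polar r t)) `^ p)) `^ p^-1)%:E.
Proof.
move=> p0 cf r01; rewrite /Mp -rintE; last exact: circ_powR.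
by rewrite -EFinM poweR_EFin.
Qed.

Lemma circ_bounded f r : con 1 f -> 0 <= r < 1 -> exists S : R, forall t, normc (f (polar r t)) <= S.
Proof.
move=> cf /andP[r0 r1]; have [M HM] := con_bounded cf r1.
by exists M => t; apply: HM; rewrite normc_polar ger0_norm.
Qed.

Lemma Mp_oo f r : con 1 f -> 0 <= r < 1 ->
  exists2 S : R, Mp +oo%E f r = S%:E & (forall t, normc (f (polar r t)) <= S).
Proof.
move=> cf r01; have [M HM] := circ_bounded cf r01.
rewrite /Mp; set A := [set _ | _ in _].
have A0 : A (normc (f (polar r 0)))%:E by exists 0.
have ub : (ereal_sup A <= M%:E)%E by apply: ge_ereal_sup => _ [t _ <-]; rewrite lee_fin.
have lb : ((normc (f (polar r 0)))%:E <= ereal_sup A)%E by exact: ereal_sup_ubound.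
have fin : ereal_sup A \is a fin_num.
  by rewrite fin_numE; apply/andP; split; apply/eqP => H; move: lb ub; rewrite H// leNgt ltNyr.
exists (fine (ereal_sup A)); first by rewrite fineK.
by move=> t; rewrite -lee_fin fineK//; apply: ereal_sup_ubound; exists t.
Qed.

Lemma Mp_oo_le f r (S : R) : (forall t, normc (f (polar r t)) <= S) -> (Mp +oo%E f r <= S%:E)%E.
Proof. by move=> H; apply: ge_ereal_sup => _ [t _ <-]; rewrite lee_fin. Qed.

Lemma MpE p f r : (0 < p)%E -> con 1 f -> 0 <= r < 1 -> Mp p f r = (mp p f r)%:E.
Proof.
move=> p0 cf r01; rewrite /mp fineK//; case: p p0 => [p| |]//.
  by rewrite lte_fin => p0; rewrite Mp_fin.
by move=> _; have [S -> _] := Mp_oo cf r01.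
Qed.

Lemma mp_ge0 p f r : (0 < p)%E -> con 1 f -> 0 <= r < 1 -> 0 <= mp p f r.
Proof.
move=> p0 cf r01; rewrite -lee_fin -MpE//; case: p p0 => [p| |]//.
  by rewrite lte_fin => p0; rewrite Mp_fin// lee_fin powR_ge0.
move=> _; have [S -> H] := Mp_oo cf r01; rewrite lee_fin.
exact: le_trans (normc_ge0 _) (H 0).
Qed.

Lemma mp_le p f r (e : R) : (0 < p)%E -> con 1 f -> 0 <= r < 1 ->
  (forall t, normc (f (polar r t)) <= e) -> mp p f r <= e.
Proof.
move=> p0 cf r01 fe; rewrite -lee_fin -MpE//; case: p p0 => [p| |]//.
  rewrite lte_fin => p0; rewrite Mp_fin// lee_fin.
  have e0 : 0 <= e := le_trans (normc_ge0 _) (fe 0).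
  rewrite -[leRHS](powRr1 e0) -(divff (lt0r_neq0 p0)) powRrM.
  have ca := circ_powR p0 cf r01.
  apply: powR_le; first by rewrite invr_ge0 ltW.
    by apply: avg_ge0 => // t; exact: powR_ge0.
  rewrite -[leRHS]avg_cst; apply: le_avg => //; first exact: continuous_cstf.
  by move=> t; apply: powR_le => //; [exact: ltW | exact: normc_ge0].
by move=> _; exact: Mp_oo_le.
Qed.

Lemma conB f g : con 1 f -> con 1 g -> con 1 (fun z => f z - g z).
Proof.
move=> cf cg z z1 e e0; have e2 : 0 < e / 2 by lra.
have [k k0 H] := cf z z1 _ e2; have [l l0 K] := cg z z1 _ e2.
exists (Num.min k l); first by rewrite lt_min k0.
move=> h; rewrite lt_min => /andP[/H h1 /K h2].
have -> : f (z + h) - g (z + h) - (f z - g z) = (f (z + h) - f z) - (g (z + h) - g z) by ring.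
by apply: le_lt_trans (le_normcB _ _) _; lra.
Qed.

Lemma mp_quasi_triangle p : (0 < p)%E -> exists2 C : R, 0 < C & forall f g r,
  con 1 f -> con 1 g -> 0 <= r < 1 -> mp p (fun z => f z - g z) r <= C * (mp p f r + mp p g r).
Proof.
case: p => [p| |]// p0.
  rewrite lte_fin in p0; exists ((2 `^ p) `^ p^-1 * 2 `^ p^-1).
    by rewrite mulr_gt0// powR_gt0// powR_gt0.
  move=> f g r cf cg r01; have cfg := conB cf cg.
  rewrite /mp !Mp_fin//=.
  have c1 := circ_powR p0 cf r01; have c2 := circ_powR p0 cg r01.
  have c3 := circ_powR p0 cfg r01.
  have a1 := avg_ge0 c1 (fun t => powR_ge0 _ _).
  have a2 := avg_ge0 c2 (fun t => powR_ge0 _ _).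
  have a3 := avg_ge0 c3 (fun t => powR_ge0 _ _).
  have pi0 : 0 <= p^-1 by rewrite invr_ge0 ltW.
  apply: (@le_trans _ _ ((2 `^ p * (avg (fun t => normc (f (polar r t)) `^ p) +
     avg (fun t => normc (g (polar r t)) `^ p))) `^ p^-1)).
    apply: powR_le => //; rewrite -avgD// -avgZ; last exact: continuousDf.
    apply: le_avg => //.
      by apply: continuousMf; [exact: continuous_cstf | exact: continuousDf].
    move=> t; apply: (@le_trans _ _ ((normc (f (polar r t)) + normc (g (polar r t))) `^ p)).
      by apply: powR_le; [exact: ltW | exact: normc_ge0 | exact: le_normcB].
    by apply: powR_addle; rewrite ?normc_ge0// ltW.
  rewrite powRM ?powR_ge0 ?addr_ge0// -mulrA ler_wpM2l ?powR_ge0//.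
  exact: powR_addle.
exists 1 => // f g r cf cg r01; rewrite mul1r.
have cfg := conB cf cg; have [S SE HS] := Mp_oo cf r01; have [T TE HT] := Mp_oo cg r01.
apply: mp_le => // t; rewrite /mp SE TE /=.
by apply: le_trans (le_normcB _ _) _; exact: lerD.
Qed.

Lemma rho_itv (a r : R) : 0 <= a -> a < 1 -> 0 <= r < 1 -> 0 <= 1 - (1 - a) / 8 * (1 - r) < 1.
Proof. by move=> a0 a1 /andP[r0 r1]; apply/andP; split; nra. Qed.

Lemma hol_comp f phi : hol 1 f -> selfmap phi -> hol 1 (fun z => f (phi z)).
Proof. by move=> hf [hp sp] z z1; apply: holo_comp; [exact: hp | apply: hf; exact: sp]. Qed.

Lemma mp_comp p (a : R) : (0 < p)%E -> 0 <= a -> a < 1 -> exists2 C : R, 0 < C &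
  forall f phi r, hol 1 f -> selfmap phi -> normc (phi 0) <= a -> 0 <= r < 1 ->
  mp p (fun z => f (phi z)) r <= C * mp p f (1 - (1 - a) / 8 * (1 - r)).
Proof.
move=> p0 a0 a1; case: p p0 => [p| |]// p0.
  rewrite lte_fin in p0; exists ((2 `^ p * (4 / (1 - a))) `^ p^-1).
    by rewrite powR_gt0// mulr_gt0 ?powR_gt0// divr_gt0// subr_gt0.
  move=> f phi r hf sp pa r01.
  have cf := hol_con hf; have cfp := hol_con (hol_comp hf sp); have rr := rho_itv a0 a1 r01.
  rewrite /mp !Mp_fin//= -powRM.
  - apply: powR_le; first by rewrite invr_ge0 ltW.
      by apply: avg_ge0 => [|t]; [exact: (circ_powR p0 cfp r01) | exact: powR_ge0].
    exact: (subordination_powR sp pa a1 r01 hf p0).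
  - by rewrite mulr_ge0 ?powR_ge0// divr_ge0// subr_ge0 ltW.
  - by apply: avg_ge0 => [|t]; [exact: (circ_powR p0 cf rr) | exact: powR_ge0].
exists 2 => // f phi r hf sp pa r01.
have cf := hol_con hf; have cfp := hol_con (hol_comp hf sp); have rr := rho_itv a0 a1 r01.
have [S SE HS] := Mp_oo cf rr.
apply: mp_le => // t; rewrite /mp SE/=; exact: (subordination_sup sp pa a1 r01 hf HS).
Qed.

Lemma continuous_radial f (t r : R) : con 1 f -> `|r| < 1 ->
  {for r, continuous (fun r => normc (f (polar r t)))}.
Proof.
move=> cf r1; apply/cvgrPdist_lt => e e0.
have [|k k0 H] := cf (polar r t) _ e e0; first by rewrite normc_polar.
near=> s; have := H (polar s t - polar r t); rewrite subrKC => {}H.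
have d : normc (f (polar s t) - f (polar r t)) < e.
  apply: H; rewrite [polar s t]polarE [polar r t]polarE -mulrBl normcM normc_polar normr1 mulr1.
  by rewrite -rmorphB normc_real distrC; near: s; exact: cvgr_dist_lt.
apply: le_lt_trans d.
have h1 := normc_leB (f (polar s t)) (f (polar r t)).
have h2 := normc_leB (f (polar r t)) (f (polar s t)); rewrite normc_distC in h2.
by rewrite ler_norml; apply/andP; split; lra.
Unshelve. all: by end_near. Qed.

Lemma avg_radial_continuous f (p r : R) : 0 < p -> con 1 f -> `|r| < 1 ->
  {for r, continuous (fun r => avg (fun t => normc (f (polar r t)) `^ p))}.
Proof.
move=> p0 cf r1; pose b := (1 + `|r|) / 2.
have b1 : b < 1 by rewrite /b; lra.
have rb : `|r| < b by rewrite /b; lra.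
have [M HM] := con_bounded cf b1.
have inb s : s \in `]-b, b[ -> `|s| < b by rewrite in_itv/= ltr_norml.
apply: cvgM; first exact: cvg_cst.
have := @continuity_under_integral _ _ _ mu (fun r t => normc (f (polar r t)) `^ p)
  `[0, 2 * pi]%classic (measurable_itv _) (-b) b _ _ (fun=> M `^ p) _ _ r.
apply; last by rewrite inE/= in_itv/= -ltr_norml.
- move=> s /= sb; apply: conton_integrable; apply: contonT.
  apply: continuous_powR_comp => // [t|]; first exact: normc_ge0.
  apply: tcont_normc; apply: tcont_comp; first exact: tcont_polar.
  by move=> t; apply: cf; rewrite normc_polar (lt_trans (inb _ sb)).
- apply: aeW => t _ s sb.
  apply: continuous_powR_at => // [x|]; first exact: normc_ge0.
  apply: continuous_radial => //; apply: lt_trans b1.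
  by apply: inb; rewrite -inE.
- apply: conton_integrable; exact: contonT (@continuous_cstf _ _).
- move=> s sb; apply: aeW => t _; rewrite ger0_norm ?powR_ge0//.
  apply: powR_le; [exact: ltW | exact: normc_ge0 |].
  by apply: HM; rewrite normc_polar; apply/ltW/inb.
Qed.

(** The absolute value extends the mean to []-1, 1[], so continuity at 0 is two-sided and
    measurability on [[0, 1[] follows from continuity on an open interval. *)
Lemma mp_abs_continuous p f (r : R) : (0 < p)%E -> con 1 f -> `|r| < 1 ->
  {for r, continuous (fun r => mp p f `|r|)}.
Proof.
move=> p0 cf r1.
have cabs : {for r, continuous (fun x : R => `|x|)} by exact: norm_continuous.
case: p p0 => [p| |]// p0.
  rewrite lte_fin in p0.
  have ca : {for r, continuous (fun r => (avg (fun t => normc (f (polar `|r| t)) `^ p)) `^ p^-1)}.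
    apply: continuous_powR_at; first by rewrite invr_gt0.
      by move=> s; apply: avg_nonneg => t; exact: powR_ge0.
    apply: (@continuous_comp _ _ _ (fun x : R => `|x|)
       (fun r => avg (fun t => normc (f (polar r t)) `^ p))) => //.
    by apply: avg_radial_continuous => //; rewrite normr_id.
  have E s : `|s| < 1 -> mp p%:E f `|s| = (avg (fun t => normc (f (polar `|s| t)) `^ p)) `^ p^-1.
    by move=> s1; rewrite /mp Mp_fin// normr_ge0.
  rewrite /prop_for /continuous_at E//; apply: cvg_trans ca; apply: near_eq_cvg; near=> s; rewrite E//.
  near: s; have r10 : 0 < 1 - `|r| by rewrite subr_gt0.
  have /cvgrPdist_lt/(_ _ r10) := cabs; apply: filterS => x.
  by rewrite ltr_norml => /andP[? ?]; lra.
apply/cvgrPdist_le => e e0.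
pose b := (1 + `|r|) / 2.
have b1 : b < 1 by rewrite /b; lra.
have rb : `|r| < b by rewrite /b; lra.
have [k k0 H] := con_unif cf b1 e0.
near=> s.
have sb : `|s| < b.
  near: s; have rb0 : 0 < b - `|r| by rewrite subr_gt0.
  have /cvgrPdist_lt/(_ _ rb0) := cabs; apply: filterS => x.
  by rewrite ltr_norml => /andP[? ?]; lra.
have srk : `| `|s| - `|r| | < k.
  by rewrite distrC; near: s; have /cvgrPdist_lt/(_ _ k0) := cabs.
have d t : normc (f (polar `|s| t) - f (polar `|r| t)) < e.
  apply: H; first by rewrite normc_polar normr_id ltW.
  by rewrite [polar `|s| t]polarE [polar `|r| t]polarE -mulrBl normcM normc_polar normr1 mulr1 -rmorphB normc_real.
have r01 : 0 <= `|r| < 1 by rewrite normr_ge0.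
have s01 : 0 <= `|s| < 1 by rewrite normr_ge0 (lt_trans sb).
have [S SE HS] := Mp_oo cf r01; have [T TE HT] := Mp_oo cf s01.
have h1 : mp +oo%E f `|s| <= mp +oo%E f `|r| + e.
  apply: mp_le => // t; rewrite /mp SE/=.
  have := normc_leB (f (polar `|s| t)) (f (polar `|r| t)); have := d t; have := HS t; lra.
have h2 : mp +oo%E f `|r| <= mp +oo%E f `|s| + e.
  apply: mp_le => // t; rewrite /mp TE/=.
  have := normc_leB (f (polar `|r| t)) (f (polar `|s| t)).
  rewrite normc_distC; have := d t; have := HT t; lra.
by rewrite ler_norml; apply/andP; split; lra.
Unshelve. all: by end_near. Qed.

Lemma mp_measurable p f : (0 < p)%E -> con 1 f -> measurable_fun `[0 : R, 1[ (mp p f).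
Proof.
move=> p0 cf.
have m1 : measurable_fun `](-1 : R), 1[ (fun r => mp p f `|r|).
  apply: open_continuous_measurable_fun; first exact: interval_open.
  move=> r; rewrite inE/= in_itv/= => r1.
  by apply: mp_abs_continuous => //; rewrite ltr_norml.
apply: (eq_measurable_fun (fun r => mp p f `|r|)).
  by move=> r; rewrite inE/= in_itv/= => /andP[r0 _]; rewrite ger0_norm.
apply: measurable_funS m1 => //.
by apply: subset_itvr; rewrite bnd_simp.
Qed.

End IntegralMeans.

(** * Weighted radial integrals *)

Section Weighted.
Variable R : realType.
Local Notation mu := (@lebesgue_measure R).
Implicit Types (f g phi : R[i] -> R[i]) (h : R -> R) (p : \bar R) (r b c q : R).

(** [b] stands for [alpha * q]. The constant factor and the outer root of the norm are left aside
    until [HnormE]. *)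
Definition wt b r : R := (1 - r) `^ (b - 1).
Definition wmp p q b f r : R := wt b r * mp p f r `^ q.
Definition wint (h : R -> R) : \bar R := (\int[mu]_(r in `[0%R, 1%R[) (h r)%:E)%E.

Lemma wt_ge0 b r : 0 <= wt b r.
Proof. exact: powR_ge0. Qed.

Lemma wmp_ge0 p q b f r : 0 <= wmp p q b f r.
Proof. by rewrite mulr_ge0 ?powR_ge0. Qed.

Lemma wt_measurable b (D : set R) : measurable_fun D (wt b).
Proof.
apply: measurable_funTS; apply: (measurableT_comp (measurable_powR _)).
by apply: measurable_funB; [exact: measurable_cst | exact: measurable_id].
Qed.

Lemma wmp_measurable p q b f : (0 < p)%E -> con 1 f -> measurable_fun `[0 : R, 1[ (wmp p q b f).
Proof.
move=> p0 cf; apply: measurable_funM; first exact: wt_measurable.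
by apply: (measurableT_comp (measurable_powR q)); exact: mp_measurable.
Qed.

Lemma wint_ge0 h : (forall r, 0 <= h r) -> (0 <= wint h)%E.
Proof. by move=> h0; apply: integral_ge0 => r _; rewrite lee_fin. Qed.

Lemma wint_integrable h : (forall r, 0 <= h r) -> measurable_fun `[0 : R, 1[ h ->
  (wint h < +oo)%E -> mu.-integrable `[0, 1[ (EFin \o h).
Proof.
move=> h0 mh hl; apply/integrableP; split; first exact/measurable_EFinP.
by under eq_integral do rewrite gee0_abs ?lee_fin//.
Qed.

Lemma HnormE p q alpha f : (0 < p)%E -> con 1 f ->
  Hnorm p q alpha f = (((alpha * q)%:E * wint (wmp p q (alpha * q) f)) `^ q^-1)%E.
Proof.
move=> p0 cf; rewrite /Hnorm; congr ((_ * _) `^ _)%E.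
apply: eq_integral => r; rewrite inE/= in_itv/= => r01.
by rewrite MpE// poweR_EFin -EFinM.
Qed.

Lemma Hnorm_lty p q alpha f : (0 < p)%E -> 0 < q -> 0 < alpha -> con 1 f ->
  (Hnorm p q alpha f < +oo)%E <-> (wint (wmp p q (alpha * q) f) < +oo)%E.
Proof.
move=> p0 q0 a0 cf; rewrite HnormE//; split => H.
  move: H => /lty_poweRy; rewrite invr_eq0 gt_eqF// => /(_ isT).
  have w0 : (0 <= wint (wmp p q (alpha * q) f))%E by apply: wint_ge0 => r; exact: wmp_ge0.
  move: w0; case: (wint _) => [x| |]// _; first by move=> _; rewrite ltry.
  by rewrite gt0_muley// lte_fin mulr_gt0.
by apply: poweR_lty; rewrite lte_mul_pinfty// lee_fin mulr_ge0// ltW.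
Qed.

(** Allows substitution and the fundamental theorem of calculus to be used on compact intervals
    only, away from the end point 1 where the weight may be singular. *)
Lemma wint_le_lim h (T : \bar R) : (forall r, 0 <= h r) -> measurable_fun `[0 : R, 1[ h ->
  (forall b, 0 < b < 1 -> (\int[mu]_(r in `[0%R, b]) (h r)%:E <= T)%E) -> (wint h <= T)%E.
Proof.
move=> h0 mh H; pose F (n : nat) : set R := `[0, 1 - n.+2%:R^-1]%classic.
have n0 n : 0 < n.+2%:R^-1 :> R by rewrite invr_gt0.
have n1 n : n.+2%:R^-1 < 1 :> R by rewrite invf_lt1 ?ltr1n// ltr0n.
have sub n : F n `<=` `[0, 1[%classic.
  by apply: subset_itvl; rewrite bnd_simp ltrBlDr ltrDl.
have -> : wint h = (\int[mu]_(r in \bigcup_n F n) (h r)%:E)%E.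
  congr (integral _ _ _); apply/seteqP; split => [r|r [n _ /sub]//].
  rewrite /= in_itv/= => /andP[r0 r1].
  have [n _ Hn] : \forall n \near \oo, n.+1%:R^-1 < 1 - r.
    have r10 : 0 < 1 - r by rewrite subr_gt0.
    exact: (near_infty_natSinv_lt (PosNum r10)).
  exists n => //; rewrite /F /= in_itv/= r0/=.
  by have /= hn := Hn n.+1 (leqnSn n); rewrite lerBrDr -lerBrDl ltW.
have cv : (\int[mu]_(r in F n) (h r)%:E @[n --> \oo] --> \int[mu]_(r in \bigcup_n F n) (h r)%:E)%E.
  apply: ge0_nondecreasing_set_cvg_integral => //.
  - apply/nondecreasing_seqP => n; rewrite subsetEset; apply: subset_itvl.
    by rewrite bnd_simp lerD2l lerN2 lef_pV2 ?posrE ?ltr0n// ler_nat.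
  - by move=> n; exact: measurable_itv.
  - by move=> n; apply/measurable_EFinP; apply: measurable_funS mh.
  - by move=> n r _; rewrite lee_fin.
move/cvg_lim : (cv) => <- //; apply: lime_le; first by apply/cvg_ex; eexists; exact: cv.
by apply: nearW => n; apply: H; rewrite subr_gt0 n1/= ltrBlDr ltrDl n0.
Qed.

Lemma wmp_continuous p q b f r : (0 < p)%E -> 0 < q -> con 1 f -> 0 < r < 1 ->
  {for r, continuous (wmp p q b f)}.
Proof.
move=> p0 q0 cf /andP[r0 r1]; apply: cvgM.
  apply: (@continuous_comp _ _ _ (fun x : R => 1 - x) (fun x => x `^ (b - 1))).
    by apply: cvgB; [exact: cvg_cst | exact: cvg_id].
  apply: differentiable_continuous; apply/derivable1_diffP.
  by apply: derivable_powR; rewrite in_itv/= subr_gt0 r1.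
have nr : `|r| < 1 by rewrite gtr0_norm.
have c := mp_abs_continuous p0 cf nr.
have c2 : {for r, continuous (fun r => (mp p f `|r|) `^ q)}.
  (* mp is only known to be nonnegative on [0, 1) *)
  have c3 : {for r, continuous (fun r => `|mp p f `|r| |)}.
    by apply: (@continuous_comp _ _ _ _ (fun x : R => `|x|)) => //; exact: norm_continuous.
  have := continuous_powR_at q0 (fun r => normr_ge0 (mp p f `|r|)) c3.
  rewrite /prop_for /continuous_at ger0_norm ?mp_ge0 ?normr_ge0//.
  apply: cvg_trans; apply: near_eq_cvg; near=> s; rewrite ger0_norm// mp_ge0// normr_ge0/=.
  near: s; have e0 : 0 < 1 - `|r| by rewrite subr_gt0.
  have /cvgrPdist_lt/(_ _ e0) := @norm_continuous _ _ r; apply: filterS => x.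
  by rewrite ltr_norml => /andP[? ?]; lra.
move: c2; rewrite /prop_for /continuous_at gtr0_norm//; apply: cvg_trans.
apply: near_eq_cvg; near=> s; rewrite gtr0_norm//; near: s; exact: lt_nbhsr.
Unshelve. all: by end_near. Qed.

Lemma wt_dilate b c r : 0 < c -> r < 1 -> wt b r = c `^ (1 - b) * wt b (1 - c * (1 - r)).
Proof.
move=> c0 r1; rewrite /wt (_ : 1 - (1 - c * (1 - r)) = c * (1 - r)); last by ring.
rewrite powRM ?(ltW c0) ?subr_ge0 ?(ltW r1)// mulrA -powRD; last by apply/implyP => _; rewrite gt_eqF.
by rewrite (_ : 1 - b + (b - 1) = 0) ?powRr0 ?mul1r//; ring.
Qed.

(** The substitution [u = 1 - c (1 - r)] turns the weight into a constant multiple of itself. On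
    [[0, d]] with [d < 1] its image lies in []0, 1[], where the integrand is continuous, and the
    resulting bound does not depend on [d]. *)
Lemma wint_dilate p q b c C f : (0 < p)%E -> 0 < q -> con 1 f -> 0 < c < 1 -> 0 < C ->
  (wint (wmp p q b f) < +oo)%E ->
  (wint (fun r => wt b r * (C * mp p f (1 - c * (1 - r))) `^ q)%R < +oo)%E.
Proof.
move=> p0 q0 cf /andP[c0 c1] C0 fin.
pose F : R -> R := fun r => 1 - c * (1 - r).
have F01 r : 0 <= r < 1 -> 0 < F r < 1.
  by move=> /andP[r0 r1]; rewrite /F; apply/andP; split; nra.
pose K := C `^ q * c `^ (1 - b) * c^-1.
have K0 : 0 <= K by rewrite !mulr_ge0 ?powR_ge0// invr_ge0 ltW.
have E r : 0 <= r < 1 -> wt b r * (C * mp p f (F r)) `^ q = K * (wmp p q b f (F r) * c).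
  move=> r01; have /andP[r0 r1] := r01; have /andP[F0 F1] := F01 r r01.
  rewrite powRM ?mp_ge0 ?(ltW F0) ?ltW// (wt_dilate b c0 r1) /wmp /K -/(F r).
  by field; rewrite gt_eqF.
have dF r : is_derive r 1 F c.
  have d1 := is_deriveB (is_derive_cst (1 : R) r 1) (is_derive_id r (1 : R)).
  have := is_deriveB (is_derive_cst (1 : R) r 1) (is_deriveM (is_derive_cst c r 1) d1).
  by rewrite scaler0 addr0 !sub0r scalerN opprK [_ *: _]mulr1.
have F' : derive1 F = fun=> c by apply/funext => r; rewrite derive1E; exact: derive_val.
have mF : measurable_fun `[0 : R, 1[ (fun r => wmp p q b f (F r)).
  apply: (@measurable_comp _ _ _ _ _ _ `[0 : R, 1[%classic) => //.
  - by move=> x [r r01 <-]; move: r01; rewrite /= !in_itv/= => /F01 /andP[F0 F1]; rewrite (ltW F0).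
  - exact: wmp_measurable.
  - apply: measurable_funTS; apply: continuous_measurable_fun => r.
    by apply: differentiable_continuous; apply/derivable1_diffP; have [] := dF r.
have mG : measurable_fun `[0 : R, 1[ (fun r => wt b r * (C * mp p f (F r)) `^ q).
  apply: (eq_measurable_fun (fun r => K * (wmp p q b f (F r) * c))).
    by move=> r; rewrite inE/= in_itv/= => /E ->.
  apply: measurable_funM; first exact: measurable_cst.
  by apply: measurable_funM => //; exact: measurable_cst.
apply: (@le_lt_trans _ _ (K%:E * wint (wmp p q b f))%E); last first.
  by rewrite lte_mul_pinfty// lee_fin.
apply: wint_le_lim => // [r|d /andP[d0 d1]]; first by rewrite mulr_ge0 ?powR_ge0.
have -> : (\int[mu]_(r in `[0%R, d]) (wt b r * (C * mp p f (F r)) `^ q)%R%:E =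
   \int[mu]_(r in `[0%R, d]) (K%:E * ((wmp p q b f \o F) r * c)%R%:E))%E.
  apply: eq_integral => r; rewrite inE/= in_itv/= => /andP[r0 rd].
  by rewrite E ?EFinM// r0 (le_lt_trans rd).
rewrite ge0_integralZl//; last 2 first.
- apply/measurable_EFinP; apply: measurable_funM; last exact: measurable_cst.
  by apply: measurable_funS mF => //; apply: subset_itvl; rewrite bnd_simp.
- by move=> r _; rewrite lee_fin mulr_ge0 ?wmp_ge0// ltW.
rewrite lee_wpmul2l ?lee_fin//.
have cF r : {for r, continuous F}.
  by apply: differentiable_continuous; apply/derivable1_diffP; have [] := dF r.
have := @integration_by_substitution_increasing _ F (wmp p q b f) 0 d (ltW d0).
rewrite F' => H.
rewrite [leLHS](_ : _ = \int[mu]_(x in `[F 0%R, F d]) (wmp p q b f x)%:E)%E; last first.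
  apply/esym; apply: H.
  - by move=> x y _ _ xy; rewrite /F ltrD2l ltrN2 ltr_pM2l// ltrD2l ltrN2.
  - by move=> x _; exact: cvg_cst.
  - exact: is_cvg_cst.
  - exact: is_cvg_cst.
  - split; first by move=> x _; have [] := dF x.
    + exact: cvg_at_right_filter (cF 0).
    + exact: cvg_at_left_filter (cF d).
  - apply: continuous_in_subspaceT => x; rewrite inE/= in_itv/= => /andP[x0 x1].
    apply: wmp_continuous => //.
    have /andP[a1 _] : 0 < F 0 < 1 by apply: F01; rewrite lexx ltr01.
    have /andP[_ a2] : 0 < F d < 1 by apply: F01; rewrite ltW.
    by rewrite (lt_le_trans a1 x0) (le_lt_trans x1 a2).
apply: ge0_subset_integral => //.
- by apply/measurable_EFinP; exact: wmp_measurable.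
- by move=> x _; rewrite lee_fin wmp_ge0.
- move=> x /=; rewrite !in_itv/= => /andP[x0 x1].
  have /andP[a1 _] : 0 < F 0 < 1 by apply: F01; rewrite lexx ltr01.
  have /andP[_ a2] : 0 < F d < 1 by apply: F01; rewrite ltW.
  by rewrite (le_trans (ltW a1) x0) (le_lt_trans x1 a2).
Qed.

End Weighted.

(** * Strong continuity *)

Section StrongContinuity.
Variable R : realType.
Local Notation mu := (@lebesgue_measure R).
Implicit Types (f g : R[i] -> R[i]) (phi : R -> R[i] -> R[i]) (h : R -> R) (p : \bar R) (r b c q : R).

Lemma le_wint h1 h2 : (forall r, 0 <= r < 1 -> 0 <= h1 r <= h2 r) -> measurable_fun `[0 : R, 1[ h1 ->
  measurable_fun `[0 : R, 1[ h2 -> (wint h1 <= wint h2)%E.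
Proof.
move=> h12 m1 m2; apply: ge0_le_integral => //.
- by move=> r; rewrite /= in_itv/= => /h12 /andP[? _]; rewrite lee_fin.
- exact/measurable_EFinP.
- exact/measurable_EFinP.
- by move=> r; rewrite /= in_itv/= => /h12 /andP[_ ?]; rewrite lee_fin.
Qed.

Lemma semigroup_selfmap phi t : analytic_semigroup phi -> 0 <= t -> selfmap (phi t).
Proof. by move=> [h1 h2 _ _ _] t0; split; [exact: h1 | exact: h2]. Qed.

Lemma semigroup_unif phi (b e : R) : analytic_semigroup phi -> b < 1 -> 0 < e ->
  exists2 d : R, 0 < d & forall t, 0 < t < d -> forall z, normc z <= b -> normc (phi t z - z) < e.
Proof.
move=> [_ _ _ _ h5] b1 e0; have [|d d0 H] := h5 _ (@compact_cdisc R b) _ e e0; last by exists d.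
by move=> z /= /le_lt_trans; apply.
Qed.

Lemma CtmI_con phi t f : analytic_semigroup phi -> 0 <= t -> hol 1 f -> con 1 (CtmI phi t f).
Proof.
move=> sg t0 hf; apply: conB; last exact: hol_con.
exact: (hol_con (hol_comp hf (semigroup_selfmap sg t0))).
Qed.

Lemma dilate_measurable p q b c C f : (0 < p)%E -> con 1 f -> 0 < c < 1 ->
  measurable_fun `[0 : R, 1[ (fun r => wt b r * (C * mp p f (1 - c * (1 - r))) `^ q).
Proof.
move=> p0 cf /andP[c0 c1]; apply: measurable_funM; first exact: wt_measurable.
apply: (measurableT_comp (measurable_powR q)); apply: measurable_funM; first exact: measurable_cst.
apply: (@measurable_comp _ _ _ _ _ _ `[0 : R, 1[%classic) => //.
- move=> x [r r01 <-]; move: r01; rewrite /= !in_itv/= => /andP[r0 r1].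
  by apply/andP; split; nra.
- exact: mp_measurable.
- apply: measurable_funTS; apply: measurable_funB; first exact: measurable_cst.
  apply: measurable_funM; first exact: measurable_cst.
  by apply: measurable_funB; [exact: measurable_cst | exact: measurable_id].
Qed.

Lemma wint_comp p q b f g : (0 < p)%E -> 0 < q -> hol 1 f -> selfmap g ->
  (wint (wmp p q b f) < +oo)%E -> (wint (wmp p q b (fun z => f (g z))) < +oo)%E.
Proof.
move=> p0 q0 hf sg fin.
have a0 := normc_ge0 (g 0); have a1 : normc (g 0) < 1 by apply: sg.2; rewrite normc0.
have [C C0 HC] := mp_comp p0 a0 a1.
have c01 : 0 < (1 - normc (g 0)) / 8 < 1 by apply/andP; split; lra.
have cfg := hol_con (hol_comp hf sg).
apply: le_lt_trans (wint_dilate p0 q0 (hol_con hf) c01 C0 fin).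
apply: le_wint; last 2 first.
- exact: wmp_measurable.
- by apply: dilate_measurable => //; exact: hol_con.
move=> r r01; rewrite wmp_ge0/= ler_wpM2l ?wt_ge0//.
by apply: powR_le; [exact: ltW | exact: mp_ge0 | exact: HC].
Qed.

Lemma cvg_powR0 (x : nat -> R) (s : R) : 0 < s -> (forall n, 0 <= x n) ->
  x @ \oo --> 0 -> (fun n => x n `^ s) @ \oo --> 0.
Proof.
move=> s0 x0 cx; apply/cvgrPdist_lt => e e0; have [k k0 kE] := powR_small s0 e0.
near=> n; rewrite sub0r normrN ger0_norm ?powR_ge0// -kE.
apply: gt0_ltr_powR; rewrite ?nnegrE ?(ltW k0)//.
have : `|0 - x n| < k by near: n; have /cvgrPdist_lt/(_ _ k0) := cx.
by rewrite sub0r normrN ger0_norm.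
Unshelve. all: by end_near. Qed.

Lemma mp_CtmI_small p phi f r (e : R) : (0 < p)%E -> analytic_semigroup phi -> hol 1 f ->
  0 <= r < 1 -> 0 < e -> exists2 d : R, 0 < d & forall t, 0 < t < d -> mp p (CtmI phi t f) r <= e.
Proof.
move=> p0 sg hf /andP[r0 r1] e0.
have [k k0 H] := con_unif (hol_con hf) r1 e0.
have [d d0 K] := semigroup_unif sg r1 k0; exists d => // t td.
have /andP[t0 _] := td.
apply: mp_le; rewrite ?r0//; first by apply: CtmI_con => //; exact: ltW.
move=> s; have zr : normc (polar r s) <= r by rewrite normc_polar ger0_norm.
by apply/ltW; apply: H => //; exact: K.
Qed.

Lemma strong_continuity p q alpha phi f : (0 < p)%E -> 0 < q -> 0 < alpha ->
  analytic_semigroup phi -> hol 1 f -> (wint (wmp p q (alpha * q) f) < +oo)%E ->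
  (Hnorm p q alpha (CtmI phi t f) @[t --> 0^'+] --> 0%E).
Proof.
move=> p0 q0 al0 sg hf fin; set b := alpha * q in fin.
have b0 : 0 < b by rewrite mulr_gt0.
have cf := hol_con hf.
have half1 : (2^-1 : R) < 1 by rewrite invf_lt1// ltr1n.
have half0 : 0 <= (2^-1 : R) by rewrite invr_ge0.
have hhalf : 0 < (2^-1 : R) by rewrite invr_gt0.
have [C C0 HC] := mp_comp p0 half0 half1.
have [Q Q0 HQ] := mp_quasi_triangle p0.
have c01 : 0 < ((1 - 2^-1) / 8 : R) < 1 by lra.
have fin2 := wint_dilate p0 q0 cf c01 C0 fin.
set h2 := (fun r => _) in fin2.
have m2 : measurable_fun `[0 : R, 1[ h2 by exact: dilate_measurable.
have m1 := wmp_measurable q b p0 cf.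
have i2 : mu.-integrable `[0, 1[ (EFin \o h2).
  by apply: wint_integrable => // r; rewrite mulr_ge0 ?wt_ge0 ?powR_ge0.
have i1 : mu.-integrable `[0, 1[ (EFin \o wmp p q b f).
  by apply: wint_integrable => // r; exact: wmp_ge0.
(* [Q] comes from the quasi-triangle inequality for the means, [2^q] from raising the sum of two
   means to the power [q]. *)
pose K := Q `^ q * 2 `^ q.
pose D r := K * (h2 r + wmp p q b f r).
have iD : mu.-integrable `[0, 1[ (EFin \o D).
  rewrite (_ : EFin \o D = fun r => (K%:E * ((EFin \o h2) r + (EFin \o wmp p q b f) r))%E).
    by apply: integrableZl => //; exact: integrableD.
  by apply/funext => r; rewrite /D /= -EFinD -EFinM.
(* Used at the origin only: [|phi t 0| <= 1/2] for [t < d], so [mp_comp] applies with the single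
   value [a = 1/2] and one majorant serves all these times. *)
have [d d0 Hd] := semigroup_unif sg half1 hhalf.
have dom t r : 0 < t < d -> 0 <= r < 1 -> wmp p q b (CtmI phi t f) r <= D r.
  move=> td r01; have /andP[/ltW t0 _] := td.
  have st := semigroup_selfmap sg t0.
  have ct := CtmI_con sg t0 hf; have cc := hol_con (hol_comp hf st).
  have pt : normc (phi t 0) <= 2^-1.
    by have := Hd t td 0; rewrite subr0 normc0 => /(_ half0) /ltW.
  have rr := rho_itv half0 half1 r01.
  pose A := C * mp p f (1 - (1 - 2^-1) / 8 * (1 - r)); pose B := mp p f r.
  have A0 : 0 <= A by rewrite mulr_ge0 ?(ltW C0)// mp_ge0.
  have B0 : 0 <= B := mp_ge0 p0 cf r01.
  have -> : D r = wt b r * (K * (A `^ q + B `^ q)).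
    by rewrite /D /h2 /wmp -/A -/B; ring.
  rewrite ler_wpM2l ?wt_ge0//.
  apply: (@le_trans _ _ ((Q * (A + B)) `^ q)).
    apply: powR_le; [exact: ltW | exact: mp_ge0 |].
    apply: le_trans (HQ _ _ r cc cf r01) _; rewrite ler_wpM2l ?(ltW Q0)// lerD2r.
    exact: HC.
  rewrite powRM ?(ltW Q0) ?addr_ge0// /K -mulrA ler_wpM2l ?powR_ge0//.
  exact: (powR_addle (ltW q0) A0 B0).
(* Dominated convergence is sequential, so the limit is tested along sequences; the shift by [N]
   puts every term in the range [t < d] of the majorant. *)
apply/cvge_at_rightP => u [u0 ucvg].
have [N _ HN] : \forall n \near \oo, u n < d.
  have /cvgrPdist_lt/(_ _ d0) := ucvg; apply: filterS => n.
  by rewrite sub0r normrN => /(le_lt_trans (ler_norm _)).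
rewrite -(cvg_shiftn N).
pose v n := u (n + N)%N.
have vd n : 0 < v n < d by rewrite u0 HN//= leq_addl.
have v0 n : 0 <= v n by have /andP[/ltW] := vd n.
have cv : v @ \oo --> 0 by rewrite /v (cvg_shiftn N).
have mv n : measurable_fun `[0 : R, 1[ (wmp p q b (CtmI phi (v n) f)).
  by apply: wmp_measurable => //; exact: CtmI_con.
have ptw r : 0 <= r < 1 -> (fun n => wmp p q b (CtmI phi (v n) f) r) @ \oo --> 0.
  move=> r01; rewrite -[X in _ --> X](mulr0 (wt b r)).
  apply: cvgM; first exact: cvg_cst.
  apply: cvg_powR0 => // [n|]; first by apply: mp_ge0 => //; exact: CtmI_con.
  apply/cvgrPdist_le => e e0.
  have [k k0 Hk] := mp_CtmI_small p0 sg hf r01 e0.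
  have /cvgrPdist_lt/(_ _ k0) := cv; apply: filterS => n.
  rewrite !sub0r !normrN => vk; rewrite ger0_norm; last by apply: mp_ge0 => //; exact: CtmI_con.
  have /andP[vn0 _] := vd n.
  by apply: Hk; rewrite vn0 (le_lt_trans (ler_norm _)).
have Hcv : (fun n => wint (wmp p q b (CtmI phi (v n) f))) @ \oo --> 0%E.
  have := @dominated_convergence _ _ R mu `[0, 1[%classic (measurable_itv _)
    (fun n r => (wmp p q b (CtmI phi (v n) f) r)%:E) (fun=> 0%E) (EFin \o D).
  case.
  - by move=> n; apply/measurable_EFinP; exact: mv.
  - exact: measurable_cst.
  - by apply: aeW => r; rewrite /= in_itv/= => r01; apply: cvg_EFin; [exact: nearW | exact: ptw].
  - exact: iD.
  - apply: aeW => r n; rewrite /= in_itv/= => r01.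
    by rewrite ger0_norm ?wmp_ge0// lee_fin dom.
  by move=> _ _; rewrite integral0.
have finv n : wint (wmp p q b (CtmI phi (v n) f)) \is a fin_num.
  rewrite ge0_fin_numE; last by apply: wint_ge0 => r; exact: wmp_ge0.
  apply: le_lt_trans (_ : wint D < +oo)%E; last first.
    exact: integrable_lty iD.
  apply: le_wint => //; last by move/integrableP : iD => [/measurable_EFinP].
  by move=> r r01; rewrite wmp_ge0 dom.
have := fine_cvg Hcv => xcv.
rewrite (_ : [sequence _]_n = EFin \o (fun n => (b * fine (wint (wmp p q b (CtmI phi (v n) f)))) `^ q^-1)).
  apply: cvg_EFin; first exact: nearW.
  apply: cvg_powR0; first by rewrite invr_gt0.
    by move=> n; rewrite mulr_ge0 ?(ltW b0)// fine_ge0// wint_ge0// => r; exact: wmp_ge0.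
  rewrite -[X in _ --> X](mulr0 b); apply: cvgM; first exact: cvg_cst.
  exact: xcv.
apply/funext => n /=; rewrite -/(v n) HnormE//; last exact: CtmI_con.
by rewrite -/b -(fineK (finv n)) -EFinM poweR_EFin.
Qed.

End StrongContinuity.

(** * A self-map whose moments stay away from zero is the identity *)

Section SelfmapRigidity.
Variable R : realType.
Implicit Types (f g : R[i] -> R[i]) (r x : R).
Local Notation Re := (@complex.Re R).
Local Notation Im := (@complex.Im R).

Variable phi : R[i] -> R[i].
Hypothesis sphi : selfmap phi.

Let y r (t : R) := phi (polar r t) / polar r t.

Let polar_neq0 r t : 0 < r -> polar r t != 0.
Proof. by move=> r0; rewrite -normc_gt0 normc_polar gtr0_norm. Qed.

Let normc_polar_gt r t : 0 < r -> normc (polar r t) = r.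
Proof. by move=> r0; rewrite normc_polar gtr0_norm. Qed.

Let phi_lt1 r t : 0 < r < 1 -> normc (phi (polar r t)) < 1.
Proof. by move=> /andP[r0 r1]; apply: sphi.2; rewrite normc_polar_gt. Qed.

Let y_le r t : 0 < r < 1 -> normc (y r t) <= r^-1.
Proof.
move=> r01; have /andP[r0 _] := r01; rewrite normcM normcV normc_polar_gt//.
by rewrite ler_piMl ?invr_ge0 ?(ltW r0)// ltW// phi_lt1.
Qed.

Let tcont_y r : 0 < r < 1 -> tcont (y r).
Proof.
move=> /andP[r0 r1]; apply: tcontM.
  by apply: (@tcont_circle _ 1); [rewrite (ltW r0) | exact: hol_con sphi.1].
by apply: tcontV; [move=> t; exact: polar_neq0 | exact: tcont_polar].
Qed.

(** Supplied by the operator norm in [small_opnorm_id]. The exponent 1 is excluded because the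
    radius used there is only known to be at least [1 - 1/n], which must be positive;
    [first_moment_ge] replaces it by a crude bound. *)
Hypothesis moments : forall n r, (2 <= n)%N -> 0 < r < 1 -> 1 / 2 <= avg (fun t => Re (y r t ^+ n)).

Let first_moment r1 r2 : 0 < r1 < 1 -> 0 < r2 < 1 ->
  avg (fun t => Re (y r1 t)) = avg (fun t => Re (y r2 t)).
Proof.
wlog r12 : r1 r2 / r1 <= r2 => [H h1 h2|/andP[r10 r11] /andP[r20 r21]].
  by have [|/ltW] := leP r1 r2 => ?; [|apply/esym]; exact: H.
apply: (@circle_avg_const _ 0 1 r1 r2 (fun z => phi z / z)) => // z /andP[z0 z1].
apply: holoM; first exact: sphi.1.
by apply: holoV; [rewrite -normc_gt0 | exact: holo_id].
Qed.

(** The mean does not depend on the radius, and at radius 1/2 one has [|phi z / z| <= 2]. *)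
Let first_moment_ge r : 0 < r < 1 -> -2 <= avg (fun t => Re (y r t)).
Proof.
move=> r01; have h : 0 < (2^-1 : R) < 1 by apply/andP; split; lra.
rewrite (first_moment r01 h) -[leLHS]avg_cst; apply: le_avg.
- exact: continuous_cstf.
- exact: tcont_Re (tcont_y h).
- move=> t; have := le_trans (normRe_le _) (y_le t h); rewrite invrK ler_norml => /andP[]; lra.
Qed.

Let cont_logsum n r x : 0 < r < 1 -> continuous (fun t => Re (logsum n (x%:C * y r t))).
Proof.
move=> r01; apply: tcont_Re.
have : tcont (fun t => - - logsum n (x%:C * y r t)).
  apply: tcontN; apply: (@tcont_comp _ (fun z => - logsum n (x%:C * z))); first exact: tcont_y.
  by move=> t; apply: holo_ccont; apply: (@hol_logsum _ x%:C n (1 + normc (y r t))); rewrite ltrDr ltr01.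
by under eq_fun do rewrite opprK.
Qed.

Let avg_logsum n r x : 0 < r < 1 -> avg (fun t => Re (logsum n (x%:C * y r t))) =
  \sum_(i < n) x ^+ i.+1 * (avg (fun t => Re (y r t ^+ i.+1)) / i.+1%:R).
Proof.
move=> r01; elim: n => [|n IH].
  by rewrite big_ord0 -[RHS]avg_cst; apply: eq_avg => t; rewrite /logsum big_ord0.
have cX k : continuous (fun t => Re (y r t ^+ k)) by apply: tcont_Re; apply: tcontX; exact: tcont_y.
have cl := @cont_logsum n r x r01.
have E t : Re ((x%:C * y r t) ^+ n.+1 / n.+1%:R) = x ^+ n.+1 / n.+1%:R * Re (y r t ^+ n.+1).
  by rewrite Re_logsum_term; ring.
rewrite big_ord_recr/= -IH; under eq_avg do rewrite /logsum big_ord_recr/= cReD E.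
have c2 : continuous (fun t => x ^+ n.+1 / n.+1%:R * Re (y r t ^+ n.+1)).
  by apply: continuousMf => //; exact: continuous_cstf.
by rewrite avgD// avgZ//; congr (_ + _); ring.
Qed.

Let pavg0 (h : R -> R) : pavg 0 h = avg h.
Proof.
apply: eq_avg => t; rewrite /pk subr0 normc_polar normr1 normc0 expr0n/= subr0 expr1n divr1.
by rewrite mul1r.
Qed.

(** Log-subharmonicity at the origin for [z - x phi] on the circle of radius [r], with shift
    [r - x]. There [|z - x phi| >= r - x], so the shift at most doubles the modulus, and [2 <= e]
    gives the summand 1. The second error is the truncation of the logarithmic series. *)
Let log_bound r x : phi 0 != 0 -> 0 < x -> x < r -> 0 < r < 1 -> forall n,
  ln (x * normc (phi 0)) <= 1 + (x / r) ^+ n / (1 - x / r)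
     - \sum_(i < n) x ^+ i.+1 * (avg (fun t => Re (y r t ^+ i.+1)) / i.+1%:R).
Proof.
move=> phi0 x0 xr r01 n; have /andP[r0 r1] := r01.
have th1 : x / r < 1 by rewrite ltr_pdivrMr// mul1r.
pose g z := z - x%:C * phi z.
have hg : hol 1 g.
  move=> z z1; apply: holoB; first exact: holo_id.
  by apply: holoM; [exact: holo_cst | exact: sphi.1].
have hG := hol_dilate r0 hg.
have B1 : 1 < 1 / r by rewrite ltr_pdivlMr// mul1r.
have d0 : 0 < r - x by rewrite subr_gt0.
have n01 : normc (0 : R[i]) < 1 by rewrite normc0.
have := logsub_hol B1 hG n01 d0; rewrite pavg0 mulr0 {1}/g sub0r normcN normcM normc_real gtr0_norm//.
have p0 : 0 < normc (phi 0) by rewrite normc_gt0.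
rewrite -[X in X <= _ -> _]lnK ?posrE ?mulr_gt0// ler_expR => /le_trans; apply.
have xy t : normc (x%:C * y r t) <= x / r.
  by rewrite normcM normc_real gtr0_norm// ler_wpM2l ?(ltW x0)// y_le.
have gE t : normc (g (polar r t)) = r * normc (1 - x%:C * y r t).
  rewrite -{2}(normc_polar_gt t r0) -normcM; congr normc; rewrite /g /y mulrBr mulr1.
  by congr (_ - _); field; exact: polar_neq0.
have pos t : 0 < normc (1 - x%:C * y r t).
  by rewrite normc_gt0 sub1_neq0// (le_lt_trans (xy t)).
have gm t : r - x <= normc (g (polar r t)).
  rewrite gE; have := normc_leB 1 (x%:C * y r t); rewrite normc1 => h1.
  have h2 := xy t; apply: (@le_trans _ _ (r * (1 - x / r))).
    by rewrite mulrBr mulr1 mulrCA divff ?mulr1// gt_eqF.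
  by apply: ler_wpM2l; [exact: ltW | lra].
have c1 : continuous (fun t => Re (logsum n (x%:C * y r t))).
  exact: cont_logsum.
set th := x / r in th1 xy *.
have cc : continuous (fun t => (1 + th ^+ n / (1 - th)) - Re (logsum n (x%:C * y r t))).
  by apply: continuousDf; [exact: continuous_cstf | move=> t; apply: cvgN; exact: c1].
rewrite -avg_logsum// -[X in _ <= X - _]avg_cst -avgB//; last exact: continuous_cstf.
apply: le_avg => //; first exact: (ucont_ln (hol_ucont B1 hG) d0).
move=> t; rewrite -polarE.
have g0 : 0 < normc (g (polar r t)) by exact: lt_le_trans (gm t).
have l1 : ln (normc (g (polar r t)) + (r - x)) <= ln (normc (g (polar r t))) + 1.
  have gp : 0 < normc (g (polar r t)) + (r - x) by lra.
  rewrite -ler_expR expRD !lnK ?posrE//.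
  apply: (@le_trans _ _ (normc (g (polar r t)) * 2)); first by have := gm t; lra.
  by rewrite ler_wpM2l ?(ltW g0)// (le_trans _ (expR_ge1Dx _)).
have l2 : ln (normc (g (polar r t))) <= ln (normc (1 - x%:C * y r t)).
  by rewrite ler_ln ?posrE// gE ler_piMl ?(ltW (pos t))// ltW.
have := ln_normc_approx n (xy t) th1; rewrite ler_norml => /andP[_ l3].
lra.
Qed.

Let harmonic_bound : phi 0 != 0 -> forall M, (0 < M)%N ->
  ln (normc (phi 0) / 2) <= 4 - (\sum_(1 <= i < M) (i.+1%:R : R)^-1) / 4.
Proof.
move=> phi0 M M0; have p0 : 0 < normc (phi 0) by rewrite normc_gt0.
have M1 : 1 <= (M%:R : R) by rewrite ler1n.
(* Bernoulli's inequality then gives [x ^+ M >= 1/2], so the terms of index below [M] keep a fixed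
   part of their harmonic size. *)
pose x : R := 1 - (2 * M%:R)^-1.
have iM : 0 < (2 * M%:R : R)^-1 by rewrite invr_gt0; lra.
have iM2 : (2 * M%:R : R)^-1 <= 1 / 2 by rewrite mul1r lef_pV2 ?posrE; lra.
have x2 : 1 / 2 <= x by rewrite /x; lra.
have x1 : x < 1 by rewrite /x; lra.
have x0 : 0 < x by lra.
pose r := (1 + x) / 2.
have r01 : 0 < r < 1 by rewrite /r; apply/andP; split; lra.
have /andP[r0 r1] := r01.
have xr : x < r by rewrite /r; lra.
have th1 : x / r < 1 by rewrite ltr_pdivrMr// mul1r.
have th0 : 0 <= x / r by rewrite divr_ge0 ?ltW.
have [N MN HN] : exists2 N, (M <= N)%N & (x / r) ^+ N / (1 - x / r) <= 1.
  have : (fun n => (x / r) ^+ n * (1 - x / r)^-1) @ \oo --> 0 * (1 - x / r)^-1.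
    by apply: cvgM; [apply: cvg_expr; rewrite ger0_norm | exact: cvg_cst].
  rewrite mul0r => /cvgrPdist_le /(_ _ ltr01)[N _ HN]; exists (maxn M N); first exact: leq_maxl.
  by have := HN (maxn M N) (leq_maxr _ _); rewrite /= sub0r normrN; exact: le_trans (ler_norm _).
have := log_bound phi0 x0 xr r01 N.
set S := \sum_(i < N) _ => HS.
apply: (@le_trans _ _ (ln (x * normc (phi 0)))).
  by rewrite ler_ln ?posrE ?divr_gt0 ?mulr_gt0// mulrC ler_wpM2r ?(ltW p0)//; lra.
apply: (le_trans HS).
have xM i : (i < M)%N -> 1 / 2 <= x ^+ i.+1.
  move=> iM'; apply: (@le_trans _ _ (x ^+ M)); last by rewrite ler_wiXn2l ?(ltW x0) ?(ltW x1).
  have bern (k : nat) : 1 - k%:R * (2 * M%:R)^-1 <= x ^+ k.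
    elim: k => [|k IH]; first by rewrite expr0 mul0r subr0.
    rewrite exprS; have u0 : 0 <= (k%:R : R) by rewrite ler0n.
    have := ler_wpM2l (ltW x0) IH; rewrite -natr1.
    move: iM; set e := (2 * M%:R)^-1 => e0; rewrite {1 2}/x -/e.
    have : 0 <= k%:R * e * e by rewrite !mulr_ge0// ltW.
    by rewrite /x -/e; lra.
  have := bern M; rewrite invfM mulrCA divff ?mulr1; last by rewrite gt_eqF//; lra.
  by lra.
(* The 4 is 1 for the shift, 1 for the truncation and 2 for the first moment. The divisor 4 combines
   [x ^+ i.+1 >= 1/2] with moments at least 1/2; terms of index [M] or more are nonnegative. *)
suff : -2 + (\sum_(1 <= i < M) (i.+1%:R : R)^-1) / 4 <= S by lra.
pose a i := x ^+ i.+1 * (avg (fun t => Re (y r t ^+ i.+1)) / i.+1%:R).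
have -> : S = \sum_(0 <= i < N) a i by rewrite big_mkord.
have xi i : 0 <= x ^+ i by rewrite exprn_ge0// ltW.
have ai i : (0 < i)%N -> 0 <= a i.
  move=> i0; rewrite mulr_ge0// divr_ge0// (le_trans _ (@moments i.+1 r _ r01))//; lra.
rewrite [leRHS]big_ltn ?(leq_trans M0)//; apply: lerD.
  have := first_moment_ge r01; rewrite /a expr1 divr1 => h.
  by under eq_avg do rewrite expr1; nra.
have -> : \sum_(1 <= i < N) a i = \sum_(1 <= i < M) a i + \sum_(M <= i < N) a i.
  by apply: big_cat_nat.
rewrite -[leLHS]addr0; apply: lerD; last first.
  by rewrite big_nat_cond sumr_ge0// => i /andP[/andP[/(leq_trans M0) i0 _] _]; exact: ai.
rewrite mulr_suml !big_nat; apply: ler_sum => i /andP[i0 iM'].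
have h1 := xM i iM'; have h2 := @moments i.+1 r i0 r01.
have i1 : 0 <= (i.+1%:R : R)^-1 by rewrite invr_ge0.
have h3 := ler_wpM2r i1 h2.
rewrite /a; apply: (@le_trans _ _ (1 / 2 * (1 / 2 / i.+1%:R))).
  by move: (_^-1) i1 => u u0; lra.
by apply: ler_pM; [lra | rewrite divr_ge0//; lra | exact: h1 | exact: h3].
Qed.

Let phi0_eq0 : phi 0 = 0.
Proof.
apply/eqP/negP => /negP /harmonic_bound H.
have := @dvg_harmonic R; apply.
apply: nondecreasing_is_cvgn.
  by apply/nondecreasing_seqP => n; rewrite /series/= big_nat_recr//= lerDl /harmonic/= invr_ge0.
exists (1 + 4 * (4 - ln (normc (phi 0) / 2))) => _ [n _ <-].
have := H n.+1 isT; rewrite /series/= => Hn.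
apply: (@le_trans _ _ (\sum_(0 <= i < n.+1) harmonic i)).
  by rewrite big_nat_recr//= lerDl /harmonic/= invr_ge0.
rewrite big_ltn// [harmonic 0%N]invr1; apply: lerD => //.
have -> : \sum_(1 <= i < n.+1) harmonic i = \sum_(1 <= i < n.+1) (i.+1%:R : R)^-1 by [].
lra.
Qed.

Lemma ccontX f n z : ccont f z -> ccont (fun z => f z ^+ n) z.
Proof.
move=> cf; elim: n => [|n IH].
  by move=> e e0; exists 1 => // h _; rewrite !expr0 subrr normc0.
by under eq_fun do rewrite exprS; exact: (ccontM cf IH).
Qed.

(** As [phi 0 = 0], the quotient [phi z / z] extends continuously to the origin by [d = phi'(0)],
    and the mean value property with one exceptional point applies. The factor [k] recovers a
    complex identity from real parts. *)
Let deriv_moment : exists d, forall (k : R[i]) n r, 0 < r < 1 ->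
  avg (fun t => Re (k * y r t ^+ n)) = Re (k * d ^+ n).
Proof.
have n01 : normc (0 : R[i]) < 1 by rewrite normc0.
have [d dE] := holo_cdiff (sphi.1 0 n01); exists d => k n r /andP[r0 r1].
pose Y z := if z == 0 then d else phi z / z.
have hY z : normc z < 1 -> z != 0 -> holo Y z.
  move=> z1 z0; have nz : 0 < normc z by rewrite normc_gt0.
  apply: (@near_eq_holo _ _ (fun z => phi z / z) _ _ nz).
    move=> x xz; rewrite /Y ifF//; apply: contraTF xz => /eqP ->.
    by rewrite sub0r normcN ltxx.
  apply: holoM; first exact: sphi.1.
  by apply: holoV; [exact: z0 | exact: holo_id].
have cY : con 1 Y.
  move=> z z1; have [->|z0] := eqVneq z 0; last by apply: holo_ccont; exact: hY.
  move=> e e0; have e2 : 0 < e / 2 by lra.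
  have [l l0 H] := dE _ e2; exists l => // h /H; rewrite phi0_eq0 !add0r subr0 => hk.
  rewrite /Y eqxx; have [h0|h0] := eqVneq h 0; first by rewrite subrr normc0.
  have h1 : 0 < normc h by rewrite normc_gt0.
  rewrite -(ltr_pM2r h1) -normcM mulrBl divfK//; apply: le_lt_trans hk _.
  by rewrite ltr_pM2r//; lra.
have cG : con 1 (fun z => k * Y z ^+ n).
  move=> z z1; apply: (@ccontM _ (fun=> k)); first by apply: holo_ccont; exact: holo_cst.
  by apply: ccontX; exact: cY.
have hG z : normc z < 1 -> z != 0 -> holo (fun z => k * Y z ^+ n) z.
  by move=> z1 z0; apply: holoM; [exact: holo_cst | apply: holoX; exact: hY].
have r01 : 0 <= r < 1 by rewrite (ltW r0).
have := mean_value_except cG hG r01; rewrite {2}/Y eqxx => <-.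
by apply: eq_avg => t; rewrite /Y (negbTE (polar_neq0 t r0)).
Qed.

(** It must be shown that [d = 1]. First [|d| <= 1], since [|phi z / z| <= 1 / r] on circles of
    radius [r] close to 1; then the powers [d^2] and [d^3] are forced to be 1. *)
Let deriv1 : forall (k : R[i]) n r, 0 < r < 1 -> avg (fun t => Re (k * y r t ^+ n)) = Re k.
Proof.
have [d Hd] := deriv_moment.
have Hm n r : 0 < r < 1 -> avg (fun t => Re (y r t ^+ n)) = Re (d ^+ n).
  by move=> r01; have := Hd 1 n r r01; rewrite mul1r => <-; apply: eq_avg => t; rewrite mul1r.
have h2 : 0 < (2^-1 : R) < 1 by apply/andP; split; lra.
have d1 : normc d <= 1.
  rewrite leNgt; apply/negP => d1; have [k k1 kE] := norm_as_Re d.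
  pose r := (1 + (normc d)^-1) / 2.
  have i0 : 0 < (normc d)^-1 by rewrite invr_gt0; lra.
  have i1 : (normc d)^-1 < 1 by rewrite invf_lt1//; lra.
  have r01 : 0 < r < 1 by rewrite /r; apply/andP; split; lra.
  have /andP[r0 r1] := r01.
  have := Hd k 1%N r r01; rewrite expr1 kE => H.
  have : normc d <= r^-1.
    rewrite -H -[leRHS]avg_cst; apply: le_avg; [|exact: continuous_cstf|].
      apply: tcont_Re; apply: tcontM; first exact: tcont_cst.
      by apply: tcontX; exact: tcont_y.
    move=> t; apply: le_trans (Re_le_normc _) _; rewrite expr1 normcM.
    by apply: le_trans (y_le t r01); rewrite ler_piMl ?normc_ge0.
  rewrite -[normc d]invrK lef_pV2 ?posrE//; rewrite /r; lra.
have dn n : normc (d ^+ n) <= 1 by rewrite normcX exprn_ile1// normc_ge0.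
have Rd n : (2 <= n)%N -> 1 / 2 <= Re (d ^+ n) by move=> n2; rewrite -(Hm n _ h2) moments.
(* For [u = d^n], [1 - Re (u^2) >= (1 - Re u) (1 + Re u)] and [Re u >= 1/2], so squaring multiplies
   the defect [1 - Re u] by at least 3/2. The defect never exceeds 1/2, hence it is 0; the factor
   [1 + k / 2] below is Bernoulli's bound for the iterates. *)
have dbl n : (2 <= n)%N -> 3 / 2 * (1 - Re (d ^+ n)) <= 1 - Re (d ^+ (n * 2)).
  move=> n2; rewrite exprM; have := Rd n n2; have := dn n.
  move: (d ^+ n) => u u1 ua; rewrite expr2 cReM.
  have : Re u ^+ 2 + Im u ^+ 2 <= 1 by rewrite -sqr_normcE expr_le1// normc_ge0.
  have := Re_le_normc u; nra.
have pow n k : (2 <= n)%N -> (1 + k%:R / 2) * (1 - Re (d ^+ n)) <= 1 / 2.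
  move=> n2; have [m m2 H] : exists2 m, (2 <= m)%N & (1 + k%:R / 2) * (1 - Re (d ^+ n)) <= 1 - Re (d ^+ m).
    elim: k => [|k [m m2 IH]]; first by exists n => //; rewrite mul0r addr0 mul1r.
    exists (m * 2)%N; first by rewrite (leq_trans m2)// leq_pmulr.
    apply: le_trans (dbl m m2); have a0 : 0 <= 1 - Re (d ^+ n).
      by rewrite subr_ge0 (le_trans (Re_le_normc _)).
    have a1 : 1 - Re (d ^+ n) <= (1 + k%:R / 2) * (1 - Re (d ^+ n)).
      by rewrite ler_peMl// lerDl divr_ge0.
    rewrite -natr1; lra.
  by apply: le_trans H _; have := Rd m m2; lra.
have R1 n : (2 <= n)%N -> d ^+ n = 1.
  move=> n2; have a0 : 0 <= 1 - Re (d ^+ n) by rewrite subr_ge0 (le_trans (Re_le_normc _)).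
  have Re1 : Re (d ^+ n) = 1.
    apply/eqP; rewrite -subr_eq0 -oppr_eq0 opprB eq_le a0 andbT leNgt; apply/negP => a1.
    have [k Hk] : exists k : nat, (1 - Re (d ^+ n))^-1 < k%:R.
      by exists (Num.bound (1 - Re (d ^+ n))^-1); apply: archi_boundP; rewrite invr_ge0.
    have := pow n k n2; move: Hk; rewrite -[X in X < _]mul1r ltr_pdivrMr//; lra.
  apply: complex_eqP => //=; apply/eqP.
  have : normc (d ^+ n) ^+ 2 <= 1 by rewrite expr_le1// normc_ge0.
  by rewrite sqr_normcE Re1 expr1n gerDl => H; rewrite -sqrf_eq0 eq_le H sqr_ge0.
have d11 : d = 1 by have := R1 3%N isT; rewrite exprS R1// mulr1.
by move=> k n r r01; rewrite Hd// d11 expr1n mulr1.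
Qed.

(** With [y = phi / z], the mean of [Re y] is 1 and [|y| <= 1 / r], so the mean of [|y - 1|^2] is at
    most [r^-2 - 1], which tends to 0 as [r -> 1]. The Poisson bound with exponent 1 transfers this
    to the given point. *)
Lemma selfmap_id z : normc z < 1 -> phi z = z.
Proof.
move=> z1; have nz0 := normc_ge0 z.
apply/eqP; rewrite -subr_eq0 -normc_eq0 eq_le normc_ge0 andbT.
apply/ler_addgt0Pr => e e0; rewrite add0r.
(* The 16 is [2 * 4 * 2]: the factor of [poisson_powR] at exponent 1, the kernel bound
   [4 / (1 - |z|)], and the bound [2 * s] on the mean. *)
pose c := 16 / (1 - normc z).
have c0 : 0 < c by rewrite divr_gt0//; lra.
have [s [s0 s1 sc]] : exists s : R, [/\ 0 < s, s <= 1 & c * s <= e].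
  exists (Num.min 1 (e / c)); split.
  - by rewrite lt_min ltr01 divr_gt0.
  - by rewrite ge_min lexx.
  - by rewrite mulrC -ler_pdivlMr// ge_min lexx orbT.
have s20 : 0 < s ^+ 2 by rewrite exprn_gt0.
pose r := Num.max ((1 + normc z) / 2) (1 + s ^+ 2)^-1.
have r1 : r < 1 by rewrite gt_max invf_lt1; lra.
have rz : (1 + normc z) / 2 <= r by rewrite le_max lexx.
have rs : (1 + s ^+ 2)^-1 <= r by rewrite le_max lexx orbT.
have r0 : 0 < r by lra.
have r01 : 0 < r < 1 by rewrite r0.
have ir : r^-1 <= 1 + s ^+ 2.
  by rewrite -[leRHS]invrK lef_pV2 ?posrE// invr_gt0; lra.
have hF : hol (1 / r) (fun u => phi (r%:C * u) - r%:C * u).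
  move=> u ur; apply: holoB; first exact: (hol_dilate r0 sphi.1).
  by apply: holoM; [exact: holo_cst | exact: holo_id].
have B1 : 1 < 1 / r by rewrite ltr_pdivlMr// mul1r.
have rC : r%:C != 0 by rewrite -normc_gt0 normc_real gtr0_norm.
pose w := r%:C^-1 * z.
have nw : normc w = normc z / r by rewrite normcM normcV normc_real gtr0_norm// mulrC.
have w1 : normc w < 1 by rewrite nw ltr_pdivrMr// ; lra.
have wz : (1 - normc z) / 2 <= 1 - normc w.
  have : normc w <= 1 - (1 - normc z) / 2 by rewrite nw ler_pdivrMr//; nra.
  lra.
have := poisson_powR B1 hF w1 ltr01.
have -> : r%:C * w = z by rewrite /w mulrA divff// mul1r.
rewrite !powRr1 ?normc_ge0// => /le_trans; apply.
have cF := hol_ucont B1 hF.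
have cn := tcont_normc cF.
rewrite (_ : (fun t => _) = (fun t => normc (phi (r%:C * polar 1 t) - r%:C * polar 1 t))); last first.
  by apply/funext => t; rewrite powRr1 ?normc_ge0.
have A : pavg w (fun t => normc (phi (r%:C * polar 1 t) - r%:C * polar 1 t)) <=
    4 / (1 - normc z) * avg (fun t => normc (phi (r%:C * polar 1 t) - r%:C * polar 1 t)).
  rewrite -avgZ//; apply: le_avg.
  - by apply: continuousMf => //; exact: pk_continuous.
  - by apply: continuousMf => //; exact: continuous_cstf.
  - move=> t; rewrite ler_wpM2r ?normc_ge0// (le_trans (pk_le t w1))//.
    rewrite ler_pdivrMr ?subr_gt0// mulrAC ler_pdivlMr ?subr_gt0//; lra.
have Bd : avg (fun t => normc (phi (r%:C * polar 1 t) - r%:C * polar 1 t)) <= 2 * s.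
  have cy := tcont_y r01.
  have c1 : continuous (fun t => normc (y r t) ^+ 2).
    by under eq_fun do rewrite expr2; apply: continuousMf; exact: tcont_normc.
  have ry : continuous (fun t => Re (1 * y r t ^+ 1)).
    by apply: tcont_Re; apply: tcontM; [exact: tcont_cst | exact: tcontX].
  have cq : continuous (fun t => (s + s^-1) / 2 + (2 * s)^-1 * normc (y r t) ^+ 2 - s^-1 * Re (1 * y r t ^+ 1)).
    move=> t; apply: cvgB; last by apply: cvgM; [exact: cvg_cst | exact: ry].
    by apply: cvgD; [exact: cvg_cst | apply: cvgM; [exact: cvg_cst | exact: c1]].
  (* The inequality [|y - 1| <= (s^2 + |y - 1|^2) / (2 s)] stands in for Cauchy-Schwarz; expanding
     the square leaves only [|y|^2] and [Re y]. *)
  apply: (@le_trans _ _ (avg (fun t => (s + s^-1) / 2 + (2 * s)^-1 * normc (y r t) ^+ 2 - s^-1 * Re (1 * y r t ^+ 1)))).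
    apply: le_avg => // t; rewrite -polarE mul1r expr1.
    have -> : phi (polar r t) - polar r t = polar r t * (y r t - 1).
      by rewrite /y mulrBr mulr1 mulrCA divff ?mulr1// polar_neq0.
    rewrite normcM normc_polar_gt//.
    have n0 := normc_ge0 (y r t - 1).
    apply: (@le_trans _ _ (normc (y r t - 1))); first by rewrite ler_piMl// ltW.
    have -> : (s + s^-1) / 2 + (2 * s)^-1 * normc (y r t) ^+ 2 - s^-1 * Re (y r t) =
       (s ^+ 2 + normc (y r t - 1) ^+ 2) / (2 * s).
      by rewrite !sqr_normcE cReB cImB subr0 /=; field; rewrite gt_eqF.
    rewrite ler_pdivlMr ?mulr_gt0//.
    have := sqr_ge0 (s - normc (y r t - 1)); nra.
  rewrite avgB; last 2 first.
  - by apply: continuousDf; [exact: continuous_cstf | apply: continuousMf => //; exact: continuous_cstf].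
  - by apply: continuousMf => //; exact: continuous_cstf.
  rewrite avgD; [|exact: continuous_cstf|by apply: continuousMf => //; exact: continuous_cstf].
  rewrite avg_cst !avgZ// deriv1// mulr1.
  have av : avg (fun t => normc (y r t) ^+ 2) <= 1 + 3 * s ^+ 2.
    rewrite -[leRHS]avg_cst; apply: le_avg => //; first exact: continuous_cstf.
    move=> t; have := le_trans (y_le t r01) ir; have := normc_ge0 (y r t).
    move=> h0 h1; apply: (@le_trans _ _ ((1 + s ^+ 2) ^+ 2)); first by rewrite lerXn2r ?nnegrE//; lra.
    have : s ^+ 2 * s ^+ 2 <= s ^+ 2 by rewrite ler_piMl ?expr_le1 ?(ltW s0) ?(ltW s20).
    nra.
  have i2s : 0 <= (2 * s)^-1 by rewrite invr_ge0; lra.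
  have := ler_wpM2l i2s av.
  have -> : (2 * s)^-1 * (1 + 3 * s ^+ 2) = (2 * s)^-1 + 3 / 2 * s by field; rewrite gt_eqF.
  have -> : (s + s^-1) / 2 = s / 2 + (2 * s)^-1 by field; rewrite gt_eqF.
  have -> : s^-1 = 2 * (2 * s)^-1 by field; rewrite gt_eqF.
  lra.
have k0 : 0 <= 4 / (1 - normc z) by rewrite divr_ge0//; lra.
apply: le_trans sc; rewrite /c.
have := ler_wpM2l k0 Bd; lra.
Qed.

End SelfmapRigidity.

(** * Weighted norms of monomials *)

Section Monomials.
Variable R : realType.
Local Notation mu := (@lebesgue_measure R).
Implicit Types (f g h : R[i] -> R[i]) (p : \bar R) (r x b q : R).

Lemma mp_scale_le p f r (l : R) : (0 < p)%E -> 0 < l -> con 1 f -> con 1 (fun z => l%:C * f z) ->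
  0 <= r < 1 -> mp p (fun z => l%:C * f z) r <= l * mp p f r.
Proof.
move=> p0 l0 cf clf r01; case: p p0 => [p| |]// p0.
  rewrite lte_fin in p0; rewrite /mp !Mp_fin//=.
  have c1 := circ_powR p0 cf r01.
  rewrite (_ : avg _ = l `^ p * avg (fun t => normc (f (polar r t)) `^ p)).
    rewrite powRM ?powR_ge0//; last by apply: avg_nonneg => t; exact: powR_ge0.
    by rewrite -powRrM divff ?gt_eqF// powRr1// ltW.
  rewrite -avgZ//; apply: eq_avg => t.
  by rewrite normcM normc_real gtr0_norm// powRM ?normc_ge0// ltW.
have [S SE HS] := Mp_oo cf r01; apply: mp_le => // t; rewrite /mp SE/=.
by rewrite normcM normc_real gtr0_norm// ler_wpM2l// ltW.
Qed.

(** A Chebyshev argument at level [k = e / 2]: where [|h|] exceeds [k], the a priori bound 2 is at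
    most [2 (|h| / k)^p]. That bound is what lets a mean of order [p < 1] control the mean of order
    1. *)
Lemma small_mean p (e : R) : (0 < p)%E -> 0 < e -> exists2 m : R, 0 < m &
  forall h r, con 1 h -> 0 <= r < 1 -> (forall t, normc (h (polar r t)) <= 2) ->
  mp p h r <= m -> avg (fun t => normc (h (polar r t))) <= e.
Proof.
case: p => [p| |]// p0 e0; last first.
  exists e => // h r ch r01 _; have [S SE HS] := Mp_oo ch r01; rewrite /mp SE/= => Se.
  rewrite -[leRHS]avg_cst; apply: le_avg; [exact: circ_normc | exact: continuous_cstf |].
  by move=> t; exact: le_trans Se.
rewrite lte_fin in p0; pose k := e / 2; have k0 : 0 < k by rewrite /k; lra.
have T0 : 0 < e / 4 * k `^ p by rewrite mulr_gt0 ?powR_gt0//; lra.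
have [m m0 mE] := powR_small p0 T0.
exists m => // h r ch r01 h2; rewrite /mp Mp_fin//= => hm.
have cp := circ_powR p0 ch r01.
have kp : 0 < k `^ p by rewrite powR_gt0.
have A0 : 0 <= avg (fun t => normc (h (polar r t)) `^ p) by apply: avg_nonneg => t; exact: powR_ge0.
have Am : avg (fun t => normc (h (polar r t)) `^ p) <= e / 4 * k `^ p.
  rewrite -mE -[leLHS]powRr1// -(mulVf (lt0r_neq0 p0)) powRrM.
  by apply: powR_le; [exact: ltW | exact: powR_ge0 |].
have cq : continuous (fun t => k + 2 / k `^ p * normc (h (polar r t)) `^ p).
  apply: continuousDf; first exact: continuous_cstf.
  by apply: continuousMf => //; exact: continuous_cstf.
apply: (@le_trans _ _ (avg (fun t => k + 2 / k `^ p * normc (h (polar r t)) `^ p))).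
  apply: le_avg => //; first exact: circ_normc.
  move=> t; have [hk|kh] := leP (normc (h (polar r t))) k.
    by rewrite (le_trans hk)// lerDl mulr_ge0 ?powR_ge0// divr_ge0// ltW.
  apply: (le_trans (h2 t)); rewrite -[leLHS]add0r lerD ?(ltW k0)// mulrAC ler_pdivlMr//.
  by rewrite ler_wpM2l//; apply: powR_le; exact: ltW.
rewrite avgD ?avg_cst; [|exact: continuous_cstf|by apply: continuousMf => //; exact: continuous_cstf].
rewrite avgZ//; have : 2 / k `^ p * avg (fun t => normc (h (polar r t)) `^ p) <= e / 2.
  rewrite mulrAC ler_pdivrMr//; lra.
by rewrite /k; lra.
Qed.

(** Up to a constant, a majorant of [(1 - x)^(b - 1) x^(n q)] that has the explicit primitive [Phi];
    it avoids Beta function asymptotics while keeping the sharp order [n^(-b)]. *)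
Let G b n x : R := (1 - x) `^ (b - 1) * (1 + n * (1 - x)) `^ (- (b + 1)).
Let Phi b n x : R := - b^-1 * ((1 - x) `^ b * (1 + n * (1 - x)) `^ (- b)).

Let D_gt0 (n x : R) : 0 <= n -> x < 1 -> 0 < 1 + n * (1 - x).
Proof. by move=> n0 x1; rewrite ltr_wpDr// mulr_ge0// subr_ge0 ltW. Qed.

Let dPhi b (n x : R) : 0 < b -> 0 <= n -> x < 1 -> is_derive x 1 (Phi b n) (G b n x).
Proof.
move=> b0 n0 x1; have D0 := D_gt0 n0 x1; have A0 : 0 < 1 - x by rewrite subr_gt0.
have d1 : is_derive x 1 (fun x : R => 1 - x) (-1).
  have := is_deriveB (is_derive_cst (1 : R) x 1) (is_derive_id x (1 : R)).
  by rewrite sub0r.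
have d2 : is_derive x 1 (fun x : R => 1 + n * (1 - x)) (- n).
  have := is_deriveD (is_derive_cst (1 : R) x 1) (is_deriveM (is_derive_cst n x 1) d1).
  by rewrite scaler0 addr0 add0r [_ *: _]mulrN1.
have e1 := @is_derive1_comp _ (fun z => z `^ b) (fun x : R => 1 - x) _ _ _ (is_derive1_powR b A0) d1.
have e2 := @is_derive1_comp _ (fun z => z `^ (- b)) (fun x : R => 1 + n * (1 - x)) _ _ _ (is_derive1_powR (- b) D0) d2.
have := is_deriveM (is_derive_cst (- b^-1) x 1) (is_deriveM e1 e2).
rewrite scaler0 addr0 => H; apply: (is_derive_eq H).
rewrite /G /= /cst; set A := 1 - x; set D := 1 + n * A.
rewrite -[_ *: _]/(_ * _) -[_ *: (_ * - n)]/(_ * _) -[_ *: (_ * -1)]/(_ * _).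
have -> : A `^ b = A * A `^ (b - 1) by rewrite mulr_powRB1// ltW.
have -> : - b - 1 = - (b + 1) by ring.
have -> : D `^ (- b) = D * D `^ (- (b + 1)).
  have Dn : D != 0 by rewrite gt_eqF.
  by rewrite -[X in X * _](powRr1 (ltW D0)) -powRD ?Dn ?implybT//; congr (_ `^ _); ring.
have : b != 0 by rewrite gt_eqF.
by move: (A `^ _) (D `^ _) => u v bn; rewrite /D; field.
Qed.

Let int_G b (n d : R) : 0 < b -> 0 < n -> 0 < d < 1 ->
  (\int[mu]_(x in `[0%R, d]) (G b n x)%:E <= (b^-1 * n `^ (- b))%:E)%E.
Proof.
move=> b0 n0 /andP[d0 d1].
have cont (F : R -> R) x : derivable F x 1 -> {for x, continuous F}.
  by move=> dF; apply: differentiable_continuous; apply/derivable1_diffP.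
have cPhi x : x < 1 -> {for x, continuous (Phi b n)}.
  by move=> x1; apply: cont; have [] := dPhi b0 (ltW n0) x1.
rewrite (@continuous_FTC2 _ _ (Phi b n))//.
- rewrite -EFinB lee_fin /Phi !subr0 !mulr1 powR1 mul1r !mulNr opprK addrC -mulrBr.
  rewrite ler_wpM2l ?invr_ge0 ?(ltW b0)//.
  apply: (@le_trans _ _ ((1 + n) `^ (- b))); first by rewrite gerBl mulr_ge0 ?powR_ge0.
  rewrite !powRN lef_pV2 ?posrE ?powR_gt0//; last by rewrite addr_gt0.
  by apply: powR_le; [exact: ltW | exact: ltW | rewrite lerDr].
- apply: continuous_in_subspaceT => x; rewrite inE/= in_itv/= => /andP[x0 xd].
  have x1 := le_lt_trans xd d1.
  have A0 : 0 < 1 - x by rewrite subr_gt0.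
  have c1 : {for x, continuous (fun x : R => 1 - x)} by apply: cvgB; [exact: cvg_cst | exact: cvg_id].
  have c2 : {for x, continuous (fun x : R => 1 + n * (1 - x))}.
    by apply: cvgD; [exact: cvg_cst | apply: cvgM; [exact: cvg_cst | exact: c1]].
  have pw (e y : R) : 0 < y -> {for y, continuous (fun z => z `^ e)}.
    by move=> y0; apply: cont; apply: derivable_powR; rewrite in_itv/= y0.
  apply: cvgM.
    by apply: (@continuous_comp _ _ _ (fun x : R => 1 - x) (fun z => z `^ (b - 1))) => //; exact: pw.
  apply: (@continuous_comp _ _ _ (fun x : R => 1 + n * (1 - x)) (fun z => z `^ (- (b + 1)))) => //.
  by apply: pw; apply: D_gt0 => //; exact: ltW.
- split.
  + by move=> x; rewrite in_itv/= => /andP[_ xd]; have [] := dPhi b0 (ltW n0) (lt_trans xd d1).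
  + by apply: cvg_at_right_filter; exact: cPhi.
  + by apply: cvg_at_left_filter; exact: cPhi.
- move=> x; rewrite in_itv/= => /andP[_ xd]; rewrite derive1E.
  by have [_ ->] := dPhi b0 (ltW n0) (lt_trans xd d1).
Qed.

(** With [y = n (1 - r)] one has [r^n <= exp (- y)]; the exponential is beaten down to a power by
    [ln u < u] at [u = s (1 + y)], and the choice [s = q / (b + 1)] matches the coefficients of
    [y]. *)
Let exp_dom q b : 0 < q -> 0 < b -> exists2 K : R, 0 < K &
  forall (n : nat) r, 0 <= r < 1 -> (r ^+ n) `^ q <= K * (1 + n%:R * (1 - r)) `^ (- (b + 1)).
Proof.
move=> q0 b0; pose s := q / (b + 1).
have b1 : 0 < b + 1 by lra.
have s0 : 0 < s by rewrite divr_gt0.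
exists (expR (q - (b + 1) * ln s)); first exact: expR_gt0.
move=> n r /andP[r0 r1].
have y0 : 0 <= n%:R * (1 - r) by rewrite mulr_ge0// subr_ge0 ltW.
set y := n%:R * (1 - r) in y0 *.
have Y0 : 0 < 1 + y by lra.
apply: (@le_trans _ _ (expR (- y) `^ q)).
  apply: powR_le; [exact: ltW | exact: exprn_ge0 |].
  have -> : - y = n%:R * (r - 1) by rewrite /y; ring.
  rewrite expRM_natl; apply: lerXn2r; rewrite ?nnegrE ?expR_ge0//.
  by apply: le_trans (expR_ge1Dx _); lra.
rewrite -expRM /powR gt_eqF// -expRD ler_expR.
have := ltW (ln_sublinear (mulr_gt0 s0 Y0)); rewrite lnM ?posrE// => h.
have := ler_wpM2l (ltW b1) h; have -> : (b + 1) * (s * (1 + y)) = q * (1 + y).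
  by rewrite /s; field; rewrite gt_eqF.
lra.
Qed.

Lemma conX n : con 1 (fun z : R[i] => z ^+ n).
Proof. by apply: hol_con => z _; apply: holoX; exact: holo_id. Qed.

Lemma con_scale (l : R) f : con 1 f -> con 1 (fun z => l%:C * f z).
Proof.
move=> cf z z1; apply: (@ccontM _ (fun=> l%:C)); last exact: cf.
by apply: holo_ccont; exact: holo_cst.
Qed.

Lemma monomial_wint p q b : (0 < p)%E -> 0 < q -> 0 < b -> exists2 K : R, 0 < K &
  forall (n : nat) (l : R), (0 < n)%N -> 0 < l ->
  (wint (wmp p q b (fun z => l%:C * z ^+ n)%R) <= (l `^ q * (K * n%:R `^ (- b)))%R%:E)%E.
Proof.
move=> p0 q0 b0; have [K K0 HK] := exp_dom q0 b0.
exists (K / b); first by rewrite divr_gt0.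
move=> n l n0 l0; have nR : 0 < (n%:R : R) by rewrite ltr0n.
have cl := con_scale l (conX n).
apply: wint_le_lim => [r||d /andP[d0 d1]]; first exact: wmp_ge0.
  exact: wmp_measurable.
have mG : measurable_fun `[0%R, d] (G b n%:R).
  apply: measurable_funTS; apply: measurable_funM.
    by apply: (measurableT_comp (measurable_powR _)); apply: measurable_funB; [exact: measurable_cst | exact: measurable_id].
  apply: (measurableT_comp (measurable_powR _)); apply: measurable_funD; first exact: measurable_cst.
  apply: measurable_funM; first exact: measurable_cst.
  by apply: measurable_funB; [exact: measurable_cst | exact: measurable_id].
have G0 x : 0 <= G b n%:R x by rewrite mulr_ge0 ?powR_ge0.
apply: (@le_trans _ _ (\int[mu]_(x in `[0%R, d]) ((l `^ q * K)%:E * (G b n%:R x)%:E))%E).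
  apply: ge0_le_integral => //.
  - by move=> r _; rewrite lee_fin wmp_ge0.
  - apply/measurable_EFinP; apply: measurable_funS (wmp_measurable q b p0 cl) => //.
    by apply: subset_itvl; rewrite bnd_simp.
  - by apply: measurable_funeM; exact/measurable_EFinP.
  - move=> r; rewrite /= in_itv/= => /andP[r0 rd]; rewrite -EFinM lee_fin.
    have r01 : 0 <= r < 1 by rewrite r0 (le_lt_trans rd).
    rewrite /wmp /G mulrCA ler_wpM2l ?wt_ge0//.
    apply: (@le_trans _ _ ((l * r ^+ n) `^ q)).
      apply: powR_le; [exact: ltW | exact: mp_ge0 |].
      apply: mp_le => // t; rewrite normcM normcX normc_real normc_polar gtr0_norm//.
      by rewrite ger0_norm.
    by rewrite powRM ?(ltW l0) ?exprn_ge0// -mulrA ler_wpM2l ?powR_ge0// HK.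
rewrite ge0_integralZl//; last 3 first.
- exact/measurable_EFinP.
- by move=> x _; rewrite lee_fin.
- by rewrite lee_fin mulr_ge0 ?powR_ge0// ltW.
apply: (@le_trans _ _ ((l `^ q * K)%:E * (b^-1 * n%:R `^ (- b))%:E)%E).
  rewrite lee_wpmul2l ?lee_fin ?mulr_ge0 ?powR_ge0 ?(ltW K0)//.
  by apply: int_G; rewrite ?d0.
by rewrite -EFinM lee_fin !mulrA.
Qed.

End Monomials.

(** * From a small operator norm to the identity *)

Section UniformContinuity.
Variable R : realType.
Local Notation mu := (@lebesgue_measure R).
Local Notation Re := (@complex.Re R).
Implicit Types (f g h : R[i] -> R[i]) (p : \bar R) (r x b q : R).

(** Otherwise, on [[1 - 1/n, 1 - 1/(2n)]], of length [1/(2n)], the weight is at least [k n^(1 - b)]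
    and the power of the mean exceeds [4 T / k]; the integral would be at least [2 T n^(-b)]. *)
Lemma exists_small_radius p q b h (n : nat) (T : R) : (0 < p)%E -> 0 < q -> 0 < b -> con 1 h ->
  (2 <= n)%N -> 0 < T -> (wint (wmp p q b h) <= (T * n%:R `^ (- b))%R%:E)%E ->
  exists2 r, 1 - n%:R^-1 <= r < 1 & mp p h r `^ q <= 4 * T / (1 / 2) `^ (b + 1).
Proof.
move=> p0 q0 b0 ch n2 T0 Hw; apply: contrapT => /forall2NP H.
have nR : 2 <= (n%:R : R) by rewrite ler_nat.
set N : R := n%:R in nR H Hw *.
have N0 : 0 < N by lra.
have i0 : 0 < N^-1 by rewrite invr_gt0.
have i1 : N^-1 <= 1 / 2 by rewrite mul1r lef_pV2 ?posrE; lra.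
have k0 : 0 < (1 / 2 : R) `^ (b + 1) by rewrite powR_gt0//; lra.
(* The exponent [b + 1] handles both signs of [b - 1]: for [u] in [[1/2, 1]],
   [u^(b - 1) >= u^(b + 1) >= k]. *)
set k := (1 / 2 : R) `^ (b + 1) in k0 H.
pose M := 4 * T / k; have M0 : 0 < M by rewrite divr_gt0//; lra.
have wtge r : 1 - N^-1 <= r <= 1 - N^-1 / 2 -> k * N `^ (1 - b) <= wt b r.
  move=> /andP[h1 h2]; have r1 : r < 1 by lra.
  rewrite (wt_dilate b N0 r1) mulrC ler_wpM2l ?powR_ge0// /wt.
  rewrite (_ : 1 - (1 - N * (1 - r)) = N * (1 - r)); last by ring.
  have X1 : N * (1 - r) <= 1 by rewrite mulrC -ler_pdivlMr// div1r; lra.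
  have X2 : 1 / 2 <= N * (1 - r) by rewrite [N * _]mulrC -ler_pdivrMr//; lra.
  apply: (@le_trans _ _ ((N * (1 - r)) `^ (b + 1))); last first.
    by apply: ger_powR; [apply/andP; split; lra | lra].
  by apply: powR_le; [lra | lra | exact: X2].
pose S : set R := `[1 - N^-1, 1 - N^-1 / 2]%classic.
have mS : measurable S by exact: measurable_itv.
have SI : S `<=` `[0, 1[%classic.
  by move=> r; rewrite /S /= !in_itv/= => /andP[? ?]; apply/andP; split; lra.
have mw := wmp_measurable q b p0 ch.
have : ((k * N `^ (1 - b) * M)%:E * mu S <= (T * N `^ (- b))%:E)%E.
  rewrite -integral_cst//.
  apply: le_trans Hw; apply: (@le_trans _ _ (\int[mu]_(r in S) (wmp p q b h r)%:E)%E).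
    apply: ge0_le_integral => //.
    - by move=> r _; rewrite lee_fin; apply: mulr_ge0; [exact: mulr_ge0 (ltW k0) (powR_ge0 _ _) | exact: ltW M0].
    - by apply/measurable_EFinP; apply: measurable_funS mw.
    - move=> r; rewrite /S /= in_itv/= => rS; rewrite lee_fin.
      have rI : 1 - N^-1 <= r < 1 by move: rS => /andP[? ?]; apply/andP; split; lra.
      have [//|/negP] := H r; rewrite -ltNge => Mr.
      by apply: ler_pM; [rewrite mulr_ge0 ?powR_ge0// ltW | exact: ltW | exact: wtge | exact: ltW].
  apply: ge0_subset_integral => //; first exact/measurable_EFinP.
  by move=> r _; rewrite lee_fin wmp_ge0.
rewrite /S lebesgue_measure_itv/= lte_fin ifT; last by lra.
rewrite -EFinB -EFinM lee_fin (_ : 1 - N^-1 / 2 - (1 - N^-1) = N^-1 / 2); last by lra.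
have -> : N `^ (1 - b) = N * N `^ (- b).
  by rewrite powRD ?powRr1 ?(ltW N0)// (gt_eqF N0) implybT.
have Nb : 0 < N `^ (- b) by rewrite powR_gt0.
have -> : k * (N * N `^ (- b)) * M * (N^-1 / 2) = 2 * (T * N `^ (- b)).
  by rewrite /M; field; rewrite !gt_eqF.
have := mulr_gt0 T0 Nb; lra.
Qed.

(** [exp (2 / n) >= 1 + 2 / n], and [(1 + 2 / n) (1 - 1 / n) >= 1] as soon as [n >= 2]. *)
Lemma expR2_expr (n : nat) r : (2 <= n)%N -> 1 - n%:R^-1 <= r -> 1 <= expR 2 * r ^+ n.
Proof.
move=> n2 nr; have nR : 2 <= (n%:R : R) by rewrite ler_nat.
have -> : expR 2 = expR (2 / n%:R) ^+ n :> R.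
  by rewrite -expRM_natl mulrCA divff ?mulr1// gt_eqF//; lra.
rewrite -exprMn exprn_ege1//.
have i0 : 0 < (n%:R : R)^-1 by rewrite invr_gt0; lra.
have i1 : (n%:R : R)^-1 <= 1 / 2 by rewrite mul1r lef_pV2 ?posrE; lra.
apply: (@le_trans _ _ ((1 + 2 / n%:R) * (1 - n%:R^-1))); first by move: (_^-1) i0 i1 => u; nra.
apply: ler_pM; [| | exact: expR_ge1Dx | exact: nr]; lra.
Qed.

(** The mean may be moved to radius [r0], where [|1 - (phi / z)^n| <= e^2 |phi^n - z^n|]; the bound
    [e^(-2) / 2] on the mean then leaves at least 1/2. *)
Lemma moment_ge phi (n : nat) r0 r : selfmap phi -> (2 <= n)%N -> 0 < r0 < 1 ->
  1 - n%:R^-1 <= r0 -> 0 < r < 1 ->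
  avg (fun t => normc (phi (polar r0 t) ^+ n - polar r0 t ^+ n)) <= expR (-2) / 2 ->
  1 / 2 <= avg (fun t => Re ((phi (polar r t) / polar r t) ^+ n)).
Proof.
move=> sphi n2 r01 nr rr H.
have pol0 s t : 0 < s -> polar s t != 0 :> R[i].
  by move=> s0; rewrite -normc_gt0 normc_polar gtr0_norm.
have cst r1 r2 : 0 < r1 < 1 -> 0 < r2 < 1 -> r1 <= r2 ->
    avg (fun t => Re ((phi (polar r1 t) / polar r1 t) ^+ n)) =
    avg (fun t => Re ((phi (polar r2 t) / polar r2 t) ^+ n)).
  move=> /andP[r10 _] /andP[_ r21] r12.
  apply: (@circle_avg_const _ 0 1 r1 r2 (fun z => (phi z / z) ^+ n)) => // z /andP[z0 z1].
  apply: holoX; apply: holoM; first exact: sphi.1.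
  by apply: holoV; [rewrite -normc_gt0 | exact: holo_id].
have -> : avg (fun t => Re ((phi (polar r t) / polar r t) ^+ n)) =
    avg (fun t => Re ((phi (polar r0 t) / polar r0 t) ^+ n)).
  by have [|/ltW] := leP r r0 => ?; [|apply/esym]; exact: cst.
have /andP[r00 r0l] := r01.
have r01' : 0 <= r0 < 1 by rewrite (ltW r00).
have hh : hol 1 (fun z => phi z ^+ n - z ^+ n).
  by move=> z z1; apply: holoB; [apply: holoX; exact: sphi.1 | apply: holoX; exact: holo_id].
have cn := circ_normc (hol_con hh) r01'.
have cphi : tcont (fun t => phi (polar r0 t)) by exact: tcont_circle (hol_con sphi.1).
have cy : continuous (fun t => Re ((phi (polar r0 t) / polar r0 t) ^+ n)).
  apply: tcont_Re; apply: tcontX; apply: tcontM => //.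
  by apply: tcontV; [move=> t; exact: pol0 | exact: tcont_polar].
have cc : continuous (fun t => 1 - expR 2 * normc (phi (polar r0 t) ^+ n - polar r0 t ^+ n)).
  by move=> t; apply: cvgB; [exact: cvg_cst | apply: cvgM; [exact: cvg_cst | exact: cn]].
apply: (@le_trans _ _ (avg (fun t => 1 - expR 2 * normc (phi (polar r0 t) ^+ n - polar r0 t ^+ n)))).
  rewrite avgB; [|exact: continuous_cstf|by apply: continuousMf => //; exact: continuous_cstf].
  rewrite avg_cst avgZ//; have := ler_wpM2l (expR_ge0 2) H.
  have -> : expR 2 * (expR (-2) / 2) = 1 / 2 :> R by rewrite mulrA -expRD subrr expR0.
  lra.
apply: le_avg => // t; set z := polar r0 t; set w := phi z.
have z0 : z != 0 by exact: pol0.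
have zn : normc z = r0 by rewrite normc_polar gtr0_norm.
have Rn : 0 < r0 ^+ n by rewrite exprn_gt0.
have e1 : normc (1 - (w / z) ^+ n) <= expR 2 * normc (w ^+ n - z ^+ n).
  have -> : 1 - (w / z) ^+ n = - ((w ^+ n - z ^+ n) * (z ^+ n)^-1).
    by rewrite expr_div_n mulrBl divff ?expf_neq0// opprB.
  rewrite normcN normcM normcV normcX zn mulrC ler_wpM2r ?normc_ge0//.
  by rewrite -div1r ler_pdivrMr// expR2_expr.
have := le_trans (Re_le_normc _) e1; rewrite cReB (_ : Re 1 = 1)//; lra.
Qed.

(** The threshold [e] is chosen before [phi], so that it can be compared with the operator norm at
    all small times at once. *)
Lemma small_opnorm_id p q alpha : (0 < p)%E -> 0 < q -> 0 < alpha -> exists2 e : R, 0 < e &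
  forall phi, selfmap phi ->
  (forall f, Hspace p q alpha f -> (Hnorm p q alpha f <= 1)%E ->
     (Hnorm p q alpha (fun z => f (phi z) - f z)%R <= e%:E)%E) ->
  forall z, normc z < 1 -> phi z = z.
Proof.
move=> p0 q0 a0; pose b := alpha * q; have b0 : 0 < b by rewrite mulr_gt0.
have [K K0 HK] := monomial_wint p0 q0 b0.
have e20 : 0 < expR (-2) / 2 :> R by rewrite divr_gt0// expR_gt0.
have [m m0 Hm] := small_mean p0 e20.
have k0 : 0 < (1 / 2 : R) `^ (b + 1) by rewrite powR_gt0//; lra.
set k := (1 / 2 : R) `^ (b + 1) in k0.
have E0 : 0 < k * m `^ q / (4 * K) by rewrite divr_gt0// mulr_gt0// powR_gt0.
(* This value makes the final estimate independent of [n]: [4 T / k] with [T = e^q n^b / b], divided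
   by [l^q = n^b / (b K)], equals [m^q]. *)
have [e e0 eE] := powR_small q0 E0; exists e => // phi sphi H.
apply: (selfmap_id sphi) => n r n2 r01.
have nR : 2 <= (n%:R : R) by rewrite ler_nat.
have n0 : 0 < (n%:R : R) by lra.
have nb0 : 0 < (n%:R : R) `^ b by rewrite powR_gt0.
have nbN : (n%:R : R) `^ (- b) = (n%:R `^ b)^-1 by rewrite powRN.
have L0 : 0 < (n%:R : R) `^ b / (b * K) by rewrite divr_gt0// mulr_gt0.
(* Normalises the test function: by [monomial_wint], [b] times the weighted integral of [l z^n] is
   at most [b l^q K n^(-b) = 1]. *)
have [l l0 lE] := powR_small q0 L0.
pose f (z : R[i]) := l%:C * z ^+ n.
pose h z := phi z ^+ n - z ^+ n.
have hf : hol 1 f by move=> z z1; apply: holoM; [exact: holo_cst | apply: holoX; exact: holo_id].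
have hh : hol 1 h.
  by move=> z z1; apply: holoB; [apply: holoX; exact: sphi.1 | apply: holoX; exact: holo_id].
have cf := hol_con hf; have ch := hol_con hh; have clh := con_scale l ch.
have n1 : (0 < n)%N by exact: ltn_trans n2.
have wf : (wint (wmp p q b f) <= (b^-1)%:E)%E.
  apply: le_trans (HK n l n1 l0) _; rewrite lee_fin lE nbN le_eqVlt; apply/orP; left; apply/eqP.
  by field; rewrite !gt_eqF.
have fin : (Hnorm p q alpha f < +oo)%E.
  by apply/Hnorm_lty => //; apply: le_lt_trans wf _; rewrite ltry.
have nf : (Hnorm p q alpha f <= 1)%E.
  rewrite HnormE// -/b.
  have w0 : (0 <= wint (wmp p q b f))%E by apply: wint_ge0 => s; exact: wmp_ge0.
  move: wf w0; case: (wint _) => [x| |]// => xb x0; rewrite !lee_fin in xb x0.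
  rewrite -EFinM poweR_EFin lee_fin; apply: (@le_trans _ _ (1 `^ q^-1)); last by rewrite powR1.
  apply: powR_le.
  - by rewrite invr_ge0 ltW.
  - by rewrite mulr_ge0// ltW.
  - by rewrite mulrC -ler_pdivlMr// div1r.
have := H f (conj hf fin) nf.
have -> : (fun z => f (phi z) - f z) = (fun z => l%:C * h z).
  by apply/funext => z; rewrite /f /h mulrBr.
move=> He.
have wh : (wint (wmp p q b (fun z => l%:C * h z)%R) <= (e `^ q / b * n%:R `^ b * n%:R `^ (- b))%R%:E)%E.
  have fin' := (Hnorm_lty p0 q0 a0 clh).1 (le_lt_trans He (ltry _)).
  move: He fin'; rewrite HnormE// -/b.
  have w0 : (0 <= wint (wmp p q b (fun z => l%:C * h z)%R))%E by apply: wint_ge0 => s; exact: wmp_ge0.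
  move: w0; case: (wint _) => [x| |]// x0; rewrite lee_fin in x0.
  rewrite -EFinM poweR_EFin lee_fin => xe _.
  rewrite lee_fin nbN mulfK ?gt_eqF// ler_pdivlMr// mulrC.
  have bx : 0 <= b * x by rewrite mulr_ge0// ltW.
  rewrite -[leLHS](powRr1 bx) -(mulVf (lt0r_neq0 q0)) powRrM.
  by apply: powR_le => //; [exact: ltW | exact: powR_ge0].
have T0 : 0 < e `^ q / b * n%:R `^ b by rewrite mulr_gt0// divr_gt0// powR_gt0.
have [r1 /andP[r1n r11] Hr1] := exists_small_radius p0 q0 b0 clh n2 T0 wh.
have i1 : (n%:R : R)^-1 <= 1 / 2 by rewrite mul1r lef_pV2 ?posrE; lra.
have r10 : 0 < r1 by lra.
apply: (@moment_ge phi n r1 r sphi n2) => //; first by rewrite r10.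
have r1' : 0 <= r1 < 1 by rewrite (ltW r10).
apply: (Hm h r1 ch r1') => [t|].
  have n1' : normc (polar r1 t) < 1 by rewrite normc_polar gtr0_norm.
  have X (s : R[i]) : normc s < 1 -> normc (s ^+ n) <= 1.
    by move=> s1; rewrite normcX exprn_ile1 ?normc_ge0// ltW.
  apply: le_trans (le_normcB _ _) _.
  by have := X _ n1'; have := X _ (sphi.2 _ n1'); lra.
rewrite leNgt; apply/negP => mh.
have li0 : 0 < l^-1 by rewrite invr_gt0.
have hE : (fun z => l^-1%:C * (l%:C * h z)) = h.
  by apply/funext => z; rewrite mulrA -realcM mulVf ?gt_eqF// mul1r.
have := @mp_scale_le _ p (fun z => l%:C * h z) r1 l^-1 p0 li0 clh; rewrite hE => /(_ ch r1') Hl.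
have := lt_le_trans mh Hl => /(gt0_ltr_powR q0); rewrite !nnegrE (ltW m0).
have mlh := mp_ge0 p0 clh r1'.
rewrite mulr_ge0 ?(ltW li0)// => /(_ isT isT).
rewrite powRM ?(ltW li0)// => Hlt.
have lq : l^-1 `^ q = (l `^ q)^-1 by rewrite -[l^-1]powR_inv1 ?(ltW l0)// -powRrM mulN1r powRN.
have := lt_le_trans Hlt (ler_wpM2l (powR_ge0 _ _) Hr1).
rewrite lq lE eE -/k; set A := n%:R `^ b; set B := m `^ q.
have -> : (A / (b * K))^-1 * (4 * (k * B / (4 * K) / b * A) / k) = B.
  by rewrite /A; field; rewrite !gt_eqF.
by rewrite ltxx.
Qed.

(** Every time is a whole multiple of one shorter than [d], and the semigroup law iterates the
    identity. *)
Lemma semigroup_id (phi : R -> R[i] -> R[i]) (d : R) : analytic_semigroup phi -> 0 < d ->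
  (forall t, 0 < t < d -> forall z, disk z -> phi t z = z) ->
  forall t, 0 <= t -> forall z, disk z -> phi t z = z.
Proof.
move=> [_ _ h0 hD _] d0 H t t0 z dz.
have step s : 0 <= s < d -> forall n : nat, phi (n%:R * s) z = z.
  move=> /andP[s0 sd]; have sz : phi s z = z.
    by move: s0; rewrite le_eqVlt => /orP[/eqP <-|s0]; [exact: h0 | apply: H => //; rewrite s0].
  elim=> [|n IH]; first by rewrite mul0r h0.
  by rewrite -natr1 mulrDl mul1r hD ?mulr_ge0// sz.
pose N := Num.bound (t / d).
have td : 0 <= t / d by rewrite divr_ge0// ltW.
have Nt : t / d < N%:R := archi_boundP td.
have N0 : 0 < (N%:R : R) by exact: le_lt_trans Nt.
have := step (t / N%:R) _ N; rewrite mulrCA divff ?gt_eqF// mulr1; apply.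
by rewrite divr_ge0 ?(ltW N0)//= ltr_pdivrMr// mulrC -ltr_pdivrMr.
Qed.

End UniformContinuity.

Theorem theorem4p2 (R : realType) (p : \bar R) (q alpha : R) :
  (0 < p)%E -> 0 < q -> 0 < alpha ->
  (* (a) strong continuity *)
  (forall phi : R -> R[i] -> R[i], analytic_semigroup phi ->
     forall f, Hspace p q alpha f ->
       (forall t, 0 <= t -> Hspace p q alpha (fun z => f (phi t z))) /\
       (Hnorm p q alpha (CtmI phi t f) @[t --> 0^'+] --> 0%E)) /\
  (* (b) no non-trivial uniformly continuous semigroup *)
  (forall phi : R -> R[i] -> R[i], analytic_semigroup phi ->
     (opnorm_CtmI p q alpha phi t @[t --> 0^'+] --> 0%E) ->
     forall t, 0 <= t -> forall z, disk z -> phi t z = z).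
Proof.
move=> p0 q0 a0; split => phi sg.
  move=> f [hf nf]; have wf := (Hnorm_lty p0 q0 a0 (hol_con hf)).1 nf; split; last first.
    exact: strong_continuity.
  move=> t t0; have st := semigroup_selfmap sg t0; have hft := hol_comp hf st.
  by split; [exact: hft | exact: (Hnorm_lty p0 q0 a0 (hol_con hft)).2 (wint_comp p0 q0 hf st wf)].
have [e e0 He] := small_opnorm_id p0 q0 a0.
move=> cv; have e0E : (0 < e%:E)%E by rewrite lte_fin.
have [d /= d0 Hd] : \forall t \near 0^'+, (opnorm_CtmI p q alpha phi t < e%:E)%E.
  apply: (cv [set x | (x < e%:E)%E]); apply: open_nbhs_nbhs.
  by split; [exact: open_ereal_lt_ereal | exact: e0E].
apply: (semigroup_id sg d0) => t /andP[t0 td].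
apply: He; first by apply: semigroup_selfmap => //; exact: ltW.
move=> f Hf nf; apply: (@le_trans _ _ (opnorm_CtmI p q alpha phi t)).
  by apply: ereal_sup_ubound; exists f.
by apply/ltW; apply: Hd => //=; rewrite sub0r normrN gtr0_norm.
Qed.
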